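(* Let $D>0$ and $0<\delta_0<1/2$, and consider the three-dimensional system of ordinary differential equations for $(h(t),r_2(t),r_1(t))$, depending on the real parameter $\tau$, $$\begin{cases}\dot h = r_2-r_1,\\ m_0\dot r_2=\sqrt2(\tau_c-\tau)r_2-g_3r_2^3+(G_0-G_1r_1)\,e^{-\frac{r_1+\phi(r_1)}{2D}h}-\delta_0,\\ m_0\dot r_1=\sqrt2(\tau_c-\tau)r_1-g_3r_1^3-(G_0+G_1r_2)\,e^{-\frac{-r_2+\phi(r_2)}{2D}h}+\delta_0,\end{cases}$$ where $\phi(r)=\sqrt{r^2+4D}$ and $m_0,\tau_c,g_3,G_0,G_1$ are the constants given in the context. Then $$(h,r_2,r_1)=(h^*,r^*,r^* )=\left(-\sqrt D\,\log(2\delta_0),\,0,\,0\right)$$ is a stationary solution of this system. Furthermore, as $\tau$ varies, this stationary solution undergoes a pitchfork bifurcation at $\tau=\tau_d$ and a Hopf bifurcation at $\tau=\tau_H$, where $$\tau_d=\tau_c-\sqrt2\,(G_1+G_0\phi_1h^* )\,\delta_0,\qquad \tau_H=\tau_c+\sqrt2\,(G_1+G_0\phi_1h^* )\,\delta_0,$$ with $\phi_1=1/(2D)$ and $h^*=-\sqrt D\log(2\delta_0)$.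
   Context: The constants are $m_0=\dfrac{3}{16\sqrt D}$, $\tau_c=\dfrac{1}{4\sqrt{2D}}$, $g_3=\dfrac{1}{32(\sqrt D)^3}$, $G_0=\dfrac12$, $G_1=\dfrac1{4\sqrt D}$. The overdot denotes $d/dt$. The bifurcation parameter is $\tau$, with all other parameters fixed. The number $\phi_1=1/(2D)$ is the coefficient of $r$ in the Taylor expansion at $r=0$ of $\frac{r+\phi(r)}{2D}$. *)

(* Defs.v *)
From HB Require Import structures.
From mathcomp Require Import all_boot all_order all_algebra.
From mathcomp Require Import complex.
From mathcomp Require Import all_classical all_reals all_analysis.

Set Implicit Arguments.
Unset Strict Implicit.
Unset Printing Implicit Defensive.

Import Order.TTheory GRing.Theory Num.Theory.
Import numFieldNormedType.Exports.

Local Open Scope classical_set_scope.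
Local Open Scope ring_scope.

Section bifurcation.
Context {R : realType} {n : nat}.
Implicit Types (f : 'rV[R]_n -> 'rV[R]_n) (F : R -> 'rV[R]_n -> 'rV[R]_n).
Implicit Types (p : 'rV[R]_n).

Definition solution f (x : R -> 'rV[R]_n) : Prop :=
  forall t : R, is_derive t 1 x (f (x t)).

Definition stationary f p : Prop := solution f (cst p).

(* [jacobian] acts on row vectors from the right, so it is the transpose of the
   usual Jacobian matrix; the spectrum is the same. *)
Definition linearization f p : 'M[R[i]]_n :=
  map_mx (real_complex R) (jacobian f p).

(* At mu0 the linearization at p has exactly the eigenvalues +/- i omega0 on the
   imaginary axis, they are simple, and they cross it with nonzero speed in mu.
   For omega0 = 0 this is a simple real eigenvalue passing through 0: by
   simplicity and invariance of the spectrum under conjugation, the branch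
   alpha mu + i omega mu is then real near mu0. *)
Definition eigenvalue_crossing F p (mu0 omega0 : R) : Prop :=
  let A mu := linearization (F mu) p in
  (exists alpha omega : R -> R,
    [/\ \forall mu \near mu0, eigenvalue (A mu) (alpha mu +i* omega mu)%C,
        alpha mu0 = 0 /\ omega mu0 = omega0,
        derivable alpha mu0 1 /\ 'D_1 alpha mu0 != 0 &
        {for mu0, continuous omega}]) /\
  mup (0 +i* omega0)%C (char_poly (A mu0)) = 1%N /\
  (forall y : R, eigenvalue (A mu0) (0 +i* y)%C -> y = omega0 \/ y = - omega0).

(* The stationary solution p loses or gains one unstable direction through a
   simple zero eigenvalue, and the number of stationary solutions near p goes
   from one to three: two continuous branches xp, xm emanate from p on exactly
   one side of mu0, namely mu > mu0 if s = 1 and mu < mu0 if s = -1. *)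
Definition pitchfork_bifurcation F p (mu0 : R) : Prop :=
  eigenvalue_crossing F p mu0 0 /\
  exists (s delta eps : R) (xp xm : R -> 'rV[R]_n),
    [/\ s = 1 \/ s = -1,
        0 < delta /\ 0 < eps,
        xp mu0 = p /\ xm mu0 = p,
        {within [set mu | 0 <= s * (mu - mu0) < delta], continuous xp} /\
        {within [set mu | 0 <= s * (mu - mu0) < delta], continuous xm} &
        forall mu : R, `|mu - mu0| < delta ->
          (s * (mu - mu0) <= 0 ->
             ball p eps `&` [set x | stationary (F mu) x] = [set p]) /\
          (0 < s * (mu - mu0) ->
             [/\ xp mu != p, xm mu != p, xp mu != xm mu &
                 ball p eps `&` [set x | stationary (F mu) x]
                   = [set p; xp mu; xm mu]])].

(* A pair of complex conjugate eigenvalues of the stationary solution p crosses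
   the imaginary axis at +/- i omega0, and a continuous family of periodic
   orbits emanates from p at mu0: x eps solves the system for the parameter
   value mu eps and has least period T eps. Joint continuity together with
   x 0 t = p makes the orbits shrink to p as eps -> 0. *)
Definition hopf_bifurcation F p (mu0 : R) : Prop :=
  (\forall mu \near mu0, stationary (F mu) p) /\
  exists omega0 : R, 0 < omega0 /\ eigenvalue_crossing F p mu0 omega0 /\
  exists (eps0 : R) (mu T : R -> R) (x : R -> R -> 'rV[R]_n),
    [/\ 0 < eps0,
        {within `[0, eps0[, continuous mu} /\ {within `[0, eps0[, continuous T},
        {within [set u : R * R | 0 <= u.1 < eps0],
           continuous (fun u => x u.1 u.2)},
        [/\ mu 0 = mu0, T 0 = 2 * pi / omega0 & forall t, x 0 t = p] &
        forall eps : R, 0 < eps < eps0 ->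
          [/\ solution (F (mu eps)) (x eps),
              0 < T eps,
              forall t, x eps (t + T eps) = x eps t &
              forall t, 0 < t < T eps -> x eps t != x eps 0]].

End bifurcation.

Section pulse.
Context {R : realType}.
Variables (D delta0 tau : R).

Definition m0 : R := 3 / (16 * Num.sqrt D).
Definition tau_c : R := 1 / (4 * Num.sqrt (2 * D)).
Definition g3 : R := 1 / (32 * Num.sqrt D ^+ 3).
Definition G0 : R := 1 / 2.
Definition G1 : R := 1 / (4 * Num.sqrt D).

Definition phi (r : R) : R := Num.sqrt (r ^+ 2 + 4 * D).

(* (r + phi r) / (2 * D) = 1 / sqrt D + phi1 * r + O(r ^ 2) as r -> 0 *)
Definition phi1 : R := 1 / (2 * D).

Definition rhs2 (h r2 r1 : R) : R :=
  Num.sqrt 2 * (tau_c - tau) * r2 - g3 * r2 ^+ 3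
  + (G0 - G1 * r1) * expR (- ((r1 + phi r1) / (2 * D)) * h) - delta0.

Definition rhs1 (h r2 r1 : R) : R :=
  Num.sqrt 2 * (tau_c - tau) * r1 - g3 * r1 ^+ 3
  - (G0 + G1 * r2) * expR (- ((- r2 + phi r2) / (2 * D)) * h) + delta0.

Definition state (h r2 r1 : R) : 'rV[R]_3 := \row_(i < 3) [:: h; r2; r1]`_i.

(* The system h' = r2 - r1, m0 r2' = rhs2, m0 r1' = rhs1 solved for the
   derivatives. *)
Definition pulse_field (x : 'rV[R]_3) : 'rV[R]_3 :=
  let h := x 0 0 in let r2 := x 0 1 in let r1 := x 0 2 in
  state (r2 - r1) (rhs2 h r2 r1 / m0) (rhs1 h r2 r1 / m0).

Definition hstar : R := - Num.sqrt D * ln (2 * delta0).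

Definition tau_d : R :=
  tau_c - Num.sqrt 2 * (G1 + G0 * phi1 * hstar) * delta0.

Definition tau_H : R :=
  tau_c + Num.sqrt 2 * (G1 + G0 * phi1 * hstar) * delta0.

End pulse.

(* Main.v *)
Require Import Defs.
From mathcomp Require Import all_boot all_order all_algebra.
From mathcomp Require Import complex.
From mathcomp Require Import all_classical all_reals all_analysis.
From mathcomp Require Import ring lra.

Set Implicit Arguments.
Unset Strict Implicit.
Unset Printing Implicit Defensive.

Import Order.TTheory GRing.Theory Num.Theory.
Import numFieldNormedType.Exports.

Local Open Scope classical_set_scope.
Local Open Scope ring_scope.

(* The field is equivariant under [(h, r2, r1) |-> (h, - r1, - r2)], so at the
   stationary point the linearization splits into the symmetric mode [r1 = r2], with
   the real eigenvalue responsible for the pitchfork, and the invariant plane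
   [r1 = - r2], which carries the imaginary pair at [tau_H].

   Hopf: the system restricted to the plane is rescaled to a small perturbation of a
   harmonic oscillator. In rotating coordinates, its periodic solutions, together
   with the corrections of the period and of the parameter, are the fixed points of
   a contraction depending in a Lipschitz way on the amplitude.

   Pitchfork: every stationary point has [r1 = r2 = r]. Eliminating [h] leaves one
   equation [eqn b k = 0], odd in [k = tanh (asinh (r / (2 sqrt D)) / 2)], with [b]
   proportional to [tau_d - tau] and expansion
   [- 4 b k + A3 k ^ 3 + A5 k ^ 5 + ...]. The cubic coefficient can vanish, but then
   the quintic one does not. In both cases, for small [k > 0], [eqn b] has no zero on
   one side of [b = 0], and on the other side [eqn b k / k ^ 2] is strictly monotone
   in [k] and has exactly one. *)

(** Hopf part: inserting [p + e *: w] and dividing by the amplitude [e] turns a remainder that is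
    quadratic at the stationary point into a perturbation of size [O(e)], Lipschitz in [e] down to
    [e = 0], where the oscillator is exactly harmonic. A quadratic Lipschitz bound on the remainder
    is therefore all the regularity that enters.

    Pitchfork part: the obstacle is the cubic coefficient, a function of [delta0] alone whose sign
    varies, so the side of the branches depends on [delta0]. Where it vanishes, the natural quotient
    [eqn b k / k] need not be monotone: its derivative contains [b * O(k)], which for fixed [b]
    beats the quintic contribution [k ^ 3] near [k = 0]. Dividing by [k ^ 2] instead turns [- 4 b k]
    into [- 4 b / k]. The derivative [4 b / k ^ 2] of that term has, on the side carrying the
    branches, the sign of the leading coefficient, and it absorbs the terms [b * O(1)]. *)

(** * Mean value estimates and differentiation rules *)

Lemma is_derive_continuous (R : realType) (f : R -> R) (x d : R) :
  is_derive x 1 f d -> {for x, continuous f}.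
Proof.
move=> [df _]; apply: differentiable_continuous.
exact/derivable1_diffP.
Qed.

Lemma MVT_le (R : realType) (f df : R -> R) (a b : R) :
  a <= b -> (forall x, a <= x <= b -> is_derive x 1 f (df x)) ->
  exists2 c, a <= c <= b & f b - f a = df c * (b - a).
Proof.
move=> ab fdf.
have [||c] := @MVT_segment R f df a b ab.
- by move=> x /[!in_itv]/= /andP[ax xb]; apply: fdf; rewrite !ltW.
- apply: continuous_in_subspaceT => x /[!inE]/= xab.
  by apply: is_derive_continuous; apply: fdf; move: xab; rewrite in_itv.
by rewrite in_itv /= => cab E; exists c.
Qed.

Lemma MVT_norm (R : realType) (f df : R -> R) (a b M : R) :
  (forall x, Num.min a b <= x <= Num.max a b -> is_derive x 1 f (df x)) ->
  (forall x, Num.min a b <= x <= Num.max a b -> `|df x| <= M) ->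
  `|f b - f a| <= M * `|b - a|.
Proof.
wlog ab : a b / a <= b => [hw|].
  move=> h1 h2; have [ab|/ltW ba] := leP a b; first exact: hw.
  by rewrite distrC (distrC b); apply: hw => // x; rewrite minC maxC; auto.
rewrite min_l // max_r // => fdf fM.
have [c cab ->] := MVT_le ab fdf.
by rewrite normrM ler_wpM2r // fM.
Qed.

Lemma MVT_normT (R : realType) (f df : R -> R) (M : R) :
  (forall x : R, is_derive x 1 f (df x)) -> (forall x, `|df x| <= M) ->
  forall a b, `|f b - f a| <= M * `|b - a|.
Proof. by move=> fdf fM a b; apply: MVT_norm => // x _. Qed.

Section derivation_rules.
Context {R : realType}.
Implicit Types f g : R -> R.

Lemma derD f g (x df dg : R) : is_derive x 1 f df -> is_derive x 1 g dg ->
  is_derive x 1 (fun s => f s + g s) (df + dg).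
Proof. by move=> hf hg; exact: is_deriveD. Qed.

Lemma derB f g (x df dg : R) : is_derive x 1 f df -> is_derive x 1 g dg ->
  is_derive x 1 (fun s => f s - g s) (df - dg).
Proof. by move=> hf hg; exact: is_deriveB. Qed.

Lemma derM f g (x df dg : R) : is_derive x 1 f df -> is_derive x 1 g dg ->
  is_derive x 1 (fun s => f s * g s) (df * g x + f x * dg).
Proof.
move=> hf hg; apply: is_derive_eq (is_deriveM hf hg) _.
by rewrite /GRing.scale /= mulrC addrC (mulrC df).
Qed.

Lemma derC (a x : R) : is_derive x 1 (fun _ : R => a) 0.
Proof. exact: is_derive_cst. Qed.

Lemma der_comp f g (x df dg : R) : is_derive (g x) 1 f df ->
  is_derive x 1 g dg -> is_derive x 1 (fun s => f (g s)) (df * dg).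
Proof. by move=> hf hg; exact: is_derive1_comp. Qed.

Lemma der_ext f g (x df dg : R) : is_derive x 1 f df ->
  (forall t, f t = g t) -> df = dg -> is_derive x 1 g dg.
Proof. by move=> h e <-; have <- : f = g by apply/funext. Qed.

Lemma derV f (x df : R) : f x != 0 ->
  is_derive x 1 f df -> is_derive x 1 (fun s => (f s)^-1) (- df / f x ^+ 2).
Proof.
move=> fx hf; apply: is_derive_eq (is_deriveV fx hf) _.
by rewrite /GRing.scale /= mulrC mulNr mulrN.
Qed.

Lemma derX n (x : R) :
  is_derive x 1 (fun t : R => t ^+ n.+1) (n.+1%:R * x ^+ n).
Proof.
elim: n => [|n IH].
  by apply: der_ext (is_derive_id x 1) _ _ => [t|]; rewrite ?expr1 ?mul1r.
apply: der_ext (derM (is_derive_id x 1) IH) _ _ => [t|]; first by rewrite [RHS]exprS.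
by rewrite mul1r mulrCA -exprS -[n.+2]add1n natrD mulrDl mul1r.
Qed.

End derivation_rules.

(** * Primitives of continuous functions on the whole line *)

Section primitive.
Context {R : realType}.
Implicit Types g : R -> R.

(** The integral from [a] is differentiable only to the right of [a]. Normalised by its value at 0,
    it does not depend on the choice of [a < 0], so the base point can move with [x]. *)
Lemma primitive_exists g : continuous g ->
  exists G : R -> R, G 0 = 0 /\ forall x : R, is_derive x 1 G (g x).
Proof.
move=> cg.
pose F (a x : R) := \int[lebesgue_measure]_(t in `[a, x]) g t.
have dF (a x : R) : a < x -> is_derive x 1 (F a) (g x).
  move=> ax; have [||||D E] := @continuous_FTC1_closed R g a x (x + 1).
  - by rewrite ltrDl.
  - apply: continuous_compact_integrable; first exact: segment_compact.
    exact: continuous_subspaceT.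
  - by [].
  - exact: cg.
  - by rewrite derive1E in E; exact: DeriveDef D E.
pose H a x := F a x - F a 0.
have dH (a x : R) : a < x -> is_derive x 1 (H a) (g x).
  move=> ax; have := dF a x ax => h.
  rewrite /H; have -> : g x = g x - 0 by rewrite subr0.
  by apply: is_deriveB.
have HE (a b x : R) : a < b -> b < 0 -> b < x -> H a x = H b x.
  move=> ab b0 bx.
  have dHH (y : R) : b < y -> is_derive y 1 (H a \- H b) (0 : R).
    move=> byy; have h1 := dH a y (lt_trans ab byy); have h2 := dH b y byy.
    by have := is_deriveB h1 h2; rewrite subrr.
  apply/eqP; rewrite -subr_eq0 -normr_le0.
  have := @MVT_norm R (H a \- H b) (cst 0) 0 x 0.
  have Ha c : H c 0 = 0 by rewrite /H subrr.
  rewrite /= !Ha !subr0 mul0r; apply => y.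
    case/andP => h _; apply: dHH; apply: lt_le_trans h.
    by rewrite lt_min b0.
  by move=> _; rewrite normr0.
exists (fun x => H (- `|x| - 1) x); split; first by rewrite /H subrr.
move=> x; pose a : R := - `|x| - 2.
have ax : a < x by rewrite /a; have := ler_norm (- x); rewrite normrN; lra.
apply: near_eq_is_derive (dH a x ax); last first.
near=> y; apply: HE.
- have : `|y| < `|x| + 1.
    near: y; apply: (@cvgr_lt R R (nbhs x) _ (fun y => `|y|) `|x|).
      exact: norm_continuous.
    by rewrite ltrDl.
  by rewrite /a; lra.
- by have := normr_ge0 y; lra.
- by have := ler_norm (- y); rewrite normrN; lra.
Unshelve. all: by end_near. Qed.

(** Chosen by [xget] to be total in [g]: operators such as [Phi] below can then be written down
    before any continuity is known. *)
Definition prim g : R -> R :=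
  xget 0 [set G | G 0 = 0 /\ forall x : R, is_derive x 1 G (g x)].

Lemma primP g : continuous g ->
  prim g 0 = 0 /\ forall x : R, is_derive x 1 (prim g) (g x).
Proof. by move=> /primitive_exists; apply: xgetPex. Qed.

Lemma prim0 g : continuous g -> prim g 0 = 0.
Proof. by move=> /primP[]. Qed.

Lemma is_derive_prim g (x : R) : continuous g -> is_derive x 1 (prim g) (g x).
Proof. by move=> /primP[]. Qed.

Lemma le_prim_dist f g M s : continuous f -> continuous g ->
  (forall x, `|f x - g x| <= M) -> `|prim f s - prim g s| <= M * `|s|.
Proof.
move=> cf cg fgM.
have := @MVT_normT R (prim f \- prim g) (f \- g) M _ fgM 0 s.
rewrite /= !prim0 // !subr0; apply => x.
by apply: is_deriveB; apply: is_derive_prim.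
Qed.

Lemma le_prim_norm g M s : continuous g ->
  (forall x, `|g x| <= M) -> `|prim g s| <= M * `|s|.
Proof.
move=> cg gM.
have := @MVT_normT R (prim g) g M (fun x => is_derive_prim x cg) gM 0 s.
by rewrite prim0 // !subr0.
Qed.

Lemma primD g T s : continuous g -> periodic g T ->
  prim g (s + T) = prim g s + prim g T.
Proof.
move=> cg pg; apply/eqP; rewrite [eqbRHS]addrC -subr_eq; apply/eqP.
have := @is_derive_0_is_cst R (fun s => prim g (s + T) - prim g s) s 0.
rewrite add0r (prim0 cg) subr0; apply => x.
have h := is_derive_prim x cg.
have h1 : is_derive (x + T) 1 (prim g) (g (x + T)) by exact: is_derive_prim.
have h2 : is_derive x 1 (fun s : R => s + T) 1 by exact: is_derive_shift.
have := @is_derive1_comp R (prim g) (fun s => s + T) x _ _ h1 h2.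
rewrite mulr1 pg => h3.
by have := is_deriveB h3 h; rewrite subrr.
Qed.

Lemma periodic_bound (f : R -> R) (T M : R) : 0 < T -> periodic f T ->
  (forall s, 0 <= s <= T -> `|f s| <= M) -> forall s, `|f s| <= M.
Proof.
move=> T0 pf fM s.
pose m := Num.floor (s / T).
have pfz (n : int) x : f (x + T *~ n) = f x.
  case: n => n; first exact: periodicn.
  by rewrite NegzE mulrNz -[LHS](periodicn pf n.+1) pmulrn subrK.
rewrite -(pfz (- m)) fM // mulrNz -mulrzr.
have /andP[h1 h2] : m%:~R <= s / T < (m + 1)%:~R by rewrite floor_itv ?num_real.
rewrite ler_pdivlMr // in h1; rewrite ltr_pdivrMr // intrD in h2.
by apply/andP; split; lra.
Qed.

End primitive.

(** * Fixed points of contractions, with pointwise bounds *)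

Lemma half_pow_small (R : realType) (c e : R) : 0 <= c -> 0 < e ->
  exists n, c / 2 ^+ n <= e.
Proof.
move=> c0 e0; pose n := Num.bound (c / e).
exists n; rewrite ler_pdivrMr ?exprn_gt0 //.
have : c / e < n%:R by apply: archi_boundP; rewrite divr_ge0 // ltW.
have : n%:R <= 2 ^+ n :> R by rewrite -natrX ler_nat ltnW // ltn_expl.
by rewrite ltr_pdivrMr //; nra.
Qed.

(** The map [d |-> d / 2 + m] has the attracting fixed point [2 * m]. This converts the contraction
    estimate into an estimate on the distance between fixed points of two different maps. *)
Lemma halving_bound (R : realType) (T : Type) (f : T -> R) (m d0 : R) :
  (forall d, (forall x, `|f x| <= d) -> forall x, `|f x| <= d / 2 + m) ->
  (forall x, `|f x| <= d0) -> forall x, `|f x| <= 2 * m.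
Proof.
move=> h hd x; have d00 : 0 <= d0 by exact: le_trans (hd x).
have it n : forall x, `|f x| <= d0 / 2 ^+ n + 2 * m.
  elim: n => [|n IH] {}x.
    have := h _ hd x; have := h _ (h _ hd) x; have := hd x.
    rewrite expr0; have := normr_ge0 (f x).
    have [] := leP 0 m; lra.
  have := h _ IH x; rewrite exprSr invfM mulrA; lra.
apply/ler_addgt0Pr => e e0.
by have [n hn] := half_pow_small d00 e0; have := it n x; lra.
Qed.

(** Banach's theorem on a class [P] closed under uniform limits. At each point the limit is the
    infimum of the upper ends of nested intervals of radius [E n] about the iterates. *)
Lemma contraction_fixpoint (R : realType) (T : Type) (P : (T -> R) -> Prop)
    (Phi : (T -> R) -> T -> R) (u0 : T -> R) (c : R) :
  P u0 -> (forall u, P u -> P (Phi u)) ->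
  (forall u, (forall e : R, 0 < e -> exists2 v, P v & forall t, `|v t - u t| <= e) ->
    P u) ->
  (forall u v (d : R), P u -> P v -> (forall t, `|u t - v t| <= d) ->
    forall t, `|Phi u t - Phi v t| <= d / 2) ->
  (forall t, `|Phi u0 t - u0 t| <= c) ->
  exists2 u, P u & forall t, Phi u t = u t.
Proof.
move=> Pu0 PPhi clP ctr hc.
pose v n := iter n Phi u0.
have Pv n : P (v n) by elim: n => //= n; exact: PPhi.
have step n t : `|v n.+1 t - v n t| <= c / 2 ^+ n.
  elim: n t => [|n IH] t; first by rewrite expr0 divr1 hc.
  rewrite exprSr invfM mulrA.
  exact: (ctr _ _ _ (Pv n.+1) (Pv n) IH).
(* A negative [c] leaves no point in [T], and [u0] is vacuously fixed. *)
have [c0|c0] := ltP c 0.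
  exists u0 => // t; have := hc t; have := normr_ge0 (Phi u0 t - u0 t).
  by lra.
(* The tail, from [n] on, of the geometric series bounding the steps. *)
pose E n : R := c / 2 ^+ n * 2.
have E0 n : 0 <= E n by rewrite /E mulr_ge0 // mulr_ge0 // invr_ge0 exprn_ge0.
have ES n : E n.+1 = c / 2 ^+ n.
  by rewrite /E exprSr invfM mulrA divfK // pnatr_eq0.
have hi n m t : v (n + m)%N t + E (n + m)%N <= v n t + E n.
  elim: m => [|m IH]; first by rewrite addn0.
  rewrite addnS ES; apply: le_trans IH.
  have := step (n + m)%N t; rewrite ler_norml => /andP[_].
  by rewrite /E; lra.
have lo n m t : v n t - E n <= v (n + m)%N t - E (n + m)%N.
  elim: m => [|m IH]; first by rewrite addn0.
  rewrite addnS ES; apply: (le_trans IH).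
  have := step (n + m)%N t; rewrite ler_norml => /andP[+ _].
  by rewrite /E; lra.
have cross n m t : v n t - E n <= v m t + E m.
  have h1 := lo n m t; have h2 := hi m n t; rewrite addnC in h2.
  by have := E0 (n + m)%N; lra.
pose u t := inf [set v n t + E n | n in [set: nat]].
have uhi n t : u t <= v n t + E n.
  apply: ge_inf; last by exists n.
  by exists (v 0%N t - E 0%N) => _ [m _ <-]; exact: cross.
have ulo n t : v n t - E n <= u t.
  apply: lb_le_inf; first by exists (v 0%N t + E 0%N); exists 0%N.
  by move=> _ [m _ <-]; exact: cross.
have uv n t : `|v n t - u t| <= E n.
  by rewrite ler_norml; have := uhi n t; have := ulo n t; lra.
have Esmall (e : R) : 0 < e -> exists n, E n <= e.
  move=> e0; have [|n hn] := @half_pow_small R (2 * c) e _ e0.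
    by rewrite mulr_ge0.
  by exists n; rewrite /E mulrAC (mulrC c).
have Pu : P u.
  by apply: clP => e e0; have [n En] := Esmall e e0; exists (v n) => // t;
     exact: le_trans (uv n t) En.
exists u => // t; apply/eqP; rewrite -subr_eq0 -normr_le0.
apply/ler_addgt0Pr => e e0; rewrite add0r.
have [n En] := Esmall (e / 2) ltac:(lra).
have h1 := ctr _ _ _ (Pv n) Pu (uv n) t.
have h2 := uv n.+1 t; rewrite ES in h2; rewrite /E in h1 En.
have -> : Phi u t - u t = - (Phi (v n) t - Phi u t) + (v n.+1 t - u t).
  by rewrite /=; lra.
by apply: (le_trans (ler_normD _ _)); rewrite normrN; lra.
Qed.

(** * Norm estimates for products and sums *)

Lemma ler_normM (R : realType) (x y X Y : R) :
  `|x| <= X -> `|y| <= Y -> `|x * y| <= X * Y.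
Proof. by move=> hx hy; rewrite normrM ler_pM. Qed.

Lemma ler_distM (R : realType) (x y x' y' dx dy X Y : R) :
  `|x'| <= X -> `|y| <= Y -> `|x - x'| <= dx -> `|y - y'| <= dy ->
  `|x * y - x' * y'| <= dx * Y + X * dy.
Proof.
move=> hx hy hdx hdy.
have -> : x * y - x' * y' = (x - x') * y + x' * (y - y') by ring.
by apply: (le_trans (ler_normD _ _)); rewrite lerD // ler_normM.
Qed.

Lemma ler_distD2 (R : realType) (x y x' y' dx dy : R) :
  `|x - x'| <= dx -> `|y - y'| <= dy -> `|(x + y) - (x' + y')| <= dx + dy.
Proof.
move=> hx hy; have -> : (x + y) - (x' + y') = (x - x') + (y - y') by ring.
by apply: (le_trans (ler_normD _ _)); rewrite lerD.
Qed.

Lemma ler_distB2 (R : realType) (x y x' y' dx dy : R) :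
  `|x - x'| <= dx -> `|y - y'| <= dy -> `|(x - y) - (x' - y')| <= dx + dy.
Proof.
by move=> hx hy; apply: ler_distD2 => //; rewrite -opprD normrN.
Qed.

Lemma lipschitz_continuous (R : realType) (V W : normedModType R)
    (f : V -> W) (K : R) :
  0 <= K -> (forall u v, `|f u - f v| <= K * `|u - v|) -> continuous f.
Proof.
move=> K0 fK x; apply/cvgrPdist_le => /= e e0.
have K1 : 0 < K + 1 by rewrite ltr_wpDl.
apply/nbhs_ballP; exists (e / (K + 1)) => /= [|y]; first by rewrite divr_gt0.
rewrite -ball_normE /= => xy; apply: (le_trans (fK x y)); move: xy.
by rewrite ltr_pdivlMr //; have := normr_ge0 (x - y); nra.
Qed.

(** * Periodic solutions of a perturbed harmonic oscillator *)

(** The rotating coordinates [A], [B], the frequency correction [q] and the damping correction [l]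
    are packed into one function on [coord * R], so that a single sup norm governs all four; the two
    constants become components constant in time. *)
Inductive coord := cA | cB | cq | cl.

Definition base (R : realType) (c : coord) : R := if c is cA then 1 else 0.

Section rotating_frame.
Context {R : realType}.
Implicit Types (N : R -> R -> R) (u v : coord * R -> R).
Implicit Types r eta mu d s t : R.

(* With [Y = A cos + B sin] and [Z = B cos - A sin], the equations of [planar_hopf]
   become [A' = hA + l sin ^ 2] and [B' = hB - q - l sin cos], where [hA] and [hB]
   are of second order at [A = 1], [B = q = l = 0]. A fixed point of [Phi] is a
   solution for which [q] and [l] cancel the means of the right-hand sides, hence a
   periodic one. *)
Definition roty u s : R := u (cA, s) * cos s + u (cB, s) * sin s.
Definition rotz u s : R := u (cB, s) * cos s - u (cA, s) * sin s.

(** Equal to [(1 + q) * (l * Z + N) + l * sin s]: the damping [- l * sin s] felt by the base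
    solution has been taken out, and the grouping by [1 - A] and [B] shows that what remains of the
    damping is of second order. *)
Definition forcing N u s : R :=
  u (cl, s) * ((1 - u (cA, s)) * sin s + u (cB, s) * cos s)
  + u (cq, s) * (u (cl, s) * rotz u s)
  + (1 + u (cq, s)) * N (roty u s) (rotz u s).

Definition hA N u s : R := u (cq, s) * u (cB, s) - sin s * forcing N u s.
Definition hB N u s : R := u (cq, s) * (1 - u (cA, s)) + cos s * forcing N u s.

Definition mean (g : R -> R) : R := prim g (2 * pi) / (2 * pi).

(** [s - sin s * cos s] and [sin s ^+ 2] are primitives of [2 * sin s ^+ 2] and [2 * sin s * cos s];
    with [l = - 2 * mean (hA N u)] they integrate the two terms in [l] exactly. *)
Definition Phi N u (x : coord * R) : R :=
  let s := x.2 in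
  match x.1 with
  | cA => 1 + prim (hA N u) s - mean (hA N u) * (s - sin s * cos s)
  | cB => prim (hB N u) s - mean (hB N u) * s + mean (hA N u) * sin s ^+ 2
  | cq => mean (hB N u)
  | cl => - 2 * mean (hA N u)
  end.

(** The radius 2 is large enough for the orbits of [near_base]: there [A] is at most 3/2 and [B] at
    most 1/2 in absolute value. *)
Definition small_pert (eta : R) N := forall y z y' z',
  `|y| <= 2 -> `|z| <= 2 -> `|y'| <= 2 -> `|z'| <= 2 ->
  `|N y z| <= eta /\ `|N y z - N y' z'| <= eta * (`|y - y'| + `|z - z'|).

(** The class on which [Phi] contracts, cut out by conditions that survive uniform limits. The
    values at time 0 fix amplitude and phase; the Lipschitz constant 1/4 gives continuity and,
    later, the minimality of the period. *)
Definition near_base (r : R) u :=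
  [/\ forall c s, u (c, s + 2 * pi) = u (c, s),
      forall c s, `|u (c, s) - base R c| <= r,
      forall c s t, `|u (c, s) - u (c, t)| <= 1 / 4 * `|s - t|,
      u (cA, 0) = 1 /\ u (cB, 0) = 0 &
      forall s, u (cq, s) = u (cq, 0) /\ u (cl, s) = u (cl, 0)].

Lemma near_base_bounds r u s : 0 <= r <= 1 / 2 -> near_base r u ->
  [/\ `|u (cA, s)| <= 3 / 2, `|1 - u (cA, s)| <= r, `|u (cB, s)| <= r,
      `|u (cq, s)| <= r & `|u (cl, s)| <= r].
Proof.
move=> hr [_ h _ _ _].
have := h cA s; have := h cB s; have := h cq s; have := h cl s.
rewrite /= !subr0 => -> -> -> hA; rewrite distrC hA; split => //.
by move: hA; rewrite !ler_norml; lra.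
Qed.

Lemma rot_bounds r u s : 0 <= r <= 1 / 2 -> near_base r u ->
  `|roty u s| <= 2 /\ `|rotz u s| <= 2.
Proof.
move=> hr /(near_base_bounds s hr)[hA _ hB _ _].
have c1 := cos_max s; have s1 := sin_max s.
have h1 := ler_normM hA c1; have h2 := ler_normM hB s1.
have h3 := ler_normM hB c1; have h4 := ler_normM hA s1.
by split; [apply: (le_trans (ler_normD _ _))|apply: (le_trans (ler_normB _ _))];
   lra.
Qed.

(** Apart from [N], every term is a product with at least two small factors, whence the gain [r].
    Two perturbations at distance [mu] are treated at once because the estimate serves three times:
    contraction ([N' = N], [mu = 0]), invariance of the class ([N' = pert0], [mu = eta]), and
    dependence on the perturbation. *)
Lemma h_dist N N' eta mu r d u v s : 0 <= r <= 1 / 2 -> 0 <= eta -> 0 <= d ->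
  small_pert eta N -> near_base r u -> near_base r v ->
  (forall y z, `|y| <= 2 -> `|z| <= 2 -> `|N y z - N' y z| <= mu) ->
  (forall x, `|u x - v x| <= d) ->
  `|hA N u s - hA N' v s| <= (12 * r + 9 * eta) * d + 2 * mu /\
  `|hB N u s - hB N' v s| <= (12 * r + 9 * eta) * d + 2 * mu.
Proof.
move=> hr eta0 d0 hN hu hv hNN' huv.
have mu0 : 0 <= mu by apply: le_trans (hNN' 0 0 _ _); rewrite ?normr0.
have /andP[r0 r2] := hr.
have rd0 : 0 <= r * d by apply: mulr_ge0.
have ed0 : 0 <= eta * d by apply: mulr_ge0.
have rrd : r * (r * d) <= 1 / 2 * (r * d) by rewrite ler_wpM2r.
have [uA u1A uB uq ul] := near_base_bounds s hr hu.
have [vA v1A vB vq vl] := near_base_bounds s hr hv.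
have [uy uz] := rot_bounds s hr hu; have [vy vz] := rot_bounds s hr hv.
have c1 := cos_max s; have s1 := sin_max s.
have dA := huv (cA, s); have dB := huv (cB, s).
have dq := huv (cq, s); have dl := huv (cl, s).
have d1A : `|(1 - u (cA, s)) - (1 - v (cA, s))| <= d.
  by have -> : (1 - u (cA, s)) - (1 - v (cA, s)) = - (u (cA, s) - v (cA, s));
     [ring|rewrite normrN].
have c0 : `|cos s - cos s| <= 0 by rewrite subrr normr0.
have s0 : `|sin s - sin s| <= 0 by rewrite subrr normr0.
have dy : `|roty u s - roty v s| <= 2 * d.
  have := ler_distD2 (ler_distM vA c1 dA c0) (ler_distM vB s1 dB s0).
  by move=> /le_trans; apply; lra.
have dz : `|rotz u s - rotz v s| <= 2 * d.
  have := ler_distB2 (ler_distM vB c1 dB c0) (ler_distM vA s1 dA s0).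
  by move=> /le_trans; apply; lra.
set Tu := (1 - u (cA, s)) * sin s + u (cB, s) * cos s.
set Tv := (1 - v (cA, s)) * sin s + v (cB, s) * cos s.
have uT : `|Tu| <= 2 * r.
  apply: (le_trans (ler_normD _ _)).
  by have := ler_normM u1A s1; have := ler_normM uB c1; lra.
have dT : `|Tu - Tv| <= 2 * d.
  have := ler_distD2 (ler_distM v1A s1 d1A s0) (ler_distM vB c1 dB c0).
  by move=> /le_trans; apply; lra.
have dlT := ler_distM vl uT dl dT.
have ulz := ler_normM ul uz.
have dlz := ler_distM vl uz dl dz.
have dqlz := ler_distM vq ulz dq dlz.
have dN : `|N (roty u s) (rotz u s) - N' (roty v s) (rotz v s)|
    <= 4 * eta * d + mu.
  have [_ h1] := hN _ _ _ _ uy uz vy vz; have h2 := hNN' _ _ vy vz.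
  have -> : N (roty u s) (rotz u s) - N' (roty v s) (rotz v s) =
    (N (roty u s) (rotz u s) - N (roty v s) (rotz v s)) +
    (N (roty v s) (rotz v s) - N' (roty v s) (rotz v s)) by ring.
  apply: (le_trans (ler_normD _ _)); rewrite lerD //.
  apply: (le_trans h1); rewrite (_ : 4 * eta * d = eta * (2 * d + 2 * d)); last by ring.
  by rewrite ler_wpM2l // lerD.
have [uN _] := hN _ _ _ _ uy uz uy uz.
have d1q : `|(1 + u (cq, s)) - (1 + v (cq, s))| <= d.
  by have -> : (1 + u (cq, s)) - (1 + v (cq, s)) = u (cq, s) - v (cq, s) by ring.
have v1q : `|1 + v (cq, s)| <= 3 / 2.
  by apply: (le_trans (ler_normD _ _)); rewrite normr1; clear - vq r2; lra.
have dqN := ler_distM v1q uN d1q dN.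
have dF : `|forcing N u s - forcing N' v s| <= 10 * r * d + 7 * eta * d + 3 / 2 * mu.
  have := ler_distD2 (ler_distD2 dlT dqlz) dqN.
  move=> /le_trans; apply.
  by clear - rrd mu0 rd0 ed0; lra.
have uFs := @ler_distM R (sin s) (forcing N u s) (sin s) (forcing N' v s) 0 _ 1 _
  s1 (lexx _) s0 dF.
have uFc := @ler_distM R (cos s) (forcing N u s) (cos s) (forcing N' v s) 0 _ 1 _
  c1 (lexx _) c0 dF.
split.
- have := ler_distB2 (ler_distM vq uB dq dB) uFs.
  by move=> /le_trans; apply; clear - mu0 rd0 ed0; lra.
- have := ler_distD2 (ler_distM vq u1A dq d1A) uFc.
  by move=> /le_trans; apply; clear - mu0 rd0 ed0; lra.
Qed.

Lemma near_base_continuous r u c : near_base r u -> continuous (fun s => u (c, s)).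
Proof. by case=> _ _ hL _ _; apply: (@lipschitz_continuous _ _ _ _ (1 / 4)) (hL c); lra. Qed.

Lemma sin_lip (s t : R) : `|sin s - sin t| <= 1 * `|s - t|.
Proof. by apply: (MVT_normT (df := cos)) => x; exact: cos_max. Qed.

Lemma cos_lip (s t : R) : `|cos s - cos t| <= 1 * `|s - t|.
Proof.
apply: (MVT_normT (df := fun x => - sin x)) => x.
by rewrite normrN; exact: sin_max.
Qed.

Lemma rot_lipschitz r u s t : 0 <= r <= 1 / 2 -> near_base r u ->
  `|roty u s - roty u t| <= 3 * `|s - t| /\
  `|rotz u s - rotz u t| <= 3 * `|s - t|.
Proof.
move=> hr hu; have [_ _ hL _ _] := hu.
have [sA _ sB _ _] := near_base_bounds s hr hu.
have [tA _ tB _ _] := near_base_bounds t hr hu.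
have c1 := cos_max s; have s1 := sin_max s.
have st := normr_ge0 (s - t).
have hAs := ler_distM tA s1 (hL cA s t) (sin_lip s t).
have hAc := ler_distM tA c1 (hL cA s t) (cos_lip s t).
have hBs := ler_distM tB s1 (hL cB s t) (sin_lip s t).
have hBc := ler_distM tB c1 (hL cB s t) (cos_lip s t).
have rst : r * `|s - t| <= 1 / 2 * `|s - t| by rewrite ler_wpM2r //; lra.
split; [have := ler_distD2 hAc hBs|have := ler_distB2 hBc hAs];
  move=> /le_trans; apply; lra.
Qed.

Lemma pert_continuous N eta r u : 0 <= eta -> 0 <= r <= 1 / 2 ->
  small_pert eta N -> near_base r u ->
  continuous (fun s => N (roty u s) (rotz u s)).
Proof.
move=> eta0 hr hN hu; apply: (@lipschitz_continuous _ _ _ _ (eta * 6)) => [|s t].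
  by rewrite mulr_ge0.
have [ys zs] := rot_bounds s hr hu; have [yt zt] := rot_bounds t hr hu.
have [_ /le_trans] := hN _ _ _ _ ys zs yt zt; apply.
rewrite -mulrA ler_wpM2l //.
by have [] := rot_lipschitz s t hr hu; lra.
Qed.

Lemma continuous_mul (f g : R -> R) :
  continuous f -> continuous g -> continuous (fun s => f s * g s).
Proof. by move=> cf cg x; exact: continuousM (cf x) (cg x). Qed.

Lemma continuous_add (f g : R -> R) :
  continuous f -> continuous g -> continuous (fun s => f s + g s).
Proof. by move=> cf cg x; exact: continuousD (cf x) (cg x). Qed.

Lemma continuous_sub (f g : R -> R) :
  continuous f -> continuous g -> continuous (fun s => f s - g s).
Proof. by move=> cf cg x; exact: continuousB (cf x) (cg x). Qed.

Lemma h_continuous N eta r u : 0 <= eta -> 0 <= r <= 1 / 2 ->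
  small_pert eta N -> near_base r u ->
  continuous (hA N u) /\ continuous (hB N u).
Proof.
move=> eta0 hr hN hu.
have cN := pert_continuous eta0 hr hN hu.
have cu c : continuous (fun s => u (c, s)) by exact: near_base_continuous hu.
have cs := @continuous_sin R; have ccos := @continuous_cos R.
have ccst (a : R) : continuous (fun _ : R => a) by exact: cst_continuous.
have c1A := continuous_sub (ccst 1) (cu cA).
have c1q := continuous_add (ccst 1) (cu cq).
have cz := continuous_sub (continuous_mul (cu cB) ccos) (continuous_mul (cu cA) cs).
have cF : continuous (forcing N u).
  apply: continuous_add; first apply: continuous_add.
  - apply: continuous_mul; first exact: cu.
    by apply: continuous_add; apply: continuous_mul; auto.
  - by apply: continuous_mul; [exact: cu|apply: continuous_mul; auto].
  - exact: continuous_mul.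
split.
- by apply: continuous_sub; apply: continuous_mul; auto.
- by apply: continuous_add; apply: continuous_mul; auto.
Qed.

Lemma sin_per (s : R) : sin (s + 2 * pi) = sin s.
Proof. by rewrite mulr_natl sinD2pi. Qed.

Lemma cos_per (s : R) : cos (s + 2 * pi) = cos s.
Proof. by rewrite mulr_natl cosD2pi. Qed.

Lemma h_periodic N r u : near_base r u ->
  periodic (hA N u) (2 * pi) /\ periodic (hB N u) (2 * pi).
Proof.
case=> hp _ _ _ _.
by split=> s; rewrite /hA /hB /forcing /roty /rotz !hp sin_per cos_per.
Qed.

Lemma two_pi_gt0 : 0 < 2 * pi :> R.
Proof. by rewrite mulr_gt0 // pi_gt0. Qed.

Lemma two_pi_lt8 : 2 * pi < 8 :> R.
Proof. by have := @pihalf_lt2 R; lra. Qed.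

Lemma mean_dist (f g : R -> R) (M : R) : continuous f -> continuous g ->
  (forall s, `|f s - g s| <= M) -> `|mean f - mean g| <= M.
Proof.
move=> cf cg fg; have tp := two_pi_gt0.
rewrite /mean -mulrBl normrM normfV (gtr0_norm tp) ler_pdivrMr //.
by have := le_prim_dist (2 * pi) cf cg fg; rewrite (gtr0_norm tp).
Qed.

Lemma prim_2pi f : prim f (2 * pi) = mean f * (2 * pi).
Proof. by rewrite /mean divfK // gt_eqF // two_pi_gt0. Qed.

Lemma Phi_periodic N eta r u c s : 0 <= eta -> 0 <= r <= 1 / 2 ->
  small_pert eta N -> near_base r u -> Phi N u (c, s + 2 * pi) = Phi N u (c, s).
Proof.
move=> eta0 hr hN hu; have [cfA cfB] := h_continuous eta0 hr hN hu.
have [pA pB] := h_periodic N hu.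
by case: c; rewrite /Phi //= sin_per ?cos_per primD // prim_2pi; ring.
Qed.

(** By periodicity it suffices to take [s] in one period, of length below 8. Then the primitive
    costs 8 and the correction by the means costs 9, either as a bound on [s - sin s * cos s] or as
    8 + 1; hence 17. *)
Lemma Phi_dist N N' eta mu r d u v : 0 <= r <= 1 / 2 -> 0 <= eta -> 0 <= d ->
  small_pert eta N -> small_pert eta N' -> near_base r u -> near_base r v ->
  (forall y z, `|y| <= 2 -> `|z| <= 2 -> `|N y z - N' y z| <= mu) ->
  (forall x, `|u x - v x| <= d) ->
  forall x, `|Phi N u x - Phi N' v x| <= 17 * ((12 * r + 9 * eta) * d + 2 * mu).
Proof.
move=> hr eta0 d0 hN hN' hu hv hNN' huv.
set D : R := (12 * r + 9 * eta) * d + 2 * mu.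
have hD s := h_dist s hr eta0 d0 hN hu hv hNN' huv.
have hDA s : `|hA N u s - hA N' v s| <= D := (hD s).1.
have hDB s : `|hB N u s - hB N' v s| <= D := (hD s).2.
have D0 : 0 <= D by exact: le_trans (hDA 0).
have [cuA cuB] := h_continuous eta0 hr hN hu.
have [cvA cvB] := h_continuous eta0 hr hN' hv.
have mA := mean_dist cuA cvA hDA; have mB := mean_dist cuB cvB hDB.
have p8 := two_pi_lt8.
case=> c s; move: s.
apply: (periodic_bound two_pi_gt0) => [s|s /andP[s0 s2]].
  rewrite !(@Phi_periodic _ eta r) //.
have s8 : s <= 8 by lra.
have ns : `|s| <= 8 by rewrite ger0_norm.
have pA : `|prim (hA N u) s - prim (hA N' v) s| <= D * 8.
  by apply: le_trans (le_prim_dist s cuA cvA hDA) _; rewrite ler_wpM2l.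
have pB : `|prim (hB N u) s - prim (hB N' v) s| <= D * 8.
  by apply: le_trans (le_prim_dist s cuB cvB hDB) _; rewrite ler_wpM2l.
have c1 := cos_max s; have s1 := sin_max s.
case: c; rewrite /Phi /=.
- have sc : `|s - sin s * cos s| <= 9.
    by apply: (le_trans (ler_normB _ _)); have := ler_normM s1 c1; lra.
  have -> : 1 + prim (hA N u) s - mean (hA N u) * (s - sin s * cos s) -
    (1 + prim (hA N' v) s - mean (hA N' v) * (s - sin s * cos s)) =
    (prim (hA N u) s - prim (hA N' v) s) -
    (mean (hA N u) - mean (hA N' v)) * (s - sin s * cos s) by ring.
  by apply: (le_trans (ler_normB _ _)); have := ler_normM mA sc; lra.
- have -> : prim (hB N u) s - mean (hB N u) * s + mean (hA N u) * sin s ^+ 2 -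
    (prim (hB N' v) s - mean (hB N' v) * s + mean (hA N' v) * sin s ^+ 2) =
    ((prim (hB N u) s - prim (hB N' v) s) - (mean (hB N u) - mean (hB N' v)) * s)
    + (mean (hA N u) - mean (hA N' v)) * (sin s * sin s) by ring.
  apply: (le_trans (ler_normD _ _)).
  have := ler_normB (prim (hB N u) s - prim (hB N' v) s)
    ((mean (hB N u) - mean (hB N' v)) * s).
  have := ler_normM mB ns; have := ler_normM mA (ler_normM s1 s1); lra.
- by apply: (le_trans mB); lra.
- rewrite -mulrBr normrM normrN (ger0_norm (_ : 0 <= 2)) //; lra.
Qed.

Lemma near_base_base r : 0 <= r -> near_base r (fun x => base R x.1).
Proof.
move=> r0; split=> //= [c s|c s t]; first by rewrite subrr normr0.
by rewrite subrr normr0 mulr_ge0.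
Qed.

Lemma prim_cst0 (f : R -> R) s : (forall x, f x = 0) -> prim f s = 0.
Proof.
move=> f0; have cf : continuous f.
  have -> : f = cst 0 by apply/funext => x; rewrite f0.
  exact: cst_continuous.
apply/eqP; rewrite -normr_le0.
by have := @le_prim_norm R f 0 s cf; rewrite mul0r; apply => x; rewrite f0 normr0.
Qed.

Definition pert0 : R -> R -> R := fun _ _ => 0.

Lemma small_pert0 eta : 0 <= eta -> small_pert eta pert0.
Proof.
by move=> h y z y' z' *; rewrite /pert0 subrr normr0 mulr_ge0 ?addr_ge0.
Qed.

Lemma Phi_base x : Phi pert0 (fun x => base R x.1) x = base R x.1.
Proof.
have hA0 s : hA pert0 (fun x => base R x.1) s = 0.
  by rewrite /hA /forcing /pert0 /=; ring.
have hB0 s : hB pert0 (fun x => base R x.1) s = 0.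
  by rewrite /hB /forcing /pert0 /=; ring.
case: x => c s; rewrite /Phi /mean !prim_cst0 // !mul0r.
by case: c => /=; ring.
Qed.

Lemma h_bound N eta r u s : 0 <= r <= 1 / 2 -> 0 <= eta ->
  small_pert eta N -> near_base r u ->
  `|hA N u s| <= (12 * r + 9 * eta) * r + 2 * eta /\
  `|hB N u s| <= (12 * r + 9 * eta) * r + 2 * eta.
Proof.
move=> hr eta0 hN hu; have r0 : 0 <= r by case/andP: hr.
have [||] := @h_dist N pert0 eta eta r r u _ s hr eta0 r0 hN hu (near_base_base r0).
- by move=> y z y2 z2; rewrite /pert0 subr0; have [] := hN y z y z y2 z2 y2 z2.
- by case=> c t; case: hu => _ + _ _ _; apply.
have -> : hA pert0 (fun x => base R x.1) s = 0.
  by rewrite /hA /forcing /pert0 /=; ring.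
have -> : hB pert0 (fun x => base R x.1) s = 0.
  by rewrite /hB /forcing /pert0 /=; ring.
by rewrite !subr0.
Qed.

Lemma mean_bound (g : R -> R) M : continuous g -> (forall s, `|g s| <= M) ->
  `|mean g| <= M.
Proof.
move=> cg gM; have tp := two_pi_gt0.
rewrite /mean normrM normfV (gtr0_norm tp) ler_pdivrMr //.
by have := le_prim_norm (2 * pi) cg gM; rewrite (gtr0_norm tp).
Qed.

Lemma is_derive_PhiA N u s : continuous (hA N u) ->
  is_derive s 1 (fun s => Phi N u (cA, s))
    (hA N u s - 2 * mean (hA N u) * sin s ^+ 2).
Proof.
move=> ch; have hp := is_derive_prim s ch.
have hsc := derM (is_derive_sin s) (is_derive_cos s).
have h := derB (derD (derC 1 s) hp)
  (derM (derC (mean (hA N u)) s) (derB (is_derive_id s 1) hsc)).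
apply: is_derive_eq h _; have := cos2Dsin2 s => e.
have -> : cos s * cos s = 1 - sin s ^+ 2 by rewrite -e; ring.
by ring.
Qed.

Lemma is_derive_PhiB N u s : continuous (hB N u) ->
  is_derive s 1 (fun s => Phi N u (cB, s))
    (hB N u s - mean (hB N u) + 2 * mean (hA N u) * (sin s * cos s)).
Proof.
move=> ch; have hp := is_derive_prim s ch.
have hss := derM (is_derive_sin s) (is_derive_sin s).
have h := derD (derB hp (derM (derC (mean (hB N u)) s) (is_derive_id s 1)))
  (derM (derC (mean (hA N u)) s) hss).
by apply: is_derive_eq h _; ring.
Qed.

(** Invariance comes from comparison with the base, a fixed point of [Phi] for the zero
    perturbation. With [r = 1 / 500] and this bound on [eta], [17 * (12 * r + 9 * eta)] is below 1/2
    and [34 * eta] below [r / 2]; the first inequality is also the contraction factor. *)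
Lemma Phi_near_base N eta u : 0 <= eta <= 1 / 200 / 200 ->
  small_pert eta N -> near_base (1 / 500) u -> near_base (1 / 500) (Phi N u).
Proof.
move=> /andP[eta0 eta1] hN hu.
set r : R := 1 / 500; have hr : 0 <= r <= 1 / 2 by rewrite /r; lra.
have r0 : 0 <= r by case/andP: hr.
have [cfA cfB] := h_continuous eta0 hr hN hu.
have hb s := h_bound s hr eta0 hN hu.
set D : R := (12 * r + 9 * eta) * r + 2 * eta in hb.
have hDA s : `|hA N u s| <= D := (hb s).1.
have hDB s : `|hB N u s| <= D := (hb s).2.
have mA := mean_bound cfA hDA; have mB := mean_bound cfB hDB.
have D1 : D <= 1 / 100 by rewrite /D /r; lra.
clearbody D; split.
- by move=> c s; exact: (Phi_periodic c s eta0 hr hN hu).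
- move=> c s.
  have := @Phi_dist N pert0 eta eta r r u _ hr eta0 r0 hN (small_pert0 eta0)
    hu (near_base_base r0).
  move=> /(_ _ _ (c, s)); rewrite Phi_base /=.
  have e1 : 17 * ((12 * r + 9 * eta) * r + 2 * eta) <= r by rewrite /r; lra.
  move=> h; apply: le_trans e1; apply: h.
    by move=> y z y2 z2; rewrite /pert0 subr0; have [] := hN y z y z y2 z2 y2 z2.
  by case=> c' t; case: hu => _ + _ _ _; apply.
- move=> c s t; have st := normr_ge0 (s - t).
  case: c.
  + apply: (@MVT_normT _ (fun s => Phi N u (cA, s)) _ (1 / 4)
      (fun x => is_derive_PhiA x cfA)) => x.
    have := ler_normM mA (ler_normM (sin_max x) (sin_max x)).
    rewrite -expr2 -mulrA => h.
    apply: (le_trans (ler_normB _ _)); rewrite normrM (ger0_norm (_ : 0 <= 2)) //.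
    by have := hDA x; lra.
  + apply: (@MVT_normT _ (fun s => Phi N u (cB, s)) _ (1 / 4)
      (fun x => is_derive_PhiB x cfB)) => x.
    have := ler_normM mA (ler_normM (sin_max x) (cos_max x)) => h.
    apply: (le_trans (ler_normD _ _)); rewrite -mulrA normrM (ger0_norm (_ : 0 <= 2)) //.
    by have := ler_normB (hB N u x) (mean (hB N u)); have := hDB x; lra.
  + by rewrite /Phi /= subrr normr0; lra.
  + by rewrite /Phi /= subrr normr0; lra.
- by rewrite /Phi /= !prim0 // sin0; split; ring.
- by [].
Qed.

Lemma near_base_closed r u :
  (forall e, 0 < e -> exists2 v, near_base r v & forall x, `|v x - u x| <= e) ->
  near_base r u.
Proof.
move=> h.
have eq0 (a b : R) : (forall e, 0 < e -> `|a - b| <= 2 * e) -> a = b.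
  move=> hab; apply/eqP; rewrite -subr_eq0 -normr_le0; apply/ler_addgt0Pr => e e0.
  by rewrite add0r; have := hab (e / 2) ltac:(lra); lra.
split.
- move=> c s; apply: eq0 => e e0; have [v [hv _ _ _ _] vu] := h e e0.
  have := vu (c, s + 2 * pi); have := vu (c, s); rewrite hv !ler_norml; lra.
- move=> c s; apply/ler_addgt0Pr => e e0; have [v [_ hv _ _ _] vu] := h e e0.
  by have := vu (c, s); have := hv c s; rewrite !ler_norml; lra.
- move=> c s t; apply/ler_addgt0Pr => e e0.
  have [v [_ _ hv _ _] vu] := h (e / 2) ltac:(lra).
  by have := vu (c, s); have := vu (c, t); have := hv c s t; rewrite !ler_norml; lra.
- by split; apply: eq0 => e e0; have [v [_ _ _ [v1 v0] _] vu] := h e e0;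
    [have := vu (cA, 0); rewrite v1|have := vu (cB, 0); rewrite v0];
    rewrite !ler_norml; lra.
- move=> s; split; apply: eq0 => e e0; have [v [_ _ _ _ hv] vu] := h e e0;
    have [hq hl] := hv s.
  + have := vu (cq, 0); have := vu (cq, s); rewrite hq !ler_norml; lra.
  + have := vu (cl, 0); have := vu (cl, s); rewrite hl !ler_norml; lra.
Qed.

Lemma Phi_fixpoint N eta : 0 <= eta <= 1 / 200 / 200 -> small_pert eta N ->
  exists2 u, near_base (1 / 500) u & forall x, Phi N u x = u x.
Proof.
move=> heta hN; have /andP[eta0 eta1] := heta.
set r : R := 1 / 500; have hr : 0 <= r <= 1 / 2 by rewrite /r; lra.
have r0 : 0 <= r by case/andP: hr.
have hb := near_base_base r0; have hPb := Phi_near_base heta hN hb.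
apply: (@contraction_fixpoint _ _ _ _ _ r hb).
- by move=> u hu; exact: (Phi_near_base heta hN hu).
- by move=> u; apply: near_base_closed.
- move=> u v d hu hv huv x.
  have d0 : 0 <= d by exact: le_trans (huv (cA, 0)).
  have := @Phi_dist N N eta 0 r d u v hr eta0 d0 hN hN hu hv _ huv x.
  move=> /(_ _)/le_trans; apply.
    by move=> y z _ _; rewrite subrr normr0.
  have : eta * d <= 1 / 200 / 200 * d by rewrite ler_wpM2r.
  by rewrite /r; lra.
- by case=> c s; case: hPb => _ + _ _ _; apply.
Qed.

Lemma fixpoint_ode N eta r u s : 0 <= eta -> 0 <= r <= 1 / 2 ->
  small_pert eta N -> near_base r u -> (forall x, Phi N u x = u x) ->
  is_derive s 1 (roty u) ((1 + u (cq, 0)) * rotz u s) /\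
  is_derive s 1 (rotz u) ((1 + u (cq, 0)) *
    (- roty u s + u (cl, 0) * rotz u s + N (roty u s) (rotz u s))).
Proof.
move=> eta0 hr hN hu fixu; have [cfA cfB] := h_continuous eta0 hr hN hu.
have EA : (fun s => Phi N u (cA, s)) = (fun s => u (cA, s)).
  by apply/funext => x.
have EB : (fun s => Phi N u (cB, s)) = (fun s => u (cB, s)).
  by apply/funext => x.
have dA := is_derive_PhiA s cfA; rewrite EA in dA.
have dB := is_derive_PhiB s cfB; rewrite EB in dB.
have [_ _ _ _ /(_ s)[uq ul]] := hu.
have mq : mean (hB N u) = u (cq, 0) by rewrite -(fixu (cq, 0)).
have ml : mean (hA N u) = - u (cl, 0) / 2.
  by rewrite -(fixu (cl, 0)) /Phi /=; field.
have dc := is_derive_cos s; have ds := is_derive_sin s.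
have c2 : cos s ^+ 2 = 1 - sin s ^+ 2 by have := cos2Dsin2 s; lra.
split.
- apply: is_derive_eq (derD (derM dA dc) (derM dB ds)) _.
  rewrite mq ml /hA /hB uq /rotz; set F := forcing _ _ _.
  by field: c2.
- apply: is_derive_eq (derB (derM dB dc) (derM dA ds)) _.
  rewrite mq ml /hA /hB /forcing uq ul /rotz /roty; set n := N _ _.
  by field: c2.
Qed.

Lemma sin_lower s : 0 < s <= pi -> 3 / 4 <= cos s -> 3 / 4 * s <= sin s.
Proof.
move=> /andP[s0 sp] c34.
have [c /andP[c0 cs]] := MVT_le (ltW s0) (fun x _ => is_derive_sin x).
rewrite sin0 !subr0 => ->; rewrite ler_pM2r //; apply: (le_trans c34).
have ccos : {in `[0, pi] &, {mono cos : x y /~ y < x}} := @ltr_cos R.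
have [->//|cs'] := eqVneq c s.
rewrite ltW // ccos ?in_itv /=; first by rewrite lt_neqAle cs' cs.
  by rewrite c0 (le_trans cs).
by rewrite (ltW s0) sp.
Qed.

(** Undoing the rotation, a return to the initial state at time [s] means [A = cos s] and
    [B = sin s]. As [A] stays near 1, [s] is near 0 or near [2 * pi]; there [sin] grows at rate at
    least 3/4 from its zero, against the Lipschitz constant 1/4 of [B]. *)
Lemma near_base_least_period u s : near_base (1 / 500) u -> 0 < s < 2 * pi ->
  ~ (roty u s = roty u 0 /\ rotz u s = rotz u 0).
Proof.
move=> [hp hr hL [u1 u0] _] /andP[s0 s2].
rewrite /roty /rotz u1 u0 sin0 cos0 => -[hy hz].
have e := cos2Dsin2 s.
have Ac : u (cA, s) = cos s.
  transitivity ((u (cA, s) * cos s + u (cB, s) * sin s) * cos s -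
    (u (cB, s) * cos s - u (cA, s) * sin s) * sin s); last by rewrite hy hz; ring.
  by transitivity (u (cA, s) * (cos s ^+ 2 + sin s ^+ 2)); [rewrite e mulr1|ring].
have Bs : u (cB, s) = sin s.
  transitivity ((u (cA, s) * cos s + u (cB, s) * sin s) * sin s +
    (u (cB, s) * cos s - u (cA, s) * sin s) * cos s); last by rewrite hy hz; ring.
  by transitivity (u (cB, s) * (cos s ^+ 2 + sin s ^+ 2)); [rewrite e mulr1|ring].
have c34 : 3 / 4 <= cos s.
  by have := hr cA s; rewrite Ac ler_norml /=; lra.
have [sp|ps] := leP s pi.
  have := sin_lower _ c34; rewrite s0 sp => /(_ isT) h.
  have := hL cB s 0; rewrite Bs u0 !subr0 (gtr0_norm s0) ler_norml.
  by lra.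
pose t := 2 * pi - s.
have t0 : 0 < t by rewrite /t; lra.
have ct : cos t = cos s by rewrite -(cosN s) /t -(cos_per (- s)); congr cos; ring.
have st : sin t = - sin s.
  by rewrite -sinN /t -(sin_per (- s)); congr sin; ring.
have := @sin_lower t; rewrite ct st => /(_ _ c34).
have -> : 0 < t <= pi by rewrite t0 /t; lra.
move=> /(_ isT) h.
have := hL cB (- t) 0; rewrite -(hp cB) (_ : - t + 2 * pi = s); last by rewrite /t; ring.
rewrite Bs u0 !subr0 normrN (gtr0_norm t0) ler_norml.
by lra.
Qed.

(** A bound [d] on the difference improves to [d / 2 + 34 * mu] by [Phi_dist], and [halving_bound]
    doubles the constant. *)
Lemma Phi_fixpoint_dist N N' eta mu u v : 0 <= eta <= 1 / 200 / 200 ->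
  small_pert eta N -> small_pert eta N' ->
  near_base (1 / 500) u -> near_base (1 / 500) v ->
  (forall x, Phi N u x = u x) -> (forall x, Phi N' v x = v x) ->
  (forall y z, `|y| <= 2 -> `|z| <= 2 -> `|N y z - N' y z| <= mu) ->
  forall x, `|u x - v x| <= 68 * mu.
Proof.
move=> /andP[eta0 eta1] hN hN' hu hv fu fv hmu.
pose r : R := 1 / 500; have hr : 0 <= r <= 1 / 2 by rewrite /r; lra.
have := @halving_bound R _ (fun x => u x - v x) (34 * mu) (2 / 500).
rewrite mulrA -natrM; apply.
- move=> d hd x.
  have d0 : 0 <= d by exact: le_trans (hd (cA, 0)).
  rewrite -fu -fv.
  have := @Phi_dist N N' eta mu (1 / 500) d u v hr eta0 d0 hN hN' hu hv hmu hd x.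
  move=> /le_trans; apply.
  have : eta * d <= 1 / 200 / 200 * d by rewrite ler_wpM2r.
  by clear - d0; lra.
- case=> c s; have [_ /(_ c s) h1 _ _ _] := hu; have [_ /(_ c s) h2 _ _ _] := hv.
  by move: h1 h2; rewrite !ler_norml; clear; lra.
Qed.

End rotating_frame.

(** One fixed point is chosen for each [e], and regularity in [e] comes from comparing fixed points.
    At [e = 0] the perturbation vanishes on the box, so the fixed point is the base and both
    corrections are 0. The constant 3 in time is that of [rot_lipschitz]. *)
Theorem planar_hopf (R : realType) (N : R -> R -> R -> R) (C e1 : R) :
  0 <= C -> 0 < e1 ->
  (forall e : R, 0 <= e <= e1 -> small_pert (C * e) (N e)) ->
  (forall e e' y z : R, 0 <= e <= e1 -> 0 <= e' <= e1 -> `|y| <= 2 -> `|z| <= 2 ->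
    `|N e y z - N e' y z| <= C * `|e - e'|) ->
  exists (e0 K : R) (q l : R -> R) (Y Z : R -> R -> R),
  [/\ 0 < e0 <= e1, q 0 = 0 /\ l 0 = 0,
    forall e : R, 0 <= e <= e0 ->
      [/\ `|q e| <= 1 / 2,
        forall s : R, is_derive s 1 (Y e) ((1 + q e) * Z e s) /\
          is_derive s 1 (Z e)
            ((1 + q e) * (- Y e s + l e * Z e s + N e (Y e s) (Z e s))),
        forall s, Y e (s + 2 * pi) = Y e s /\ Z e (s + 2 * pi) = Z e s &
        forall s : R, 0 < s < 2 * pi -> ~ (Y e s = Y e 0 /\ Z e s = Z e 0)],
    forall e e' : R, 0 <= e <= e0 -> 0 <= e' <= e0 ->
      `|q e - q e'| <= K * `|e - e'| /\ `|l e - l e'| <= K * `|e - e'| &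
    forall e e' s s' : R, 0 <= e <= e0 -> 0 <= e' <= e0 ->
      `|Y e s - Y e' s'| <= K * `|e - e'| + 3 * `|s - s'| /\
      `|Z e s - Z e' s'| <= K * `|e - e'| + 3 * `|s - s'|].
Proof.
move=> C0 e10 hN hNe.
(* Small enough for [C * e0] to meet the threshold of [Phi_fixpoint]. *)
pose e0 := Num.min e1 (1 / 200 / 200 / (C + 1)).
have C1 : 0 < C + 1 by rewrite ltr_wpDl.
have e00 : 0 < e0 by rewrite lt_min e10 divr_gt0 //; clear; lra.
have e0e1 : e0 <= e1 by rewrite ge_min lexx.
have e0C : C * e0 <= 1 / 200 / 200.
  have : e0 <= 1 / 200 / 200 / (C + 1) by rewrite ge_min lexx orbT.
  by rewrite ler_pdivlMr //; move: C0 e00; clear; nra.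
pose eta := C * e0.
have eta0 : 0 <= eta by rewrite mulr_ge0 // ltW.
have hN' (e : R) : 0 <= e <= e0 -> small_pert eta (N e).
  move=> /andP[h1 h2] y z y' z' y2 z2 y'2 z'2.
  have he : 0 <= e <= e1 by rewrite h1 (le_trans h2).
  have le : C * e <= eta by rewrite ler_wpM2l.
  have [n1 n2] := hN e he y z y' z' y2 z2 y'2 z'2.
  split; first exact: le_trans n1 le.
  by apply: (le_trans n2); rewrite ler_wpM2r // addr_ge0.
have heta : 0 <= eta <= 1 / 200 / 200 by rewrite eta0.
pose r : R := 1 / 500; have hr : 0 <= r <= 1 / 2 by rewrite /r; clear; lra.
have [U hU] : {U : R -> coord * R -> R & forall e : R, 0 <= e <= e0 ->
    near_base (1 / 500) (U e) /\ forall x, Phi (N e) (U e) x = U e x}.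
  apply: (@choice R (coord * R -> R) (fun e u => 0 <= e <= e0 ->
    near_base (1 / 500) u /\ forall x, Phi (N e) u x = u x)) => e.
  have [he|he] := boolP (0 <= e <= e0); last by exists (fun=> 0).
  by have [u h1 h2] := Phi_fixpoint heta (hN' e he); exists u.
pose K := 68 * C.
have K0 : 0 <= K by rewrite mulr_ge0.
have UL (e e' : R) x : 0 <= e <= e0 -> 0 <= e' <= e0 ->
    `|U e x - U e' x| <= K * `|e - e'|.
  move=> he he'; have [hu fu] := hU e he; have [hv fv] := hU e' he'.
  rewrite /K -mulrA.
  apply: (Phi_fixpoint_dist heta (hN' e he) (hN' e' he') hu hv fu fv) => y z y2 z2.
  have [/andP[a1 a2] /andP[b1 b2]] := (he, he').
  by apply: hNe => //; rewrite ?a1 ?b1 /= ?(le_trans a2) ?(le_trans b2).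
have h0 : 0 <= (0 : R) <= e0 by rewrite lexx ltW.
have U0 x : U 0 x = base R x.1.
  have [hu fu] := hU 0 h0.
  have hb : near_base (1 / 500) (fun x => base R x.1).
    by apply: near_base_base; clear; lra.
  have := Phi_fixpoint_dist heta (hN' 0 h0) (small_pert0 eta0) hu hb fu
    (@Phi_base R) (mu := 0).
  move=> /(_ _ x); rewrite mulr0 => h; apply/eqP; rewrite -subr_eq0 -normr_le0.
  apply: h => y z y2 z2; rewrite /pert0 subr0.
  have h01 : 0 <= (0 : R) <= e1 by rewrite lexx ltW.
  by have [] := hN 0 h01 y z y z y2 z2 y2 z2; rewrite mulr0.
exists e0, (3 * K), (fun e => U e (cq, 0)), (fun e => U e (cl, 0)),
  (fun e => roty (U e)), (fun e => rotz (U e)); split.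
- by rewrite e00.
- by rewrite !U0.
- move=> e he; have [hu fu] := hU e he; split.
  + have [_ h _ _ _] := hu; have := h cq 0; rewrite /= subr0 => /le_trans; apply.
    by clear; lra.
  + by move=> s; exact: (fixpoint_ode s eta0 hr (hN' e he) hu fu).
  + by move=> s; have [hp _ _ _ _] := hu; rewrite /roty /rotz !hp sin_per cos_per.
  + by move=> s; exact: near_base_least_period.
- move=> e e' he he'; have K3 : K * `|e - e'| <= 3 * K * `|e - e'|.
    by rewrite ler_wpM2r //; clear - K0; lra.
  by split; apply: le_trans K3; exact: UL.
- move=> e e' s s' he he'.
  have [hu _] := hU e he; have [hv _] := hU e' he'.
  have [Ly Lz] := rot_lipschitz s s' hr hu.
  have c1 := cos_max s'; have s1 := sin_max s'.
  have dA := UL e e' (cA, s') he he'; have dB := UL e e' (cB, s') he he'.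
  have Ke : 0 <= K * `|e - e'| by rewrite mulr_ge0.
  split.
  + rewrite -(subrKA (roty (U e) s')); apply: (le_trans (ler_normD _ _)).
    rewrite addrC lerD //.
    have -> : roty (U e) s' - roty (U e') s' =
      (U e (cA, s') - U e' (cA, s')) * cos s' +
      (U e (cB, s') - U e' (cB, s')) * sin s' by rewrite /roty; ring.
    apply: (le_trans (ler_normD _ _)).
    by have := ler_normM dA c1; have := ler_normM dB s1; clear - Ke; lra.
  + rewrite -(subrKA (rotz (U e) s')); apply: (le_trans (ler_normD _ _)).
    rewrite addrC lerD //.
    have -> : rotz (U e) s' - rotz (U e') s' =
      (U e (cB, s') - U e' (cB, s')) * cos s' -
      (U e (cA, s') - U e' (cA, s')) * sin s' by rewrite /rotz; ring.
    apply: (le_trans (ler_normB _ _)).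
    by have := ler_normM dB c1; have := ler_normM dA s1; clear - Ke; lra.
Qed.

(** * Strict differentiability with a quadratic remainder *)

Section matrix_norm.
Context {R : realType} {n : nat}.
Implicit Types x : 'rV[R]_n.

Lemma rV_coord_le x i : `|x 0 i| <= `|x|.
Proof.
rewrite [leRHS]/Num.norm /= mx_normrE.
exact: (@le_bigmax _ _ _ _ (fun ij : 'I_1 * 'I_n => `|x ij.1 ij.2|) (0, i)).
Qed.

Lemma rV_norm_le x M : 0 <= M -> (forall i, `|x 0 i| <= M) -> `|x| <= M.
Proof.
move=> M0 xM; rewrite [leLHS]/Num.norm /= mx_normrE; apply: bigmax_le => // -[i j] _ /=.
by rewrite ord1.
Qed.

End matrix_norm.

Section strict_diff.
Context {R : realType} {V : normedModType R}.
Implicit Types (f g L : V -> R) (p u v : V).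

(** On the ball of radius [r] about [p], [f] minus its approximation is Lipschitz with constant
    [C * r]. This single notion yields the Jacobian and, after rescaling, the small perturbation of
    the oscillator. [L] is a bare function, so that differentials can be composed as explicit
    formulas and compared by [ring]. *)
Definition strict_diff f p L := exists C d : R,
  [/\ 0 <= C, 0 < d, L 0 = 0,
    forall u v, `|L u - L v| <= C * `|u - v| &
    forall u v r, `|u| <= r -> `|v| <= r -> r <= d ->
      `|(f (p + u) - L u) - (f (p + v) - L v)| <= C * r * `|u - v|].

Lemma strict_diff_ext f p L f' L' : strict_diff f p L ->
  (forall x, f x = f' x) -> (forall u, L u = L' u) -> strict_diff f' p L'.
Proof.
move=> h ef eL.
by have -> : f' = f by [apply/funext => x]; have -> : L' = L by [apply/funext => x].
Qed.

Lemma strict_diff_cst a p : strict_diff (cst a) p (cst 0).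
Proof.
by exists 0, 1; split => //= *; rewrite ?subrr ?normr0 !mul0r.
Qed.

Lemma strict_diffD f g p Lf Lg : strict_diff f p Lf -> strict_diff g p Lg ->
  strict_diff (fun x => f x + g x) p (fun u => Lf u + Lg u).
Proof.
move=> [C [d [C0 d0 f0 fL fS]]] [C' [d' [C'0 d'0 g0 gL gS]]].
exists (C + C'), (Num.min d d'); split.
- by rewrite addr_ge0.
- by rewrite lt_min d0.
- by rewrite f0 g0 addr0.
- by move=> u v; rewrite mulrDl; exact: ler_distD2.
- move=> u v r hu hv; rewrite le_min => /andP[rd rd'].
  have -> : f (p + u) + g (p + u) - (Lf u + Lg u) -
     (f (p + v) + g (p + v) - (Lf v + Lg v)) =
     ((f (p + u) - Lf u) - (f (p + v) - Lf v)) +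
     ((g (p + u) - Lg u) - (g (p + v) - Lg v)) by ring.
  by rewrite !mulrDl (le_trans (ler_normD _ _)) // lerD // ?fS ?gS.
Qed.

Lemma strict_diff_lipschitz f p L : strict_diff f p L -> exists C d : R,
  [/\ 0 <= C, 0 < d & forall u v, `|u| <= d -> `|v| <= d ->
    `|f (p + u) - f (p + v)| <= C * `|u - v|].
Proof.
move=> [C [d [C0 d0 L0 LL LS]]]; exists (C + C * d), d; split => //.
  by rewrite addr_ge0 // mulr_ge0 // ltW.
move=> u v hu hv; have := LS u v d hu hv (lexx _); have := LL u v => h1 h2.
have -> : f (p + u) - f (p + v) =
  (L u - L v) + ((f (p + u) - L u) - (f (p + v) - L v)) by ring.
by rewrite mulrDl (le_trans (ler_normD _ _)) // lerD.
Qed.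

Lemma strict_diffZ a f p L : strict_diff f p L ->
  strict_diff (fun x => a * f x) p (fun u => a * L u).
Proof.
move=> [C [d [C0 d0 L0 LL LS]]]; exists (`|a| * C), d; split => //.
- by rewrite mulr_ge0.
- by rewrite L0 mulr0.
- by move=> u v; rewrite -mulrBr normrM -mulrA ler_wpM2l.
- move=> u v r hu hv rd.
  have -> : a * f (p + u) - a * L u - (a * f (p + v) - a * L v) =
    a * ((f (p + u) - L u) - (f (p + v) - L v)) by ring.
  by rewrite normrM -!mulrA ler_wpM2l // mulrA LS.
Qed.

(** Beyond the two linear pieces there remains the product of the increments of [f] and [g], whose
    Lipschitz constant on the ball of radius [r] is [2 * (K * K') * r]. *)
Lemma strict_diffM f g p Lf Lg : strict_diff f p Lf -> strict_diff g p Lg ->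
  strict_diff (fun x => f x * g x) p (fun u => g p * Lf u + f p * Lg u).
Proof.
move=> hf hg.
have [K [k [K0 k0 fK]]] := strict_diff_lipschitz hf.
have [K' [k' [K'0 k'0 gK]]] := strict_diff_lipschitz hg.
have [C [d [C0 d0 f0 fL fS]]] := strict_diffZ (g p) hf.
have [C' [d' [C'0 d'0 g0 gL gS]]] := strict_diffZ (f p) hg.
exists (C + C' + 2 * (K * K')), (Num.min (Num.min d d') (Num.min k k')).
have KK : 0 <= K * K' by rewrite mulr_ge0.
split.
- by rewrite addr_ge0 ?mulr_ge0 ?addr_ge0.
- by rewrite !lt_min d0 d'0 k0.
- by rewrite f0 g0 addr0.
- move=> u v; apply: (le_trans (ler_distD2 (fL u v) (gL u v))).
  by have : 0 <= 2 * (K * K') * `|u - v|; [rewrite !mulr_ge0|lra].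
- move=> u v r hu hv; rewrite !le_min => /andP[/andP[rd rd'] /andP[rk rk']].
  have r0 : 0 <= r by exact: le_trans (normr_ge0 u) hu.
  set F := fun u => f (p + u) - f p; set G := fun u => g (p + u) - g p.
  have Fb w : `|w| <= r -> `|F w| <= K * r.
    move=> hw; have := fK w 0 (le_trans hw rk).
    rewrite normr0 (ltW k0) addr0 subr0 => /(_ isT) /le_trans; apply.
    by rewrite ler_wpM2l.
  have Gb w : `|w| <= r -> `|G w| <= K' * r.
    move=> hw; have := gK w 0 (le_trans hw rk').
    rewrite normr0 (ltW k'0) addr0 subr0 => /(_ isT) /le_trans; apply.
    by rewrite ler_wpM2l.
  have dF : `|F u - F v| <= K * `|u - v|.
    by rewrite /F opprB addrA subrK fK // (le_trans _ rk).
  have dG : `|G u - G v| <= K' * `|u - v|.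
    by rewrite /G opprB addrA subrK gK // (le_trans _ rk').
  have dFG := ler_distM (Fb v hv) (Gb u hu) dF dG.
  have S1 := fS u v r hu hv rd; have S2 := gS u v r hu hv rd'.
  have -> : f (p + u) * g (p + u) - (g p * Lf u + f p * Lg u) -
     (f (p + v) * g (p + v) - (g p * Lf v + f p * Lg v)) =
     ((g p * f (p + u) - g p * Lf u) - (g p * f (p + v) - g p * Lf v)) +
     ((f p * g (p + u) - f p * Lg u) - (f p * g (p + v) - f p * Lg v)) +
     (F u * G u - F v * G v) by rewrite /F /G; ring.
  apply: (le_trans (ler_normD _ _)).
  have := ler_normD ((g p * f (p + u) - g p * Lf u) - (g p * f (p + v) - g p * Lf v))
     ((f p * g (p + u) - f p * Lg u) - (f p * g (p + v) - f p * Lg v)).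
  by move: S1 S2 dFG; clear; lra.
Qed.

Lemma strict_diff_comp (F : R -> R) f p L (D K e : R) : strict_diff f p L ->
  0 <= K -> 0 < e ->
  (forall x y r, `|x| <= r -> `|y| <= r -> r <= e ->
    `|(F (f p + x) - D * x) - (F (f p + y) - D * y)| <= K * r * `|x - y|) ->
  strict_diff (fun x => F (f x)) p (fun u => D * L u).
Proof.
move=> hf K0 e0 FK.
have [M [k [M0 k0 fM]]] := strict_diff_lipschitz hf.
have [C [d [C0 d0 f0 fL fS]]] := strict_diffZ D hf.
have M1 : 0 < M + 1 by rewrite ltr_wpDl.
exists (C + K * (M * M)), (Num.min (Num.min d k) (e / (M + 1))).
have MM : 0 <= M * M by rewrite mulr_ge0.
split.
- by rewrite addr_ge0 // mulr_ge0.
- by rewrite !lt_min d0 k0 divr_gt0.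
- by rewrite f0.
- move=> u v; apply: (le_trans (fL u v)).
  by rewrite ler_wpM2r // lerDl mulr_ge0.
- move=> u v r hu hv; rewrite !le_min => /andP[/andP[rd rk]].
  have r0 : 0 <= r by exact: le_trans (normr_ge0 u) hu.
  rewrite ler_pdivlMr // => re.
  set x := f (p + u) - f p; set y := f (p + v) - f p.
  have Fb w : `|w| <= r -> `|f (p + w) - f p| <= M * r.
    move=> hw; have := fM w 0 (le_trans hw rk).
    rewrite normr0 (ltW k0) addr0 subr0 => /(_ isT) /le_trans; apply.
    by rewrite ler_wpM2l.
  have dF : `|x - y| <= M * `|u - v|.
    by rewrite /x /y opprB addrA subrK fM // (le_trans _ rk).
  have Mre : M * r <= e by move: re r0; clear; lra.
  have S1 := fS u v r hu hv rd.
  have S2 := FK x y (M * r) (Fb u hu) (Fb v hv) Mre.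
  have S3 : K * (M * r) * `|x - y| <= K * (M * M) * r * `|u - v|.
    rewrite (_ : K * (M * M) * r * `|u - v| = K * (M * r) * (M * `|u - v|)).
      by rewrite ler_wpM2l // !mulr_ge0.
    by ring.
  have -> : F (f (p + u)) - D * L u - (F (f (p + v)) - D * L v) =
    ((D * f (p + u) - D * L u) - (D * f (p + v) - D * L v)) +
    ((F (f p + x) - D * x) - (F (f p + y) - D * y)).
    have -> : f p + x = f (p + u) by rewrite /x; ring.
    have -> : f p + y = f (p + v) by rewrite /y; ring.
    by rewrite /x /y; ring.
  apply: (le_trans (ler_normD _ _)); rewrite !mulrDl lerD //.
  exact: le_trans S2 S3.
Qed.

End strict_diff.

Lemma strict_coord (R : realType) n (p : 'rV[R]_n) i :
  strict_diff (fun x : 'rV[R]_n => x 0 i) p (fun u => u 0 i).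
Proof.
exists 1, 1; split=> // [|u v|u v r hu hv r1]; first by rewrite mxE.
- have -> : u 0 i - v 0 i = (u - v) 0 i by rewrite !mxE.
  by rewrite mul1r rV_coord_le.
- rewrite !mxE !addrK subrr normr0 mulr_ge0 // mul1r.
  exact: le_trans (normr_ge0 u) hu.
Qed.

Lemma expR_strict (R : realType) (a x y r : R) : `|x| <= r -> `|y| <= r -> r <= 1 ->
  `|(expR (a + x) - expR a * x) - (expR (a + y) - expR a * y)|
  <= expR a * expR 1 * r * `|x - y|.
Proof.
move=> hx hy r1.
have /andP[x0 x1] : - r <= x <= r by rewrite -ler_norml.
have /andP[y0 y1] : - r <= y <= r by rewrite -ler_norml.
apply: (@MVT_norm _ (fun x => expR (a + x) - expR a * x)
  (fun x => expR a * (expR x - 1))) => z.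
  move=> _.
  have h := derB (der_comp (is_derive_expR (a + z)) (derD (derC a z) (is_derive_id z 1)))
    (derM (derC (expR a) z) (is_derive_id z 1)).
  by apply: is_derive_eq h _; rewrite expRD; ring.
move=> /andP[hz1 hz2].
have hz : `|z| <= r.
  by rewrite ler_norml (le_trans _ hz1) ?(le_trans hz2) // ?ge_max ?le_min ?x1 ?y1 ?x0 ?y0.
rewrite normrM (ger0_norm (expR_ge0 a)) -mulrA ler_wpM2l ?expR_ge0 //.
have := @MVT_norm _ (@expR R) (@expR R) 0 z (expR 1).
rewrite subr0 expR0 => /(_ (fun x _ => is_derive_expR x)) h.
have e1 : expR 1 * `|z| <= expR 1 * r by rewrite ler_wpM2l // expR_ge0.
apply: le_trans e1; apply: h => t /andP[_ t1].
rewrite (ger0_norm (expR_ge0 _)) ler_expR (le_trans t1) // ge_max ler01.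
by rewrite (le_trans (ler_norm z)) // (le_trans hz).
Qed.

(** * First-order expansion of the pulse system at its stationary point *)

Section pulse_facts.
Context {R : realType} (D delta0 : R).
Hypotheses (hD : 0 < D) (hd : 0 < delta0 < 1 / 2).

Lemma sqrtD_gt0 : 0 < Num.sqrt D. Proof. by rewrite sqrtr_gt0. Qed.

Lemma sqrtD_sq : Num.sqrt D ^+ 2 = D. Proof. by rewrite sqr_sqrtr // ltW. Qed.

Lemma delta0_gt0 : 0 < delta0. Proof. by case/andP: hd. Qed.

Lemma m0_gt0 : 0 < m0 D.
Proof. by rewrite /m0 divr_gt0 // mulr_gt0 // sqrtD_gt0. Qed.

Lemma phi0 : phi D 0 = 2 * Num.sqrt D.
Proof.
rewrite /phi expr0n /= add0r sqrtrM // (_ : (4 : R) = 2 ^+ 2); last by ring.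
by rewrite sqrtr_sqr ger0_norm.
Qed.

Lemma phi_ge r : 2 * Num.sqrt D <= phi D r.
Proof. by rewrite -phi0 /phi ler_wsqrtr // expr0n /= lerD2r sqr_ge0. Qed.

Lemma phi_sq r : phi D r ^+ 2 = r ^+ 2 + 4 * D.
Proof. by rewrite /phi sqr_sqrtr // addr_ge0 ?sqr_ge0 // mulr_ge0 // ltW. Qed.

Lemma phi_even r : phi D (- r) = phi D r.
Proof. by rewrite /phi sqrrN. Qed.

(** [phi] is even, so its slope at 0 vanishes; the bound comes from the fact that squares of [phi]
    differ as the squares of the arguments do. The zeros fit the shape asked by
    [strict_diff_comp]. *)
Lemma phi_strict x y r : `|x| <= r -> `|y| <= r -> r <= 1 ->
  `|(phi D (0 + x) - 0 * x) - (phi D (0 + y) - 0 * y)|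
   <= (2 * Num.sqrt D)^-1 * r * `|x - y|.
Proof.
move=> hx hy _; rewrite !mul0r !subr0 !add0r.
have s0 := sqrtD_gt0.
have px := phi_ge x; have py := phi_ge y.
have e : (phi D x - phi D y) * (phi D x + phi D y) = (x - y) * (x + y).
  by rewrite -!subr_sqr !phi_sq; ring.
rewrite -mulrA mulrC ler_pdivlMr ?mulr_gt0 //.
have r0 : 0 <= r by exact: le_trans (normr_ge0 x) hx.
rewrite -(ler_pM2r (_ : 0 < 2)) //.
have h1 : `|phi D x - phi D y| * (phi D x + phi D y) <= r * `|x - y| * 2.
  have p0 : 0 <= phi D x + phi D y by lra.
  rewrite -{1}(ger0_norm p0) -normrM e normrM.
  rewrite (_ : r * `|x - y| * 2 = `|x - y| * (r + r)); last by ring.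
  by rewrite ler_wpM2l // (le_trans (ler_normD _ _)) // lerD.
apply: le_trans h1; rewrite -mulrA ler_wpM2l //; lra.
Qed.

(** At [pstar], [- kappa] and [- stiffness] are the partial derivatives of [rhs2] in [r1] and in
    [h]. The two thresholds are the values of [tau] with [lin_coef tau = kappa] and
    [lin_coef tau = - kappa]. *)
Definition kappa : R := 2 * delta0 * (G1 D + G0 * phi1 D * hstar D delta0).
Definition stiffness : R := delta0 / Num.sqrt D.
Definition Lambda : R := - ln (2 * delta0).
Definition pstar : 'rV[R]_3 := state (hstar D delta0) 0 0.
Definition lin_coef (tau : R) : R := Num.sqrt 2 * (tau_c D - tau).

Lemma Lambda_gt0 : 0 < Lambda.
Proof. by rewrite oppr_gt0 ln_lt0 //; case/andP: hd; lra. Qed.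

Lemma expR_Lambda : expR (- Lambda) = 2 * delta0.
Proof. by rewrite opprK lnK // posrE mulr_gt0 // delta0_gt0. Qed.

Lemma hstarE : hstar D delta0 = Num.sqrt D * Lambda.
Proof. by rewrite /hstar /Lambda; ring. Qed.

Lemma kappaE : kappa = delta0 * (1 + Lambda) / (2 * Num.sqrt D).
Proof.
have s0 := sqrtD_gt0; have d0 := sqrtD_sq.
rewrite /kappa /G1 /G0 /phi1 hstarE.
set q := Num.sqrt D in s0 d0 *; rewrite -d0; field; exact: lt0r_neq0.
Qed.

Lemma kappa_gt0 : 0 < kappa.
Proof.
have := Lambda_gt0; have := sqrtD_gt0; have := delta0_gt0; rewrite kappaE => *.
by rewrite divr_gt0 ?mulr_gt0 //; lra.
Qed.

Lemma stiffness_gt0 : 0 < stiffness.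
Proof. by rewrite /stiffness divr_gt0 ?delta0_gt0 ?sqrtD_gt0. Qed.

Lemma state0 h r2 r1 : (state h r2 r1 : 'rV[R]_3) 0 0 = h.
Proof. by rewrite mxE. Qed.
Lemma state1 h r2 r1 : (state h r2 r1 : 'rV[R]_3) 0 1 = r2.
Proof. by rewrite mxE. Qed.
Lemma state2 h r2 r1 : (state h r2 r1 : 'rV[R]_3) 0 2 = r1.
Proof. by rewrite mxE. Qed.

Lemma rhs1_rhs2 tau h r2 r1 :
  rhs1 D delta0 tau h r2 r1 = - rhs2 D delta0 tau h (- r1) (- r2).
Proof. by rewrite /rhs1 /rhs2 phi_even; ring. Qed.

(** Covers both exponentials of the system: [s = 1] with the coordinate [r1], and [s = - 1] with the
    coordinate [r2]. *)
Lemma strict_exp s (i : 'I_3) : i != 0 ->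
  strict_diff (fun x : 'rV[R]_3 =>
    expR (- ((s * x 0 i + phi D (s * x 0 i)) / (2 * D)) * x 0 0)) pstar
    (fun u => 2 * delta0 * (- s * Lambda / (2 * Num.sqrt D) * u 0 i
                            - u 0 0 / Num.sqrt D)).
Proof.
move=> i0.
have pi0 : pstar 0 i = 0 by rewrite mxE; case: i i0 => -[|[|[|]]].
have s0 := sqrtD_gt0; have sq := sqrtD_sq.
have hr := strict_diffZ s (strict_coord pstar i).
have sV : 0 <= (2 * Num.sqrt D)^-1 by rewrite invr_ge0 mulr_ge0 // ltW.
have hphi := @strict_diff_comp R _ (phi D) _ _ _ 0 _ 1 hr sV ltr01.
rewrite /= pi0 mulr0 in hphi; move: hphi => /(_ phi_strict) hphi.
have hin := strict_diffM (strict_diffZ (- (2 * D)^-1) (strict_diffD hr hphi))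
  (strict_coord pstar 0).
have e1 : 0 <= expR (- Lambda) * expR 1 by rewrite mulr_ge0 // expR_ge0.
have hex := @strict_diff_comp R _ (@expR R) _ _ _ (expR (- Lambda)) _ 1 hin e1 ltr01.
rewrite /= pi0 !mulr0 !add0r state0 phi0 hstarE in hex.
have ev : - (2 * D)^-1 * (2 * Num.sqrt D) * (Num.sqrt D * Lambda) = - Lambda.
  by set q := Num.sqrt D in s0 sq *; rewrite -sq; field; exact: lt0r_neq0.
rewrite ev in hex.
apply: strict_diff_ext (hex (expR_strict (- Lambda))) _ _ => x.
- by congr expR; ring.
- rewrite expR_Lambda; set q := Num.sqrt D in s0 sq *; rewrite -sq.
  by field; exact: lt0r_neq0.
Qed.

Lemma strict_rhs2 tau :
  strict_diff (fun x : 'rV[R]_3 => rhs2 D delta0 tau (x 0 0) (x 0 1) (x 0 2))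
    pstar (fun u => lin_coef tau * u 0 1 - kappa * u 0 2 - stiffness * u 0 0).
Proof.
have s0 := sqrtD_gt0; have sq := sqrtD_sq.
have h1 := strict_coord pstar 1; have h2 := strict_coord pstar 2.
have hexp := @strict_exp 1 2 isT.
have hq := strict_diffD (strict_diff_cst G0 pstar) (strict_diffZ (- G1 D) h2).
have h := strict_diffD (strict_diffD (strict_diffD (strict_diffZ (lin_coef tau) h1)
  (strict_diffZ (- g3 D) (strict_diffM h1 (strict_diffM h1 h1))))
  (strict_diffM hq hexp)) (strict_diff_cst (- delta0) pstar).
apply: strict_diff_ext h _ _ => x /=.
- by rewrite /rhs2 /lin_coef !mul1r; ring.
- rewrite !(state0, state1, state2) mul1r mulr0 add0r phi0 hstarE.
  have -> : - (2 * Num.sqrt D / (2 * D)) * (Num.sqrt D * Lambda) = - Lambda.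
    by set q := Num.sqrt D in s0 sq *; rewrite -sq; field; exact: lt0r_neq0.
  rewrite expR_Lambda kappaE /stiffness /G0 /G1; field; exact: lt0r_neq0.
Qed.

Lemma strict_rhs1 tau :
  strict_diff (fun x : 'rV[R]_3 => rhs1 D delta0 tau (x 0 0) (x 0 1) (x 0 2))
    pstar (fun u => lin_coef tau * u 0 2 - kappa * u 0 1 + stiffness * u 0 0).
Proof.
have s0 := sqrtD_gt0; have sq := sqrtD_sq.
have h1 := strict_coord pstar 1; have h2 := strict_coord pstar 2.
have hexp := @strict_exp (-1) 1 isT.
have hq := strict_diffD (strict_diff_cst (- G0) pstar) (strict_diffZ (- G1 D) h1).
have h := strict_diffD (strict_diffD (strict_diffD (strict_diffZ (lin_coef tau) h2)
  (strict_diffZ (- g3 D) (strict_diffM h2 (strict_diffM h2 h2))))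
  (strict_diffM hq hexp)) (strict_diff_cst delta0 pstar).
apply: strict_diff_ext h _ _ => x /=.
- by rewrite /rhs1 /lin_coef !mulN1r phi_even; ring.
- rewrite !(state0, state1, state2) (mulr0 (-1)) add0r phi0 hstarE.
  have -> : - (2 * Num.sqrt D / (2 * D)) * (Num.sqrt D * Lambda) = - Lambda.
    by set q := Num.sqrt D in s0 sq *; rewrite -sq; field; exact: lt0r_neq0.
  rewrite expR_Lambda kappaE /stiffness /G0 /G1; field; exact: lt0r_neq0.
Qed.

End pulse_facts.

(** * Jacobian matrices from strict differentials *)

Lemma diff_linear_approx (R : realType) (V W : normedModType R) (f : V -> W)
    (L : {linear V -> W}) (p : V) : continuous L ->
  (forall e : R, 0 < e -> \forall u \near (0 : V),
    `|f (p + u) - f p - L u| <= e * `|u|) ->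
  'd f p = L :> (V -> W).
Proof.
move=> cL hf; apply: diff_unique => //.
apply/eqaddoP => e e0; apply: filterS (hf e e0) => u.
by rewrite !fctE /= opprD addrA (addrC u p).
Qed.

Section jacobian_of_strict_diff.
Context {R : realType} {n m : nat}.

Lemma jacobian_eq (f : 'rV[R]_n -> 'rV[R]_m) (p : 'rV[R]_n) (J : 'M[R]_(n, m)) :
  (forall u, 'd f p u = u *m J) -> jacobian f p = J.
Proof.
by move=> E; apply/row_matrixP => i; rewrite !rowE mul_rV_lin1 E.
Qed.

Lemma strict_diff_jacobian (f : 'rV[R]_n -> 'rV[R]_m) (p : 'rV[R]_n)
    (J : 'M[R]_(n, m)) :
  (forall j, strict_diff (fun x => f x 0 j) p (fun u => (u *m J) 0 j)) ->
  jacobian f p = J.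
Proof.
move=> hf.
have [C hC] := choice hf; have [d hCd] := choice hC.
pose K := \sum_j C j.
have CK j : C j <= K.
  rewrite /K (bigD1 j) //= lerDl sumr_ge0 // => i _.
  by have [] := hCd i.
have K0 : 0 <= K by rewrite sumr_ge0 // => i _; have [] := hCd i.
have K1 : 0 < K + 1 by rewrite ltr_wpDl.
have linK (u v : 'rV[R]_n) : `|u *m J - v *m J| <= K * `|u - v|.
  apply: rV_norm_le => [|j]; first by rewrite mulr_ge0.
  have [_ _ _ h _] := hCd j; have := h u v.
  by rewrite !mxE => /le_trans; apply; rewrite ler_wpM2r.
have contJ : continuous (mulmxr J : 'rV[R]_n -> 'rV[R]_m).
  exact: lipschitz_continuous K0 linK.
have E : 'd f p = mulmxr J :> ('rV[R]_n -> 'rV[R]_m).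
  apply: diff_linear_approx contJ _ => e e0.
  have : \forall u \near (0 : 'rV[R]_n), forall j,
      `|u| <= d j /\ `|u| <= e / (K + 1).
    apply: (@filter_forall _ 'I_m (fun j (u : 'rV[R]_n) =>
      `|u| <= d j /\ `|u| <= e / (K + 1)) _ (nbhs_filter (0 : 'rV[R]_n))) => j; have [_ d0 _ _ _] := hCd j.
    have e0' : 0 < e / (K + 1) by rewrite divr_gt0.
    have m0 : 0 < Num.min (d j) (e / (K + 1)) by rewrite lt_min d0.
    by apply: filterS (nbhs0_le m0) => u; rewrite le_min => /andP[].
  apply: filterS => u hu.
  apply: rV_norm_le => [|j]; first by rewrite mulr_ge0 // ltW.
  have [hdj] := hu j; rewrite ler_pdivlMr // => he.
  (* With [v = 0] and the radius equal to the norm of [u], the strict bound becomes quadratic in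
     [u]. *)
  have [C0 d0 L0 _ h] := hCd j; have := h u 0 `|u| (lexx _) _ hdj.
  rewrite normr0 normr_ge0 => /(_ isT); rewrite addr0 subr0 L0 subr0 => h1.
  have -> : (f (p + u) - f p - mulmxr J u) 0 j =
     f (p + u) 0 j - (u *m J) 0 j - f p 0 j by rewrite !mxE; ring.
  apply: (le_trans h1); rewrite ler_wpM2r //.
  have := CK j; have := normr_ge0 u; move: he; clear -K0; nra.
apply: jacobian_eq => u; exact: (congr1 (@^~ u) E).
Qed.

End jacobian_of_strict_diff.

(** * Characteristic polynomial of the linearization *)

Lemma det_mx22 (R : comPzRingType) (A : 'M[R]_2) :
  \det A = A 0 0 * A 1 1 - A 0 1 * A 1 0.
Proof.
rewrite (expand_det_row _ 0) !big_ord_recl big_ord0 /cofactor !det_mx11 !mxE /=.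
rewrite addr0 expr0 mul1r expr1 mulN1r mulrN.
by congr (_ * A _ _ - A _ _ * A _ _); apply/val_inj.
Qed.

Lemma det_mx33 (R : comPzRingType) (A : 'M[R]_3) :
  \det A = A 0 0 * (A 1 1 * A 2 2 - A 1 2 * A 2 1)
         - A 0 1 * (A 1 0 * A 2 2 - A 1 2 * A 2 0)
         + A 0 2 * (A 1 0 * A 2 1 - A 1 1 * A 2 0).
Proof.
rewrite (expand_det_row _ 0) !big_ord_recl big_ord0 /cofactor !det_mx22 !mxE /=.
have e00 : ord0 = 0 :> 'I_3 by apply/val_inj.
have l0 : lift ord0 ord0 = 1 :> 'I_3 by apply/val_inj.
have l1 : lift ord0 (lift ord0 ord0) = 2 :> 'I_3 by apply/val_inj.
have l2 : lift ord0 (1 : 'I_2) = 2 :> 'I_3 by apply/val_inj.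
have l3 : lift ord0 (0 : 'I_2) = 1 :> 'I_3 by apply/val_inj.
have m0 : lift (1 : 'I_3) (0 : 'I_2) = 0 by apply/val_inj.
have m1 : lift (1 : 'I_3) (1 : 'I_2) = 2 by apply/val_inj.
have n0 : lift (2 : 'I_3) (0 : 'I_2) = 0 by apply/val_inj.
have n1 : lift (2 : 'I_3) (1 : 'I_2) = 1 by apply/val_inj.
have z0 : lift (0 : 'I_3) (0 : 'I_2) = 1 by apply/val_inj.
have z1 : lift (0 : 'I_3) (1 : 'I_2) = 2 by apply/val_inj.
rewrite !(e00, l1, l0, l2, l3, m0, m1, n0, n1, z0, z1) /=.
by rewrite /bump /= expr0 expr1 sqrrN expr1n; ring.
Qed.

(** The transpose of the matrix of [h' = r2 - r1], [r2' = - c h + a r2 - k r1],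
    [r1' = c h - k r2 + a r1]. *)
Definition mode_mx (F : pzRingType) (a k c : F) : 'M[F]_3 :=
  \matrix_(i < 3, j < 3)
    (nth [::] [:: [:: 0; - c; c]; [:: 1; a; - k]; [:: -1; - k; a]] i)`_j.

Lemma char_poly_mode_mx (F : comNzRingType) (a k c : F) :
  char_poly (mode_mx a k c) =
  ('X - (a - k)%:P) * ('X^2 - (a + k)%:P * 'X + (2 * c)%:P).
Proof.
rewrite /char_poly det_mx33 /char_poly_mx !mxE /= !polyCB !polyCD polyCM polyCMn.
rewrite !polyCN polyC0 polyC1 !mulr0n !mulr1n.
set A := a%:P; set K := k%:P; set C := c%:P; ring.
Qed.
Lemma map_mode_mx (F G : pzRingType) (f : {rmorphism F -> G}) (a k c : F) :
  map_mx f (mode_mx a k c) = mode_mx (f a) (f k) (f c).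
Proof.
apply/matrixP => i j; rewrite !mxE.
by case: i => -[|[|[|//]]] hi; case: j => -[|[|[|//]]] hj /=;
   rewrite ?rmorph0 ?rmorph1 ?rmorphN ?rmorph1.
Qed.

Section crossing.
Context {R : realType}.
Implicit Types a k c : R.

Local Notation A a k c := (map_mx (real_complex R) (mode_mx a k c)).

Lemma char_poly_mode a k c : char_poly (A a k c) =
  ('X - (a - k)%:C%C%:P) * ('X^2 - (a + k)%:C%C%:P * 'X + (2 * c)%:C%C%:P).
Proof.
rewrite map_mode_mx char_poly_mode_mx -rmorphB -rmorphD.
by rewrite -[2 * _](_ : (2 * c)%:C%C = _) // rmorphM rmorph_nat.
Qed.

Lemma eigenvalue_mode a k c x y : eigenvalue (A a k c) (x +i* y)%C =
  ((x == a - k) && (y == 0)) ||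
  ((x ^+ 2 - y ^+ 2 - (a + k) * x + 2 * c == 0) && (2 * x * y - (a + k) * y == 0)).
Proof.
rewrite eigenvalue_root_char char_poly_mode rootM root_XsubC eq_complex /=.
congr (_ || _); rewrite rootE !hornerE /= expr2 eq_complex /=.
congr (_ && _); congr (_ == _); ring.
Qed.

Lemma mup_mode_zero k c : 0 < c ->
  mup (0 +i* 0)%C (char_poly (A k k c)) = 1%N.
Proof.
move=> c0; rewrite char_poly_mode mupMl.
  by rewrite subrr -['X - _]expr1 mup_XsubCX eqxx.
rewrite rootE !hornerE /= expr2 eq_complex /= negb_and; apply/orP; left.
by apply/eqP => h; move: c0 h; clear; lra.
Qed.

Lemma mup_mode_imag k c (w : R) : 0 < k -> 0 < w -> w ^+ 2 = 2 * c ->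
  mup (0 +i* w)%C (char_poly (A (- k) k c)) = 1%N.
Proof.
move=> k0 w0 w2; rewrite char_poly_mode mupMr; last first.
  by rewrite root_XsubC eq_complex /= (gt_eqF w0) andbF.
have -> : 'X^2 - (- k + k)%:C%C%:P * 'X + (2 * c)%:C%C%:P =
   ('X - (0 +i* w)%C%:P) * ('X - (0 -i* w)%C%:P) :> {poly R[i]}.
  have -> : (0 -i* w)%C = - (0 +i* w)%C by rewrite /GRing.opp /= oppr0.
  have -> : (2 * c)%:C%C = - ((0 +i* w)%C * (0 +i* w)%C).
    by apply/eqP; rewrite eq_complex /= -w2; apply/andP; split; apply/eqP; ring.
  by rewrite addNr [(0)%:C%C](_ : _ = 0) // !polyCN polyCM; ring.
rewrite mupMl; first by rewrite -['X - _]expr1 mup_XsubCX eqxx.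
by rewrite root_XsubC eq_complex /= eqxx /= -addr_eq0 gt_eqF ?addr_gt0.
Qed.

End crossing.

(** * Eigenvalues crossing the imaginary axis *)

Lemma pulse_linearization (R : realType) (D delta0 tau : R) :
  0 < D -> 0 < delta0 < 1 / 2 ->
  linearization (pulse_field D delta0 tau) (pstar D delta0) =
  map_mx (real_complex R)
    (mode_mx (lin_coef D tau / m0 D) (kappa D delta0 / m0 D) (stiffness D delta0 / m0 D)).
Proof.
move=> hD hd; rewrite /linearization; congr map_mx.
apply: strict_diff_jacobian => j.
have h0 := strict_diffD (strict_coord (pstar D delta0) 1)
  (strict_diffZ (-1) (strict_coord (pstar D delta0) 2)).
have h1 := strict_diffZ (m0 D)^-1 (strict_rhs2 hD hd tau).
have h2 := strict_diffZ (m0 D)^-1 (strict_rhs1 hD hd tau).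
have e0 : (ord0 : 'I_3) = 0 by apply/val_inj.
have e1 : lift (ord0 : 'I_3) ord0 = 1 by apply/val_inj.
have e2 : lift (ord0 : 'I_3) (lift ord0 ord0) = 2 by apply/val_inj.
case: j => -[|[|[|//]]] hj; [apply: strict_diff_ext h0 _ _|
  apply: strict_diff_ext h1 _ _|apply: strict_diff_ext h2 _ _] => u /=;
  rewrite !mxE /= ?big_ord_recl ?big_ord0 ?mxE /= ?e0 ?e1 ?e2; ring.
Qed.

Section eigenvalue_crossings.
Context {R : realType} (D delta0 : R).
Hypotheses (hD : 0 < D) (hd : 0 < delta0 < 1 / 2).

Lemma sqrt2_sq : Num.sqrt 2 ^+ 2 = 2 :> R. Proof. by rewrite sqr_sqrtr. Qed.

Lemma lin_coef_tau_d : lin_coef D (tau_d D delta0) = kappa D delta0.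
Proof. by have := sqrt2_sq; rewrite /lin_coef /tau_d /kappa => e; ring: e. Qed.

Lemma lin_coef_tau_H : lin_coef D (tau_H D delta0) = - kappa D delta0.
Proof. by have := sqrt2_sq; rewrite /lin_coef /tau_H /kappa => e; ring: e. Qed.

Lemma is_derive_lin_coef (s b tau : R) :
  is_derive tau 1 (fun tau => s * (lin_coef D tau + b)) (- s * Num.sqrt 2).
Proof.
have h := derM (derC s tau) (derD (derM (derC (Num.sqrt 2) tau)
  (derB (derC (tau_c D) tau) (is_derive_id tau 1))) (derC b tau)).
by apply: is_derive_eq h _; ring.
Qed.

Lemma crossing_d : eigenvalue_crossing (pulse_field D delta0) (pstar D delta0)
  (tau_d D delta0) 0.
Proof.
have k0 := kappa_gt0 hD hd; have m0_0 := m0_gt0 hD; have c0 := stiffness_gt0 hD hd.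
have hlin tau := pulse_linearization tau hD hd.
have da tau := is_derive_lin_coef (m0 D)^-1 (- kappa D delta0) tau.
have s2 : 0 < Num.sqrt 2 :> R by rewrite sqrtr_gt0.
split; [|split].
- exists (fun tau => (m0 D)^-1 * (lin_coef D tau + - kappa D delta0)), (cst 0); split.
  + near=> tau; rewrite hlin eigenvalue_mode.
    by rewrite -mulrBl mulrC !eqxx.
  + by rewrite lin_coef_tau_d subrr mulr0.
  + have [h1 ->] := da (tau_d D delta0); split => //.
    by rewrite mulNr oppr_eq0 mulf_neq0 ?invr_eq0 ?gt_eqF.
  + exact: cst_continuous.
- by rewrite hlin lin_coef_tau_d mup_mode_zero // divr_gt0.
- move=> y; rewrite hlin lin_coef_tau_d eigenvalue_mode oppr0.
  case/orP => [/andP[_ /eqP->]|/andP[_]]; first by left.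
  rewrite mulr0 mul0r sub0r oppr_eq0 mulf_eq0 => /orP[|/eqP->]; last by left.
  by rewrite gt_eqF // addr_gt0 // divr_gt0.
Unshelve. all: by end_near. Qed.

Definition omega0 : R := Num.sqrt (2 * (stiffness D delta0 / m0 D)).

Lemma omega0_gt0 : 0 < omega0.
Proof. by rewrite sqrtr_gt0 mulr_gt0 // divr_gt0 ?stiffness_gt0 ?m0_gt0. Qed.

Lemma omega0_sq : omega0 ^+ 2 = 2 * (stiffness D delta0 / m0 D).
Proof.
by rewrite sqr_sqrtr // mulr_ge0 // ltW // divr_gt0 ?stiffness_gt0 ?m0_gt0.
Qed.

Lemma crossing_H : eigenvalue_crossing (pulse_field D delta0) (pstar D delta0)
  (tau_H D delta0) omega0.
Proof.
have k0 := kappa_gt0 hD hd; have m0_0 := m0_gt0 hD; have c0 := stiffness_gt0 hD hd.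
have w0 := omega0_gt0; have w2 := omega0_sq.
have hlin tau := pulse_linearization tau hD hd.
(* Half the trace on the invariant plane: the real part of the pair as long as the discriminant is
   negative. *)
pose al tau := (2 * m0 D)^-1 * (lin_coef D tau + kappa D delta0).
have da (tau : R) : is_derive tau 1 al (- (2 * m0 D)^-1 * Num.sqrt 2).
  exact: is_derive_lin_coef.
have s2 : 0 < Num.sqrt 2 :> R by rewrite sqrtr_gt0.
have calpha : continuous al.
  by move=> tau; apply: is_derive_continuous (da tau).
have cg : continuous (fun tau => omega0 ^+ 2 - al tau * al tau).
  by apply: continuous_sub; [exact: cst_continuous|exact: continuous_mul].
have al0 : al (tau_H D delta0) = 0 by rewrite /al lin_coef_tau_H addNr mulr0.
split; [|split].
- exists al, (fun tau => Num.sqrt (omega0 ^+ 2 - al tau * al tau)); split.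
  + near=> tau; rewrite hlin eigenvalue_mode; apply/orP; right.
    have pos : 0 < omega0 ^+ 2 - al tau * al tau.
      near: tau; apply: (cvgr_gt (omega0 ^+ 2 - al (tau_H D delta0) * al (tau_H D delta0))).
        exact: cg.
      by rewrite al0 mulr0 subr0 exprn_gt0.
    have e : lin_coef D tau / m0 D + kappa D delta0 / m0 D = 2 * al tau.
      by rewrite /al; field; exact: lt0r_neq0.
    rewrite sqr_sqrtr ?(ltW pos) // e -w2.
    by apply/andP; split; apply/eqP; ring.
  + by rewrite al0 mulr0 subr0 sqrtr_sqr gtr0_norm.
  + have [h1 ->] := da (tau_H D delta0); split => //.
    by rewrite mulNr oppr_eq0 mulf_neq0 ?invr_eq0 ?gt_eqF // mulr_gt0.
  + apply: continuous_comp; first exact: cg.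
    exact: sqrt_continuous.
- rewrite hlin lin_coef_tau_H mulNr mup_mode_imag //; last exact: divr_gt0.
- move=> y; rewrite hlin lin_coef_tau_H eigenvalue_mode.
  case/orP => [/andP[/eqP h _]|/andP[/eqP h _]].
    exfalso; have := divr_gt0 k0 m0_0; move: h; rewrite mulNr; lra.
  have : (y - omega0) * (y + omega0) = 0.
    by rewrite -subr_sqr w2; move: h; rewrite mulNr addNr; lra.
  move/eqP; rewrite mulf_eq0 subr_eq0 addr_eq0 => /orP[]/eqP; tauto.
Unshelve. all: by end_near. Qed.

End eigenvalue_crossings.

(** * Rescaling by the amplitude *)

Lemma is_derive_rV (R : realType) n (f : R -> 'rV[R]_n) (df : 'rV[R]_n) (t : R) :
  (forall i, is_derive t 1 (fun s => f s 0 i) (df 0 i)) -> is_derive t 1 f df.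
Proof.
move=> h.
have d : derivable f t 1.
  by apply/derivable_mxP => i j; rewrite ord1; have [] := h j.
apply: DeriveDef => //; rewrite derive_mx //; apply/rowP => j.
by rewrite !mxE; have [] := h j.
Qed.

(** The constant may depend on the point [x]: the periodic family has phase [w0 / (1 + q e) * t],
    whose variation with [e] grows with [t]. *)
Lemma within_continuous_lipschitz_at (R : realType) (V W : normedModType R)
    (A : set V) (f : V -> W) :
  (forall x, A x -> exists2 K, 0 <= K &
     forall y, A y -> `|f x - f y| <= K * `|x - y|) ->
  {within A, continuous f}.
Proof.
move=> hf; apply/subspace_continuousP => x Ax.
have [K K0 fK] := hf x Ax; have K1 : 0 < K + 1 by rewrite ltr_wpDl.
apply/cvgrPdist_le => /= e e0.
apply/nbhs_ballP; exists (e / (K + 1)) => /= [|y]; first by rewrite divr_gt0.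
rewrite -ball_normE /= => xy Ay; apply: (le_trans (fK y Ay)); move: xy.
by rewrite ltr_pdivlMr //; have := normr_ge0 (x - y); nra.
Qed.

Section blow_up.
Context {R : realType} {V : normedModType R}.

(** At scale [e] the arguments of [Q] have size [e * M], where [Q] has Lipschitz constant of order
    [e]. Hence [Q] is of order [e ^ 2], and after division by [e] both the values and the slopes are
    of order [e]. *)
Lemma blow_up (Q : V -> R) (W : R -> R -> V) (C d B : R) :
  0 <= C -> 0 < d -> 0 <= B -> Q 0 = 0 -> W 0 0 = 0 ->
  (forall u v r, `|u| <= r -> `|v| <= r -> r <= d ->
    `|Q u - Q v| <= C * r * `|u - v|) ->
  (forall y z y' z', `|W y z - W y' z'| <= B * (`|y - y'| + `|z - z'|)) ->
  exists C' e1, [/\ 0 <= C', 0 < e1,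
    forall e, 0 <= e <= e1 -> small_pert (C' * e) (fun y z => Q (e *: W y z) / e) &
    forall e e' y z : R, 0 <= e <= e1 -> 0 <= e' <= e1 -> `|y| <= 2 -> `|z| <= 2 ->
      `|Q (e *: W y z) / e - Q (e' *: W y z) / e'| <= C' * `|e - e'|].
Proof.
move=> C0 d0 B0 Q0 W0 hQ hW.
pose M := 4 * B; have M0 : 0 <= M by rewrite mulr_ge0.
have WM y z : `|y| <= 2 -> `|z| <= 2 -> `|W y z| <= M.
  move=> y2 z2; have := hW y z 0 0; rewrite W0 !subr0 => /le_trans; apply.
  by rewrite /M mulrC ler_wpM2r //; lra.
have M1 : 0 < M + 1 by rewrite ltr_wpDl.
pose e1 := d / (M + 1).
have e1M (e : R) : 0 <= e <= e1 -> e * M <= d.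
  by rewrite ler_pdivlMr // => /andP[h1 h2]; move: h1 h2; clear; lra.
have sW (e y z : R) : 0 <= e -> `|y| <= 2 -> `|z| <= 2 -> `|e *: W y z| <= e * M.
  by move=> e0 y2 z2; rewrite normrZ (ger0_norm e0) ler_wpM2l // WM.
have CMB : 0 <= C * M * B by rewrite !mulr_ge0.
have CMM : 0 <= C * M * M by rewrite !mulr_ge0.
have Nb (e y z : R) : 0 <= e <= e1 -> `|y| <= 2 -> `|z| <= 2 ->
    `|Q (e *: W y z)| <= C * M * M * e * e.
  move=> he y2 z2; have /andP[e0 _] := he.
  have := hQ (e *: W y z) 0 (e * M) (sW e y z e0 y2 z2) _ (e1M e he).
  rewrite normr0 Q0 !subr0 mulr_ge0 // => /(_ isT) /le_trans; apply.
  rewrite (_ : C * M * M * e * e = C * (e * M) * (e * M)); last by ring.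
  by rewrite ler_wpM2l ?sW // !mulr_ge0.
exists (C * M * B + 2 * (C * M * M)), e1; split.
- by rewrite addr_ge0 // mulr_ge0.
- by rewrite divr_gt0.
- move=> e he; have /andP[e0 _] := he => y z y' z' y2 z2 y'2 z'2.
  (* Division by zero returns zero, which is the limit of the rescaled perturbation. *)
  have [->|ne] := eqVneq e 0.
    by rewrite mulr0 mul0r invr0 !mulr0 subrr normr0.
  have ep : 0 < e by rewrite lt_neqAle eq_sym ne.
  split.
    rewrite normrM normfV (gtr0_norm ep) ler_pdivrMr //.
    apply: (le_trans (Nb e y z he y2 z2)); rewrite !ler_wpM2r //; lra.
  rewrite -mulrBl normrM normfV (gtr0_norm ep) ler_pdivrMr //.
  apply: (le_trans (hQ _ _ _ (sW e y z e0 y2 z2) (sW e y' z' e0 y'2 z'2) (e1M e he))).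
  rewrite -scalerBr normrZ (gtr0_norm ep).
  have s0 : 0 <= `|y - y'| + `|z - z'| by rewrite addr_ge0.
  have h1 : C * (e * M) * (e * `|W y z - W y' z'|) <=
      C * (e * M) * (e * (B * (`|y - y'| + `|z - z'|))).
    by rewrite ler_wpM2l ?mulr_ge0 // ler_wpM2l.
  apply: (le_trans h1).
  rewrite (_ : C * (e * M) * (e * (B * (`|y - y'| + `|z - z'|))) =
    C * M * B * (e * (`|y - y'| + `|z - z'|) * e)); last by ring.
  rewrite (_ : (_ + _) * e * _ * e = (C * M * B + 2 * (C * M * M)) *
    (e * (`|y - y'| + `|z - z'|) * e)); last by ring.
  by rewrite ler_wpM2r ?mulr_ge0 //; lra.
- move=> e e' y z; wlog le_e : e e' / e' <= e => [hw|] he he' y2 z2.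
    have [le_e|/ltW le_e] := leP e' e; first exact: hw.
    by rewrite distrC (distrC e); apply: hw.
  have /andP[e0 _] := he; have /andP[e'0 _] := he'.
  have K2 : C * M * M <= C * M * B + 2 * (C * M * M) by lra.
  have [E'|ne'] := eqVneq e' 0.
    rewrite E' scale0r Q0 mul0r !subr0 (ger0_norm e0).
    have [->|ne] := eqVneq e 0; first by rewrite scale0r Q0 mul0r normr0 mulr0.
    have ep : 0 < e by rewrite lt_neqAle eq_sym ne.
    rewrite normrM normfV (gtr0_norm ep) ler_pdivrMr //.
    by apply: (le_trans (Nb e y z he y2 z2)); rewrite !ler_wpM2r.
  have e'p : 0 < e' by rewrite lt_neqAle eq_sym ne'.
  have ep : 0 < e by exact: lt_le_trans e'p le_e.
  have d0' : 0 <= e - e' by rewrite subr_ge0.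
  rewrite (ger0_norm d0').
  (* The change of the argument and the change of the divisor are separated; each costs
     [C * M * M * (e - e')]. *)
  have -> : Q (e *: W y z) / e - Q (e' *: W y z) / e' =
    (Q (e *: W y z) - Q (e' *: W y z)) / e - Q (e' *: W y z) / e' * ((e - e') / e).
    by field; rewrite !gt_eqF.
  have h1 : `|(Q (e *: W y z) - Q (e' *: W y z)) / e| <= C * M * M * (e - e').
    rewrite normrM normfV (gtr0_norm ep) ler_pdivrMr //.
    have hs : `|e' *: W y z| <= e * M.
      by apply: (le_trans (sW e' y z e'0 y2 z2)); rewrite ler_wpM2r.
    apply: (le_trans (hQ _ _ _ (sW e y z e0 y2 z2) hs (e1M e he))).
    rewrite -scalerBl normrZ (ger0_norm d0').
    rewrite (_ : C * M * M * (e - e') * e = C * (e * M) * ((e - e') * M)); last by ring.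
    by rewrite ler_wpM2l ?mulr_ge0 // ler_wpM2l // WM.
  have h2 : `|Q (e' *: W y z) / e' * ((e - e') / e)| <= C * M * M * (e - e').
    have q1 : `|Q (e' *: W y z) / e'| <= C * M * M * e'.
      rewrite normrM normfV (gtr0_norm e'p) ler_pdivrMr //; exact: Nb.
    have q2 : `|(e - e') / e| <= (e - e') / e by rewrite ger0_norm // divr_ge0.
    apply: (le_trans (ler_normM q1 q2)).
    rewrite (_ : C * M * M * e' * ((e - e') / e) =
      C * M * M * (e - e') * (e' / e)); last by ring.
    by rewrite ler_piMr ?mulr_ge0 // ler_pdivrMr // mul1r.
  apply: (le_trans (ler_normB _ _)).
  have : 0 <= C * M * B * (e - e') by rewrite mulr_ge0.
  by move: h1 h2; clear; lra.
Qed.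

End blow_up.

(** * The Hopf bifurcation of the pulse system *)

Lemma stationaryP (R : realType) n (f : 'rV[R]_n -> 'rV[R]_n) (p : 'rV[R]_n) :
  stationary f p <-> f p = 0.
Proof.
split=> [/(_ 0)|E t]; last by rewrite /cst E; exact: is_derive_cst.
by case=> _ <-; rewrite derive_cst.
Qed.

Section hopf.
Context {R : realType} (D delta0 : R).
Hypotheses (hD : 0 < D) (hd : 0 < delta0 < 1 / 2).

Local Notation p := (pstar D delta0).
Local Notation w0 := (omega0 D delta0).

Lemma rhs2_pstar tau : rhs2 D delta0 tau (hstar D delta0) 0 0 = 0.
Proof.
have s0 := sqrtD_gt0 hD; have sq := sqrtD_sq hD.
rewrite /rhs2 !mulr0 subr0 !add0r phi0 hstarE.
have -> : - (2 * Num.sqrt D / (2 * D)) * (Num.sqrt D * Lambda delta0) = - Lambda delta0.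
  by set q := Num.sqrt D in s0 sq *; rewrite -sq; field; exact: lt0r_neq0.
by rewrite (expR_Lambda hd) /G0 expr0n /=; field.
Qed.

Lemma pulse_field_pstar tau : pulse_field D delta0 tau p = 0.
Proof.
apply/rowP => i; rewrite /pulse_field /p !mxE /=.
rewrite rhs1_rhs2 !oppr0 !rhs2_pstar !oppr0 addr0 !mul0r.
by case: i => -[|[|[|]]].
Qed.

(** Since [lin_coef] vanishes at [tau_c], the parameter can be moved entirely into a linear damping
    term. The nonlinear remainder is thus independent of [tau], and the unknown parameter is carried
    by [l]. *)
Lemma rhs2_lin_coef tau h r2 r1 : rhs2 D delta0 tau h r2 r1 =
  rhs2 D delta0 (tau_c D) h r2 r1 + lin_coef D tau * r2.
Proof. by rewrite /rhs2 /lin_coef; ring. Qed.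

(** The factor [w0 / 2] makes [h' = r2 - r1] read [y' = w0 * z], the first oscillator equation in
    the time [w0 * t]. *)
Definition plane_vec (y z : R) : 'rV[R]_3 := state y (w0 / 2 * z) (- (w0 / 2 * z)).

Definition remainder (u : 'rV[R]_3) : R :=
  (rhs2 D delta0 (tau_c D) ((p + u) 0 0) ((p + u) 0 1) ((p + u) 0 2)
   + kappa D delta0 * u 0 2 + stiffness D delta0 * u 0 0) / stiffness D delta0.

Lemma remainder_bound : exists C d : R, [/\ 0 <= C, 0 < d &
  forall u v r, `|u| <= r -> `|v| <= r -> r <= d ->
    `|remainder u - remainder v| <= C * r * `|u - v|].
Proof.
have c0 := stiffness_gt0 hD hd.
have := strict_diffZ (stiffness D delta0)^-1 (strict_rhs2 hD hd (tau_c D)).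
move=> [C [d [C0 d0 _ _ h]]]; exists C, d; split => // u v r hu hv rd.
apply: le_trans (h u v r hu hv rd); rewrite le_eqVlt; apply/orP; left; apply/eqP.
by congr `|_|; rewrite /remainder /lin_coef subrr mulr0; ring.
Qed.

Lemma remainder0 : remainder 0 = 0.
Proof. by rewrite /remainder addr0 !mxE rhs2_pstar; ring. Qed.

Lemma plane_vec_dist y z y' z' :
  `|plane_vec y z - plane_vec y' z'| <= (1 + w0 / 2) * (`|y - y'| + `|z - z'|).
Proof.
have w := omega0_gt0 hD hd.
have b0 : 0 <= w0 / 2 by rewrite divr_ge0 // ltW.
have yz : 0 <= `|y - y'| by []; have zz : 0 <= `|z - z'| by [].
have e : w0 / 2 * `|z - z'| <= (1 + w0 / 2) * (`|y - y'| + `|z - z'|).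
  by have := mulr_ge0 b0 yz; nra.
apply: rV_norm_le => [|i]; first by rewrite mulr_ge0 ?addr_ge0.
rewrite /plane_vec !mxE; case: i => -[|[|[|//]]] hi /=.
- by have := mulr_ge0 b0 yz; have := mulr_ge0 b0 zz; nra.
- by rewrite -mulrBr normrM (ger0_norm b0).
- by rewrite -opprD normrN -mulrBr normrM (ger0_norm b0).
Qed.

Lemma m0_omega0 : m0 D * w0 ^+ 2 = 2 * stiffness D delta0.
Proof. by rewrite (omega0_sq hD hd); field; exact: lt0r_neq0 (m0_gt0 hD). Qed.

(** On the plane [rhs1] is [- rhs2], so [k2] settles both velocity equations. Dividing by
    [stiffness = m0 * w0 ^ 2 / 2] normalises the restoring force to [- y], and
    [lin_coef tau + kappa = m0 * w0 * l] is the damping. The clock [w0 / (1 + q) * t] cancels the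
    factor [1 + q]. *)
Lemma planar_solution (e q l tau : R) (Y Z : R -> R) (N : R -> R -> R) :
  0 < e -> `|q| <= 1 / 2 ->
  (forall y z, N y z = remainder (e *: plane_vec y z) / e) ->
  lin_coef D tau = m0 D * w0 * l - kappa D delta0 ->
  (forall s : R, is_derive s 1 Y ((1 + q) * Z s) /\
    is_derive s 1 Z ((1 + q) * (- Y s + l * Z s + N (Y s) (Z s)))) ->
  solution (pulse_field D delta0 tau)
    (fun t => p + e *: plane_vec (Y (w0 / (1 + q) * t)) (Z (w0 / (1 + q) * t))).
Proof.
move=> e0 q2 hN haa hYZ t.
have q1 : 1 + q != 0 by move: q2; rewrite ler_norml => /andP[? _]; apply: lt0r_neq0; lra.
have [dY dZ] := hYZ (w0 / (1 + q) * t).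
have ds := derM (derC (w0 / (1 + q)) t) (is_derive_id t 1).
have hY := der_comp dY ds; have hZ := der_comp dZ ds.
set s := w0 / (1 + q) * t in dY dZ hY hZ *.
set y := Y s in dY dZ hY hZ *; set z := Z s in dY dZ hY hZ *.
have mw := m0_omega0; have m00 := lt0r_neq0 (m0_gt0 hD).
have c0 := lt0r_neq0 (stiffness_gt0 hD hd); have e1 := lt0r_neq0 e0.
have k2 : rhs2 D delta0 tau (hstar D delta0 + e * y) (e * (w0 / 2 * z))
    (- (e * (w0 / 2 * z))) =
    m0 D * (e * (w0 / 2 * (w0 * (- y + l * z + N y z)))).
  have : remainder (e *: plane_vec y z) = e * N y z by rewrite hN; field.
  rewrite /remainder !mxE /= !add0r mulrN => E.
  rewrite rhs2_lin_coef haa.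
  have {}E : rhs2 D delta0 (tau_c D) (hstar D delta0 + e * y) (e * (w0 / 2 * z))
      (- (e * (w0 / 2 * z))) = stiffness D delta0 * (e * N y z)
      + kappa D delta0 * (e * (w0 / 2 * z)) - stiffness D delta0 * (e * y).
    by rewrite -E; field.
  rewrite E.
  have -> : stiffness D delta0 = m0 D * w0 ^+ 2 / 2 by rewrite mw; field.
  by field.
apply: is_derive_rV => i.
rewrite /pulse_field !mxE /= !add0r mulrN.
rewrite rhs1_rhs2 opprK k2.
have hc (f : R -> R) (df a b : R) : is_derive t 1 f df ->
    is_derive t 1 (fun t => a + b * f t) (b * df).
  move=> hf; have h := derD (derC a t) (derM (derC b t) hf).
  by apply: is_derive_eq h _; ring.
case: i => -[|[|[|//]]] hi /=.
- apply: (der_ext (hc _ _ (hstar D delta0) e hY)) => [x|]; first by rewrite !mxE.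
  by field.
- apply: (der_ext (hc _ _ 0 (e * (w0 / 2)) hZ)) => [x|].
    by rewrite !mxE /=; ring.
  by field; rewrite m00.
- apply: (der_ext (hc _ _ 0 (- (e * (w0 / 2))) hZ)) => [x|].
    by rewrite !mxE /=; ring.
  by field; rewrite m00.
Qed.

Theorem pulse_hopf : hopf_bifurcation (pulse_field D delta0) p (tau_H D delta0).
Proof.
have w00 := omega0_gt0 hD hd; have m00 := m0_gt0 hD; have c0 := stiffness_gt0 hD hd.
split; first by near=> tau; apply/stationaryP; exact: pulse_field_pstar.
exists w0; split => //; split; first exact: crossing_H.
have [C [d [C0 d0 hQ]]] := remainder_bound.
have B0 : 0 <= 1 + w0 / 2 by rewrite addr_ge0 // divr_ge0 // ltW.
have W0 : plane_vec 0 0 = 0.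
  by apply/rowP => i; rewrite !mxE mulr0 oppr0; case: i => -[|[|[|]]].
have [C' [e1 [C'0 e10 hN hNe]]] :=
  blow_up C0 d0 B0 remainder0 W0 hQ plane_vec_dist.
have [e0 [K [q [l [Y [Z [he0 [q0 l0] hsol hql hYZ]]]]]]] := planar_hopf C'0 e10 hN hNe.
have /andP[e00 e0e1] := he0.
have s2 : 0 < Num.sqrt 2 :> R by rewrite sqrtr_gt0.
(* Solves [lin_coef (mu e) = m0 * w0 * l e - kappa], starting from [lin_coef tau_H = - kappa]. *)
pose mu (e : R) := tau_H D delta0 - m0 D * w0 / Num.sqrt 2 * l e.
pose T (e : R) := 2 * pi / w0 * (1 + q e).
pose s (e t : R) := w0 / (1 + q e) * t.
pose x (e t : R) := p + e *: plane_vec (Y e (s e t)) (Z e (s e t)).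
have q1 (e : R) : 0 <= e <= e0 -> 1 / 2 <= 1 + q e.
  by move=> /hsol[+ _ _ _]; rewrite ler_norml => /andP[h _]; move: h; clear -hD hd; lra.
have K0 : 0 <= K.
  have h : 0 <= e0 <= e0 by rewrite lexx ltW.
  have h' : 0 <= (0 : R) <= e0 by rewrite lexx ltW.
  have [h1 _] := hql e0 0 h h'; move: h1; rewrite subr0 (gtr0_norm e00) => h1.
  by rewrite -(pmulr_lge0 _ e00) (le_trans _ h1).
exists e0, mu, T, x; split.
- done.
- split; apply: within_continuous_lipschitz_at => e; rewrite /= in_itv /= => /andP[h1 h2].
  + exists (m0 D * w0 / Num.sqrt 2 * K) => [|e'].
      by rewrite mulr_ge0 // divr_ge0 ?mulr_ge0 // ltW.
    rewrite /= in_itv /= => /andP[h3 h4].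
    have [_ hl] := hql e e' ltac:(rewrite h1 ltW //) ltac:(rewrite h3 ltW //).
    rewrite /mu (_ : _ - _ - _ = - (m0 D * w0 / Num.sqrt 2 * (l e - l e'))); last by ring.
    have pos : 0 <= m0 D * w0 / Num.sqrt 2 by rewrite divr_ge0 ?mulr_ge0 // ltW.
    by rewrite normrN normrM (ger0_norm pos) -[leRHS]mulrA ler_wpM2l.
  + have pos : 0 <= 2 * pi / w0 by rewrite divr_ge0 ?mulr_ge0 ?pi_ge0 // ltW.
    exists (2 * pi / w0 * K) => [|e']; first by rewrite mulr_ge0.
    rewrite /= in_itv /= => /andP[h3 h4].
    have [hq _] := hql e e' ltac:(rewrite h1 ltW //) ltac:(rewrite h3 ltW //).
    rewrite /T (_ : _ - _ = 2 * pi / w0 * (q e - q e')); last by ring.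
    by rewrite normrM (ger0_norm pos) -[leRHS]mulrA ler_wpM2l.
- apply: within_continuous_lipschitz_at => -[e t] /= /andP[h1 h2].
  have he : 0 <= e <= e0 by rewrite h1 ltW.
  set w := plane_vec (Y e (s e t)) (Z e (s e t)).
  pose B := 1 + w0 / 2.
  (* Lipschitz constant of the phase at [(e, t)]: one factor [(1 + q)^-1] is at most 2, the product
     of two of them at most 4. *)
  pose L := w0 * (2 + 4 * `|t| * K).
  have L0 : 0 <= L by apply: mulr_ge0; [exact: ltW|rewrite addr_ge0 // !mulr_ge0].
  exists (`|w| + e0 * (B * (2 * (K + 3 * L)))) => [|[e' t'] /= /andP[h3 h4]].
    by rewrite addr_ge0 // mulr_ge0 ?(ltW e00) // mulr_ge0 // mulr_ge0 // addr_ge0 // mulr_ge0.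
  have he' : 0 <= e' <= e0 by rewrite h3 ltW.
  set n := `|(e, t) - (e', t')|.
  have en : `|e - e'| <= n by rewrite /n prod_normE /= le_max lexx.
  have tn : `|t - t'| <= n by rewrite /n prod_normE /= le_max lexx orbT.
  have n0 : 0 <= n by exact: le_trans en.
  have p1 := q1 e he; have p1' := q1 e' he'.
  have i1 : (1 + q e)^-1 <= 2.
    by rewrite -[leRHS]invrK lef_pV2 ?posrE //; move: p1; clear -hD hd; lra.
  have i1' : (1 + q e')^-1 <= 2.
    by rewrite -[leRHS]invrK lef_pV2 ?posrE //; move: p1'; clear -hD hd; lra.
  have j0 : 0 <= (1 + q e)^-1 by rewrite invr_ge0; move: p1; clear -hD hd; lra.
  have j0' : 0 <= (1 + q e')^-1 by rewrite invr_ge0; move: p1'; clear -hD hd; lra.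
  have ds : `|s e t - s e' t'| <= L * n.
    have -> : s e t - s e' t' = w0 * ((t - t') * (1 + q e')^-1 +
        t * ((q e' - q e) * ((1 + q e)^-1 * (1 + q e')^-1))).
      rewrite /s; field.
      by apply/andP; split; apply: lt0r_neq0; [move: p1'|move: p1]; clear -hD hd; lra.
    rewrite normrM (gtr0_norm w00) /L -mulrA ler_wpM2l ?(ltW w00) //.
    have [hq _] := hql e' e he' he; rewrite distrC (distrC e') in hq.
    have hq' : `|q e' - q e| <= K * n.
      by rewrite distrC; apply: (le_trans hq); rewrite ler_wpM2l.
    have ii : `|(1 + q e)^-1 * (1 + q e')^-1| <= 4.
      rewrite normrM !ger0_norm //; apply: le_trans (ler_pM j0 j0' i1 i1') _.
      by clear -hD hd; lra.
    have i2 : `|(1 + q e')^-1| <= 2 by rewrite ger0_norm.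
    apply: (le_trans (ler_normD _ _)).
    have a1 := ler_normM tn i2.
    have a2 := ler_normM (lexx `|t|) (ler_normM hq' ii).
    by move: a1 a2; clear -hD hd; lra.
  have dw : `|w - plane_vec (Y e' (s e' t')) (Z e' (s e' t'))|
      <= B * (2 * (K + 3 * L)) * n.
    apply: (le_trans (plane_vec_dist _ _ _ _)).
    rewrite -!mulrA ler_wpM2l //.
    have [dY dZ] := hYZ e e' (s e t) (s e' t') he he'.
    have Kn : K * `|e - e'| <= K * n by rewrite ler_wpM2l.
    by move: dY dZ ds Kn; clear -hD hd; lra.
  rewrite /x opprD addrACA subrr add0r.
  have -> : e *: w - e' *: plane_vec (Y e' (s e' t')) (Z e' (s e' t')) =
    (e - e') *: w + e' *: (w - plane_vec (Y e' (s e' t')) (Z e' (s e' t'))).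
    by rewrite scalerBl scalerBr addrA subrK.
  apply: (le_trans (ler_normD _ _)); rewrite mulrDl lerD // normrZ.
    by rewrite mulrC ler_wpM2l.
  rewrite (ger0_norm h3) -mulrA ler_pM // ltW //.
- split; first by rewrite /mu l0 mulr0 subr0.
  + by rewrite /T q0 addr0 mulr1.
  + by move=> t; rewrite /x scale0r addr0.
- move=> e /andP[h1 h2].
  have he : 0 <= e <= e0 by rewrite !ltW.
  have [qb ode per least] := hsol e he.
  have qp : 0 < 1 + q e by have := q1 e he; lra.
  have T0 : 0 < T e by rewrite mulr_gt0 // divr_gt0 // mulr_gt0 // pi_gt0.
  have sT t : s e (t + T e) = s e t + 2 * pi.
    by rewrite /s /T; field; rewrite !gt_eqF.
  split => //.
  + apply: (planar_solution h1 qb (fun y z => erefl)) => //.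
    have := lin_coef_tau_H D delta0; rewrite /lin_coef /mu => E.
    have -> : Num.sqrt 2 * (tau_c D - (tau_H D delta0 - m0 D * w0 / Num.sqrt 2 * l e)) =
      Num.sqrt 2 * (tau_c D - tau_H D delta0) + m0 D * w0 * l e.
      by field; exact: lt0r_neq0.
    by rewrite E; ring.
  + by move=> t; rewrite /x sT; have [-> ->] := per (s e t).
  + move=> t /andP[t0 tT]; apply/eqP => E.
    apply: (least (s e t)).
      rewrite mulr_gt0 ?divr_gt0 //=; have := sT 0; rewrite add0r {2}/s mulr0 add0r => <-.
      by rewrite /s ltr_pM2l // divr_gt0.
    move/addrI: E => /(scalerI (lt0r_neq0 h1)) E.
    have s00 : s e 0 = 0 by rewrite /s mulr0.
    rewrite s00 in E; split.
      by have := congr1 (fun u : 'rV[R]_3 => u 0 0) E; rewrite !mxE.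
    have := congr1 (fun u : 'rV[R]_3 => u 0 1) E; rewrite !mxE /=.
    by apply: mulfI; rewrite mulf_neq0 ?invr_eq0 // gt_eqF.
Unshelve. all: by end_near. Qed.

End hopf.

(** * Taylor expansions in [k], uniform in a parameter [b] *)

Section taylor.
Context {R : realType}.
Implicit Types (f g h : R -> R -> R) (c : R -> R).

Definition bigO (n : nat) f := exists C d : R, [/\ 0 <= C, 0 < d <= 1 &
  forall b k, `|b| <= 1 -> `|k| <= d -> `|f b k| <= C * `|k| ^+ n].

Lemma bigO_ext n f g : bigO n f -> (forall b k, f b k = g b k) -> bigO n g.
Proof.
move=> [C [d [C0 d0 h]]] E; exists C, d; split=> // b k hb hk.
by rewrite -E; exact: h.
Qed.

Lemma bigOD n f g : bigO n f -> bigO n g -> bigO n (fun b k => f b k + g b k).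
Proof.
move=> [C [d [C0 /andP[d0 d1] hf]]] [C' [d' [C'0 /andP[d'0 d'1] hg]]].
exists (C + C'), (Num.min d d'); split.
- by rewrite addr_ge0.
- by rewrite lt_min d0 d'0 ge_min d1.
move=> b k hb; rewrite le_min => /andP[hk hk'].
apply: (le_trans (ler_normD _ _)); rewrite mulrDl lerD //; [exact: hf|exact: hg].
Qed.

Lemma bigOM n m f g : bigO n f -> bigO m g ->
  bigO (n + m) (fun b k => f b k * g b k).
Proof.
move=> [C [d [C0 /andP[d0 d1] hf]]] [C' [d' [C'0 /andP[d'0 d'1] hg]]].
exists (C * C'), (Num.min d d'); split.
- by rewrite mulr_ge0.
- by rewrite lt_min d0 d'0 ge_min d1.
move=> b k hb; rewrite le_min => /andP[hk hk'].
rewrite (_ : C * C' * _ = (C * `|k| ^+ n) * (C' * `|k| ^+ m)); last first.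
  by rewrite exprD; ring.
by apply: ler_normM; [exact: hf|exact: hg].
Qed.

Lemma bigOW n m f : (m <= n)%N -> bigO n f -> bigO m f.
Proof.
move=> mn [C [d [C0 /andP[d0 d1] hf]]]; exists C, d; split => //.
  by rewrite d0.
move=> b k hb hk; apply: (le_trans (hf b k hb hk)).
by rewrite ler_wpM2l // ler_wiXn2l // (le_trans hk).
Qed.

Lemma bigO_cst (a : R) : bigO 0 (fun _ _ => a).
Proof. by exists `|a|, 1; split; rewrite ?ltr01 ?lexx // => b k _ _; rewrite expr0 mulr1. Qed.

Lemma bigO_b : bigO 0 (fun b _ => b).
Proof. by exists 1, 1; split; rewrite ?ltr01 ?lexx // => b k hb _; rewrite expr0 mulr1. Qed.

Lemma bigO_k : bigO 1 (fun _ k => k).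
Proof. by exists 1, 1; split; rewrite ?ltr01 ?lexx // => b k hb _; rewrite expr1 mul1r. Qed.

Definition poly6 (c0 c1 c2 c3 c4 c5 k : R) : R :=
  c0 + c1 * k + c2 * k ^+ 2 + c3 * k ^+ 3 + c4 * k ^+ 4 + c5 * k ^+ 5.

Definition bounded_coef c := bigO 0 (fun b _ => c b).

(** The coefficients are bounded functions of [b] given as explicit formulas, so that identities
    between expansions reduce to [ring]. Order 5 is imposed by the values of [delta0] at which the
    cubic coefficient vanishes. *)
Record taylor6 f c0 c1 c2 c3 c4 c5 : Prop := Taylor6 {
  taylor6_bounds : [/\ bounded_coef c0, bounded_coef c1 & bounded_coef c2] /\
    [/\ bounded_coef c3, bounded_coef c4 & bounded_coef c5];
  taylor6_rem : bigO 6 (fun b k =>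
    f b k - poly6 (c0 b) (c1 b) (c2 b) (c3 b) (c4 b) (c5 b) k) }.

Lemma bounded_coefD c c' : bounded_coef c -> bounded_coef c' ->
  bounded_coef (fun b => c b + c' b).
Proof. exact: bigOD. Qed.

Lemma bounded_coefM c c' : bounded_coef c -> bounded_coef c' ->
  bounded_coef (fun b => c b * c' b).
Proof. exact: bigOM. Qed.

Lemma bounded_coef_cst (a : R) : bounded_coef (fun=> a).
Proof. exact: bigO_cst. Qed.

Lemma bigO0_k : bigO 0 (fun _ k => k).
Proof. exact: bigOW bigO_k. Qed.

Lemma bigO0M f g : bigO 0 f -> bigO 0 g -> bigO 0 (fun b k => f b k * g b k).
Proof. exact: bigOM. Qed.

Lemma bigO0X f n : bigO 0 f -> bigO 0 (fun b k => f b k ^+ n).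
Proof.
move=> hf; elim: n => [|n IH]; first exact: bigO_cst.
by apply: bigO_ext (bigO0M hf IH) _ => b k; rewrite exprS.
Qed.

Lemma bigO_kX n : bigO n (fun _ k => k ^+ n).
Proof.
elim: n => [|n IH]; first exact: bigO_cst.
by apply: bigO_ext (bigOM bigO_k IH) _ => b k; rewrite exprS.
Qed.

Lemma bigO0_poly6 c0 c1 c2 c3 c4 c5 :
  [/\ bounded_coef c0, bounded_coef c1 & bounded_coef c2] /\
    [/\ bounded_coef c3, bounded_coef c4 & bounded_coef c5] ->
  bigO 0 (fun b k => poly6 (c0 b) (c1 b) (c2 b) (c3 b) (c4 b) (c5 b) k).
Proof.
move=> [[h0 h1 h2] [h3 h4 h5]].
have hk n := bigO0X n bigO0_k.
by do 5!(apply: bigOD; last by apply: bigO0M; [|exact: hk || exact: bigO0_k]).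
Qed.

Lemma taylor6_bigO0 f c0 c1 c2 c3 c4 c5 : taylor6 f c0 c1 c2 c3 c4 c5 -> bigO 0 f.
Proof.
case=> hc hr; have h := bigOD (bigOW (leq0n 6) hr) (bigO0_poly6 hc).
by apply: bigO_ext h _ => b k; rewrite subrK.
Qed.

Lemma taylor6_ext f g c0 c1 c2 c3 c4 c5 e0 e1 e2 e3 e4 e5 :
  taylor6 f c0 c1 c2 c3 c4 c5 -> (forall b k, f b k = g b k) ->
  (forall b, [/\ c0 b = e0 b, c1 b = e1 b & c2 b = e2 b] /\
             [/\ c3 b = e3 b, c4 b = e4 b & c5 b = e5 b]) ->
  taylor6 g e0 e1 e2 e3 e4 e5.
Proof.
move=> h fg ce.
have -> : g = f by apply/funext => b; apply/funext => k; rewrite fg.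
have -> : e0 = c0 by apply/funext => b; have [[]] := ce b.
have -> : e1 = c1 by apply/funext => b; have [[]] := ce b.
have -> : e2 = c2 by apply/funext => b; have [[]] := ce b.
have -> : e3 = c3 by apply/funext => b; have [_ []] := ce b.
have -> : e4 = c4 by apply/funext => b; have [_ []] := ce b.
by have -> : e5 = c5 by apply/funext => b; have [_ []] := ce b.
Qed.

Lemma taylor6D f g c0 c1 c2 c3 c4 c5 e0 e1 e2 e3 e4 e5 :
  taylor6 f c0 c1 c2 c3 c4 c5 -> taylor6 g e0 e1 e2 e3 e4 e5 ->
  taylor6 (fun b k => f b k + g b k) (fun b => c0 b + e0 b) (fun b => c1 b + e1 b)
   (fun b => c2 b + e2 b) (fun b => c3 b + e3 b) (fun b => c4 b + e4 b)
   (fun b => c5 b + e5 b).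
Proof.
move=> [[[h0 h1 h2] [h3 h4 h5]] hf] [[[g0 g1 g2] [g3 g4 g5]] hg]; split.
  by split; split; exact: bounded_coefD.
by apply: bigO_ext (bigOD hf hg) _ => b k; rewrite /poly6; ring.
Qed.

Lemma taylor6M f g c0 c1 c2 c3 c4 c5 e0 e1 e2 e3 e4 e5 :
  taylor6 f c0 c1 c2 c3 c4 c5 -> taylor6 g e0 e1 e2 e3 e4 e5 ->
  taylor6 (fun b k => f b k * g b k) (fun b => c0 b * e0 b)
   (fun b => c0 b * e1 b + c1 b * e0 b)
   (fun b => c0 b * e2 b + c1 b * e1 b + c2 b * e0 b)
   (fun b => c0 b * e3 b + c1 b * e2 b + c2 b * e1 b + c3 b * e0 b)
   (fun b => c0 b * e4 b + c1 b * e3 b + c2 b * e2 b + c3 b * e1 b + c4 b * e0 b)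
   (fun b => c0 b * e5 b + c1 b * e4 b + c2 b * e3 b + c3 b * e2 b + c4 b * e1 b
             + c5 b * e0 b).
Proof.
move=> tf tg; have f0 := taylor6_bigO0 tf.
move: tf tg => [hc hf] [he hg]; have g0 := bigO0_poly6 he.
move: (hc) (he) => [[h0 h1 h2] [h3 h4 h5]] [[k0 k1 k2] [k3 k4 k5]]; split.
  by split; split; do ?apply: bounded_coefD; exact: bounded_coefM.
have hr : bigO 6 (fun b k => k ^+ 6 * poly6
   (c1 b * e5 b + c2 b * e4 b + c3 b * e3 b + c4 b * e2 b + c5 b * e1 b)
   (c2 b * e5 b + c3 b * e4 b + c4 b * e3 b + c5 b * e2 b)
   (c3 b * e5 b + c4 b * e4 b + c5 b * e3 b)
   (c4 b * e5 b + c5 b * e4 b) (c5 b * e5 b) 0 k).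
  apply: (@bigOM 6 0); first exact: bigO_kX.
  apply: (@bigO0_poly6 (fun b => c1 b * e5 b + c2 b * e4 b + c3 b * e3 b + c4 b * e2 b + c5 b * e1 b)
   (fun b => c2 b * e5 b + c3 b * e4 b + c4 b * e3 b + c5 b * e2 b)
   (fun b => c3 b * e5 b + c4 b * e4 b + c5 b * e3 b)
   (fun b => c4 b * e5 b + c5 b * e4 b) (fun b => c5 b * e5 b) (fun=> 0)).
  by split; split; do ?apply: bounded_coefD;
     (exact: bounded_coefM || exact: bounded_coef_cst).
have h := bigOD (bigOD (@bigOM 0 6 _ _ f0 hg) (@bigOM 6 0 _ _ hf g0)) hr.
by apply: bigO_ext h _ => b k; rewrite /poly6; ring.
Qed.

Lemma taylor6_coef c : bounded_coef c ->
  taylor6 (fun b _ => c b) c (fun=> 0) (fun=> 0) (fun=> 0) (fun=> 0) (fun=> 0).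
Proof.
move=> hc; split; first by split; split => //; exact: bounded_coef_cst.
have h := @bigOM 6 0 _ _ (bigO_kX 6) (bigO_cst 0).
by apply: bigO_ext h _ => b k; rewrite /poly6; ring.
Qed.

Lemma taylor6_k :
  taylor6 (fun _ k => k) (fun=> 0) (fun=> 1) (fun=> 0) (fun=> 0) (fun=> 0) (fun=> 0).
Proof.
split; first by split; split => //; exact: bounded_coef_cst.
have h := @bigOM 6 0 _ _ (bigO_kX 6) (bigO_cst 0).
by apply: bigO_ext h _ => b k; rewrite /poly6; ring.
Qed.

Lemma taylor6Z (a : R) f c0 c1 c2 c3 c4 c5 : taylor6 f c0 c1 c2 c3 c4 c5 ->
  taylor6 (fun b k => a * f b k) (fun b => a * c0 b) (fun b => a * c1 b)
   (fun b => a * c2 b) (fun b => a * c3 b) (fun b => a * c4 b) (fun b => a * c5 b).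
Proof.
move=> h; apply: taylor6_ext (taylor6M (taylor6_coef (bounded_coef_cst a)) h) _ _ => //.
by move=> b; split; split; ring.
Qed.

Lemma taylor6_rem_ext f g c0 c1 c2 c3 c4 c5 : taylor6 f c0 c1 c2 c3 c4 c5 ->
  bigO 6 (fun b k => g b k - f b k) -> taylor6 g c0 c1 c2 c3 c4 c5.
Proof.
case=> hc hf hg; split=> //.
by apply: bigO_ext (bigOD hg hf) _ => b k; ring.
Qed.

Lemma taylor6_bigO1 f c1 c2 c3 c4 c5 : taylor6 f (fun=> 0) c1 c2 c3 c4 c5 -> bigO 1 f.
Proof.
case=> [[[_ b1 b2] [b3 b4 b5]] hr].
have hX n c : (0 < n)%N -> bounded_coef c -> bigO 1 (fun b k => k ^+ n * c b).
  by move=> n0 hc; apply: bigOW (bigOM (bigO_kX n) hc); rewrite addn0.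
have h := bigOD (bigOD (bigOD (bigOD (bigOD (bigOW (isT : (1 <= 6)%N) hr)
  (hX 1 _ isT b1)) (hX 2 _ isT b2)) (hX 3 _ isT b3)) (hX 4 _ isT b4)) (hX 5 _ isT b5).
by apply: bigO_ext h _ => b k; rewrite /poly6; ring.
Qed.

(** The even coefficients of [v] vanish, which leaves few terms in the composition; as [v] is
    [O(k)], the sixth-order remainder of [F] stays of sixth order in [k]. *)
Lemma taylor6_odd_comp (F : R -> R) (a0 a1 a2 a3 a4 a5 C d : R) v v1 v3 v5 :
  0 <= C -> 0 < d ->
  (forall x, `|x| <= d -> `|F x - poly6 a0 a1 a2 a3 a4 a5 x| <= C * `|x| ^+ 6) ->
  taylor6 v (fun=> 0) v1 (fun=> 0) v3 (fun=> 0) v5 ->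
  taylor6 (fun b k => F (v b k)) (fun=> a0) (fun b => a1 * v1 b)
    (fun b => a2 * v1 b ^+ 2) (fun b => a1 * v3 b + a3 * v1 b ^+ 3)
    (fun b => 2 * a2 * v1 b * v3 b + a4 * v1 b ^+ 4)
    (fun b => a1 * v5 b + 3 * a3 * v1 b ^+ 2 * v3 b + a5 * v1 b ^+ 5).
Proof.
move=> C0 d0 hF hv.
have hv2 := taylor6M hv hv; have hv3 := taylor6M hv hv2.
have hv4 := taylor6M hv hv3; have hv5 := taylor6M hv hv4.
have cst a := taylor6_coef (bounded_coef_cst a).
have h := taylor6D (taylor6D (taylor6D (taylor6D (taylor6D (cst a0) (taylor6Z a1 hv))
  (taylor6Z a2 hv2)) (taylor6Z a3 hv3)) (taylor6Z a4 hv4)) (taylor6Z a5 hv5).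
have {}h : taylor6 (fun b k => poly6 a0 a1 a2 a3 a4 a5 (v b k)) (fun=> a0)
    (fun b => a1 * v1 b)
    (fun b => a2 * v1 b ^+ 2) (fun b => a1 * v3 b + a3 * v1 b ^+ 3)
    (fun b => 2 * a2 * v1 b * v3 b + a4 * v1 b ^+ 4)
    (fun b => a1 * v5 b + 3 * a3 * v1 b ^+ 2 * v3 b + a5 * v1 b ^+ 5).
  apply: taylor6_ext h _ _ => [b k|b]; first by rewrite /poly6; ring.
  by split; split; ring.
apply: taylor6_rem_ext h _.
have v1O := taylor6_bigO1 hv.
have [M [e [M0 /andP[e0 e1] hM]]] := v1O.
have M1 : 0 < M + 1 by rewrite ltr_wpDl.
exists (C * M ^+ 6), (Num.min e (d / (M + 1))); split.
- by rewrite mulr_ge0 ?exprn_ge0.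
- by rewrite lt_min e0 divr_gt0 //= ge_min e1.
move=> b k hb; rewrite le_min => /andP[hk]; rewrite ler_pdivlMr // => hk'.
have vk := hM b k hb hk; rewrite expr1 in vk.
have vd : `|v b k| <= d.
  by apply: (le_trans vk); move: hk' (normr_ge0 k); clear; lra.
apply: (le_trans (hF _ vd)); rewrite -mulrA -exprMn ler_wpM2l //.
by rewrite lerXn2r ?nnegrE // mulr_ge0.
Qed.

(** By the finite geometric sum, the remainder has derivative [- t ^+ 5 / (1 + t)]. *)
Lemma ln_taylor6 (x : R) : `|x| <= 1 / 2 ->
  `|ln (1 + x) - poly6 0 1 (- (1 / 2)) (1 / 3) (- (1 / 4)) (1 / 5) x| <= 2 * `|x| ^+ 6.
Proof.
move=> hx; have /andP[x0 x1] : - (1 / 2) <= x <= 1 / 2 by rewrite -ler_norml.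
pose G t := ln (1 + t) - poly6 0 1 (- (1 / 2)) (1 / 3) (- (1 / 4)) (1 / 5) t.
have bd t : Num.min 0 x <= t <= Num.max 0 x -> `|t| <= `|x| /\ 1 / 2 <= 1 + t.
  move=> /andP[]; rewrite ge_min le_max => h1 h2.
  have [h0|h0] := leP 0 x; last first.
    rewrite (ltr0_norm h0) ler_norml; move: h1 h2.
    by move=> /orP[a1|a1] /orP[a2|a2]; split; lra.
  rewrite (ger0_norm h0) ler_norml.
  by move: h1 h2 => /orP[a1|a1] /orP[a2|a2]; split; lra.
have := @MVT_norm R G (fun t => - t ^+ 5 / (1 + t)) 0 x (2 * `|x| ^+ 5).
have G0 : G 0 = 0 by rewrite /G addr0 ln1 /poly6; ring.
rewrite G0 !subr0 -mulrA -exprSr; apply => t /bd[tx t1].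
- have t0 : 0 < 1 + t by lra.
  have hl : is_derive (1 + t) 1 (@ln R) (1 + t)^-1 by exact: is_derive1_ln.
  have hln := der_comp hl (derD (derC 1 t) (is_derive_id t 1)).
  have h := derB hln (derD (derD (derD (derD (derD (derC 0 t)
    (derM (derC 1 t) (is_derive_id t 1)))
    (derM (derC (- (1 / 2)) t) (derX 1 t))) (derM (derC (1 / 3) t) (derX 2 t)))
    (derM (derC (- (1 / 4)) t) (derX 3 t))) (derM (derC (1 / 5) t) (derX 4 t))).
  by apply: is_derive_eq h _; field; rewrite gt_eqF.
- have t0 : 0 < 1 + t by lra.
  rewrite normrM normrN normrX normfV (gtr0_norm t0) ler_pdivrMr //.
  have p0 : 0 <= `|x| ^+ 5 by rewrite exprn_ge0.
  have p1 : `|t| ^+ 5 <= `|x| ^+ 5 by rewrite lerXn2r ?nnegrE.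
  by move: p0 p1 t1; clear; nra.
Qed.

Lemma inv_taylor6 (x : R) : `|x| <= 1 / 2 ->
  `|(1 + x)^-1 - poly6 1 (- 1) 1 (- 1) 1 (- 1) x| <= 2 * `|x| ^+ 6.
Proof.
move=> hx; have /andP[x0 x1] : - (1 / 2) <= x <= 1 / 2 by rewrite -ler_norml.
have p : 0 < 1 + x by lra.
have -> : (1 + x)^-1 - poly6 1 (- 1) 1 (- 1) 1 (- 1) x = x ^+ 6 / (1 + x).
  by rewrite /poly6; field; rewrite gt_eqF.
rewrite normrM normrX normfV (gtr0_norm p) ler_pdivrMr //.
by have := exprn_ge0 6 (normr_ge0 x); move: x0; clear; nra.
Qed.

End taylor.

(** * Sign of an odd germ on each side of the bifurcation *)

Section odd_germ.
Context {R : realType}.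
Implicit Types H : R -> R -> R.

(** The point of this form is that [b] enters at first order in [k] only through [- w * b * k]; its
    other effects are [b * O(k ^ 3)] and negligible against that term, uniformly in [b]. *)
Definition odd_germ H (w A3 A5 : R) := exists G3 G5 : R -> R,
  [/\ bounded_coef G3, bounded_coef G5 &
    bigO 6 (fun b k => H b k - (- w * b * k + (A3 + b * G3 b) * k ^+ 3
                                + (A5 + b * G5 b) * k ^+ 5))].

Lemma odd_germ_bound H w A3 A5 : odd_germ H w A3 A5 -> exists C d : R,
  [/\ 0 <= C, 0 < d <= 1 & forall b k, `|b| <= 1 -> 0 < k <= d ->
   `|H b k - (- w * b * k + A3 * k ^+ 3 + A5 * k ^+ 5)|
    <= C * k * (`|b| * k ^+ 2 + k ^+ 5)].
Proof.
move=> [G3 [G5 [[C3 [d3 [C30 /andP[d30 d31] h3]]] [C5 [d5 [C50 /andP[d50 d51] h5]]]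
  [C [d [C0 /andP[d0 d1] h]]]]]].
exists (C3 + C5 + C), (Num.min d (Num.min d3 d5)); split.
- by rewrite !addr_ge0.
- by rewrite !lt_min d0 d30 d50 ge_min d1.
move=> b k hb /andP[k0]; rewrite !le_min => /andP[kd /andP[kd3 kd5]].
have nk : `|k| = k by rewrite gtr0_norm.
have k1 : k <= 1 by exact: le_trans d1.
have := h3 b k hb; rewrite nk expr0 mulr1 => /(_ kd3) g3.
have := h5 b k hb; rewrite nk expr0 mulr1 => /(_ kd5) g5.
have := h b k hb; rewrite nk => /(_ kd) hh.
have -> : H b k - (- w * b * k + A3 * k ^+ 3 + A5 * k ^+ 5) =
  (H b k - (- w * b * k + (A3 + b * G3 b) * k ^+ 3 + (A5 + b * G5 b) * k ^+ 5))
  + (b * G3 b * k ^+ 3 + b * G5 b * k ^+ 5) by ring.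
have k0' := ltW k0.
have b3 : `|b * G3 b * k ^+ 3| <= C3 * (`|b| * k ^+ 3).
  rewrite (_ : b * G3 b * k ^+ 3 = G3 b * (b * k ^+ 3)); last by ring.
  by apply: ler_normM => //; rewrite normrM (ger0_norm (exprn_ge0 _ k0')).
have b5 : `|b * G5 b * k ^+ 5| <= C5 * (`|b| * k ^+ 3).
  rewrite (_ : b * G5 b * k ^+ 5 = G5 b * (b * k ^+ 5)); last by ring.
  apply: ler_normM => //; rewrite normrM (ger0_norm (exprn_ge0 _ k0')).
  by rewrite ler_wpM2l // ler_wiXn2l.
have bk : 0 <= `|b| * k ^+ 3 by rewrite mulr_ge0 ?exprn_ge0.
have k6 : 0 <= k ^+ 6 by rewrite exprn_ge0.
rewrite (_ : (C3 + C5 + C) * k * _ = (C3 + C5 + C) * (`|b| * k ^+ 3 + k ^+ 6)); last by ring.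
apply: (le_trans (ler_normD _ _)).
have := ler_normD (b * G3 b * k ^+ 3) (b * G5 b * k ^+ 5).
have := mulr_ge0 C0 bk; have := mulr_ge0 C30 k6; have := mulr_ge0 C50 k6.
move: hh b3 b5; clear; lra.
Qed.

Lemma exprS_le (k : R) n : 0 <= k -> k <= 1 -> k ^+ n.+1 <= k.
Proof. by move=> k0 k1; rewrite exprS ler_piMr // exprn_ile1. Qed.

(** On this side nothing cancels: the linear term absorbs the error in [b], and the first nonzero
    one of [A3], [A5] absorbs the error in [k ^ 6]. Hence [k1] does not depend on [b]. *)
Lemma odd_germ_pos H w A3 A5 (sg : R) : odd_germ H w A3 A5 -> w != 0 ->
  sg = 1 \/ sg = -1 -> 0 < sg * A3 \/ (A3 = 0 /\ 0 < sg * A5) ->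
  exists2 k1 : R, 0 < k1 <= 1 & forall b k, `|b| <= 1 -> 0 < k <= k1 ->
    sg * w * b <= 0 -> 0 < sg * H b k.
Proof.
move=> /odd_germ_bound[C [d [C0 /andP[d0 d1] hC]]] w0 hsg hA.
have nsg : `|sg| = 1 by case: hsg => ->; rewrite ?normrN normr1.
have w0' : 0 < `|w| by rewrite normr_gt0.
have C1 : 0 < C + 1 by rewrite ltr_wpDl.
(* [m] is the leading coefficient and [M] collects the coefficients it has to dominate. *)
have [m [M [m0 M0 hm]]] : exists m M : R, [/\ 0 < m, 0 < M & forall k : R,
    0 < k <= 1 -> k * M <= m -> 0 < sg * (A3 * k ^+ 3 + A5 * k ^+ 5) - C * k ^+ 6].
  case: hA => [A30|[-> A50]].
  - exists (sg * A3), (`|A5| + C + 1); split => //.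
      by rewrite ltr_wpDl // addr_ge0.
    move=> k /andP[k0 k1] hk.
    have e : sg * (A3 * k ^+ 3 + A5 * k ^+ 5) - C * k ^+ 6 =
      k ^+ 3 * (sg * A3 + sg * A5 * k ^+ 2 - C * k ^+ 3) by ring.
    rewrite e mulr_gt0 ?exprn_gt0 //.
    have a5 : - `|A5| <= sg * A5 by rewrite lerNl (le_trans (ler_norm _)) // normrN normrM nsg mul1r.
    have k2 : k ^+ 2 <= k by apply: exprS_le => //; exact: ltW.
    have k3 : k ^+ 3 <= k by apply: exprS_le => //; exact: ltW.
    have k20 : 0 <= k ^+ 2 by rewrite exprn_ge0 // ltW.
    have a : - (`|A5| * k) <= sg * A5 * k ^+ 2.
      apply: (@le_trans _ _ (- `|A5| * k ^+ 2)); last by rewrite ler_wpM2r.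
      by rewrite mulNr lerN2 ler_wpM2l.
    have c : C * k ^+ 3 <= C * k by rewrite ler_wpM2l.
    by move: hk a c k0; clear; lra.
  - exists (sg * A5), (C + 1); split => // k /andP[k0 k1] hk.
    have -> : sg * (0 * k ^+ 3 + A5 * k ^+ 5) - C * k ^+ 6 =
      k ^+ 5 * (sg * A5 - C * k) by ring.
    rewrite mulr_gt0 ?exprn_gt0 //; move: hk k0; clear; lra.
pose k1 := Num.min d (Num.min (`|w| / (C + 1)) (m / M)).
have k10 : 0 < k1 by rewrite !lt_min d0 !divr_gt0.
exists k1; first by rewrite k10 ge_min d1.
move=> b k hb /andP[k0]; rewrite !le_min !ler_pdivlMr // => /andP[kd /andP[kw km]] hs.
have k1' : k <= 1 by exact: le_trans d1.
have := hC b k hb; rewrite k0 kd => /(_ isT) h.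
have {}hm := hm k ltac:(rewrite k0 k1' //) km.
have h' : - (C * k * (`|b| * k ^+ 2 + k ^+ 5)) <=
   sg * (H b k - (- w * b * k + A3 * k ^+ 3 + A5 * k ^+ 5)).
  by rewrite lerNl (le_trans (ler_norm _)) // normrN normrM nsg mul1r.
have swb : - (sg * w * b) = `|w| * `|b|.
  by rewrite -(ler0_norm hs) !normrM nsg mul1r.
have k2 : C * k ^+ 2 <= `|w|.
  have : C * k ^+ 2 <= C * k by rewrite ler_wpM2l // exprS_le // ltW.
  by move: kw k0; clear; lra.
have bk : 0 <= `|b| * k by rewrite mulr_ge0 // ltW.
have p : 0 <= `|b| * k * (`|w| - C * k ^+ 2) by rewrite mulr_ge0 // subr_ge0.
have e : - (sg * w * b) * k = `|w| * `|b| * k by rewrite swb.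
move: h' hm p e; clear; set h := H b k; lra.
Qed.

(** On the other side the linear term has the opposite sign and wins only when [k] is small compared
    with [b]; so [k2] depends on [b]. *)
Lemma odd_germ_near0 H w A3 A5 (sg b : R) : odd_germ H w A3 A5 ->
  sg = 1 \/ sg = -1 -> `|b| <= 1 -> 0 < sg * w * b ->
  exists2 k2 : R, 0 < k2 & forall k, 0 < k <= k2 -> sg * H b k < 0.
Proof.
move=> /odd_germ_bound[C [d [C0 /andP[d0 d1] hC]]] hsg hb hs.
have nsg : `|sg| = 1 by case: hsg => ->; rewrite ?normrN normr1.
pose M : R := `|A3| + `|A5| + 2 * C + 1.
have M0 : 0 < M by rewrite /M ltr_wpDl // !addr_ge0 // mulr_ge0.
have M1 : 0 < M + 1 by rewrite addr_gt0.
exists (Num.min d (sg * w * b / (M + 1))).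
  by rewrite lt_min d0 divr_gt0.
move=> k /andP[k0]; rewrite le_min => /andP[kd].
rewrite ler_pdivlMr // => kM.
have := hC b k hb; rewrite k0 kd => /(_ isT) h.
have k1 : k <= 1 by exact: le_trans d1.
have k0' := ltW k0.
have h' : sg * (H b k - (- w * b * k + A3 * k ^+ 3 + A5 * k ^+ 5)) <=
    C * k * (`|b| * k ^+ 2 + k ^+ 5).
  by rewrite (le_trans (ler_norm _)) // normrM nsg mul1r.
have e : C * k * (`|b| * k ^+ 2 + k ^+ 5) <= C * k * (k + k).
  rewrite ler_wpM2l ?mulr_ge0 // lerD //.
    by rewrite expr2 mulrA ler_piMl // mulr_ile1.
  exact: exprS_le.
have a3 : sg * A3 * k ^+ 3 <= `|A3| * k * k.
  apply: (@le_trans _ _ (`|A3| * k ^+ 3)).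
    by rewrite ler_wpM2r ?exprn_ge0 // (le_trans (ler_norm _)) // normrM nsg mul1r.
  by rewrite -mulrA ler_wpM2l // -expr2 ler_wiXn2l.
have a5 : sg * A5 * k ^+ 5 <= `|A5| * k * k.
  apply: (@le_trans _ _ (`|A5| * k ^+ 5)).
    by rewrite ler_wpM2r ?exprn_ge0 // (le_trans (ler_norm _)) // normrM nsg mul1r.
  by rewrite -mulrA ler_wpM2l // -expr2 ler_wiXn2l.
have kMk : k * (M + 1) * k <= sg * w * b * k by rewrite ler_wpM2r.
have kk : 0 < k * k by rewrite mulr_gt0.
move: h' e a3 a5 kMk kk; rewrite /M; clear; set h := H b k; lra.
Qed.

Lemma taylor6_oddpart (f : R -> R -> R) c0 c1 c2 c3 c4 c5 :
  taylor6 f c0 c1 c2 c3 c4 c5 ->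
  bigO 6 (fun b k => f b k - f b (- k)
    - (2 * c1 b * k + 2 * c3 b * k ^+ 3 + 2 * c5 b * k ^+ 5)).
Proof.
case=> _ [C [d [C0 hd h]]]; exists (2 * C), d; split => //.
  by rewrite mulr_ge0.
move=> b k hb hk; have h1 := h b k hb hk.
have := h b (- k) hb; rewrite normrN => /(_ hk) h2.
set p := poly6 _ _ _ _ _ _ k in h1; set q := poly6 _ _ _ _ _ _ _ in h2.
have -> : f b k - f b (- k)
    - (2 * c1 b * k + 2 * c3 b * k ^+ 3 + 2 * c5 b * k ^+ 5) =
  (f b k - p) - (f b (- k) - q) by rewrite /p /q /poly6; ring.
by apply: (le_trans (ler_normB _ _)); move: h1 h2; clear; lra.
Qed.

End odd_germ.

(** * The scalar equation for the branches and its expansion *)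

Section branch_equation.
Context {R : realType} (Lam gam : R).
Implicit Types b k : R.

(* If [k = tanh (theta / 2)], then [sv k = sinh theta], and for
   [r = 2 sqrt D * sv k] one has [(r + phi r) / (2 * D) = (1 + k) / (1 - k) / sqrt D].
   Taking logarithms in the two stationarity conditions at [r2 = r1 = r] makes them
   linear in [h]; [eqn] is the result of eliminating [h], and [deqn b k] is
   [k ^ 3] times the derivative of [eqn b k / k ^ 2]. *)
Definition sv k : R := 2 * k / (1 - k ^+ 2).
Definition dsv k : R := 2 * (1 + k ^+ 2) / (1 - k ^+ 2) ^+ 2.
(** With [gam = 1 / (4 * delta0)] and [Lam + 1 + b = 2 * sqrt D * lin_coef tau / delta0], the
    polynomial part of [rhs2] at [r2 = r1 = 2 * sqrt D * sv k] is [- delta0 * (1 - uv b k)]. *)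
Definition uv b k : R := (Lam + 1 + b) * sv k - gam * sv k ^+ 3.
Definition duv b k : R := (Lam + 1 + b) * dsv k - 3 * gam * sv k ^+ 2 * dsv k.
Definition ell b k : R := Lam + (ln (1 + sv k) - ln (1 + uv b k)).
Definition half_eqn b k : R := (1 + k) ^+ 2 * ell b k.
Definition dhalf_eqn b k : R := 2 * (1 + k) * ell b k
  + (1 + k) ^+ 2 * (dsv k / (1 + sv k) - duv b k / (1 + uv b k)).
Definition eqn b k : R := half_eqn b k - half_eqn b (- k).
Definition wronsk b k : R := k * dhalf_eqn b k - 2 * half_eqn b k.
Definition deqn b k : R := wronsk b k - wronsk b (- k).

(* [eqn b k = - 4 b k + A3 k ^ 3 + A5 k ^ 5 + ...], up to [b * O(k ^ 3)]. *)
Definition A3 : R := 16 * gam - 8 * Lam - 8 * Lam ^+ 2 - 16 / 3 * Lam ^+ 3.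
Definition A5 : R := 64 * gam * (1 + Lam + Lam ^+ 2) - 40 * Lam - 80 * Lam ^+ 2
  - 256 / 3 * Lam ^+ 3 - 48 * Lam ^+ 4 - 64 / 5 * Lam ^+ 5.

Lemma bigO_inv1mk2 : bigO 0 (fun _ k => (1 - k ^+ 2)^-1).
Proof.
exists 2, (1 / 2); split => //; first by apply/andP; split; lra.
move=> b k _ hk; rewrite expr0 mulr1.
have k2 : k ^+ 2 <= 1 / 4.
  rewrite -real_normK ?num_real //; have := normr_ge0 k; move: hk; clear; nra.
rewrite ger0_norm ?invr_ge0; last by move: k2; clear; lra.
by rewrite -[leRHS]invrK lef_pV2 ?posrE //; move: k2; clear; lra.
Qed.

Local Notation zero := (fun _ : R => 0).
Local Notation const a := (fun _ : R => a).

Lemma one_mk2_neq0 k : `|k| < 1 -> 1 - k ^+ 2 != 0.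
Proof.
move=> hk; rewrite subr_eq0 eq_sym lt_eqF // -real_normK ?num_real //.
by rewrite expr_lt1.
Qed.

Lemma taylor6_inv1mk2 : taylor6 (fun _ k => (1 - k ^+ 2)^-1)
  (const 1) zero (const 1) zero (const 1) zero.
Proof.
split; first by split; split; exact: bounded_coef_cst.
have [C [d [C0 /andP[d0 d1] h]]] := @bigOM R 6 0 _ _ (bigO_kX 6) bigO_inv1mk2.
exists C, (Num.min d (1 / 2)); split => //.
  by rewrite lt_min d0 ge_min d1 andbT; lra.
move=> b k hb; rewrite le_min => /andP[kd k2].
have := h b k hb kd; rewrite addn0; congr (`|_| <= _).
rewrite /poly6; field; apply: one_mk2_neq0; move: k2; clear; lra.
Qed.

Lemma taylor6_sv : taylor6 (fun _ => sv) zero (const 2) zero (const 2) zero (const 2).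
Proof.
apply: taylor6_ext (taylor6M (taylor6Z 2 taylor6_k) taylor6_inv1mk2) _ _ => //.
by move=> b; split; split; ring.
Qed.

Lemma taylor6_kdsv : taylor6 (fun _ k => k * dsv k)
  zero (const 2) zero (const 6) zero (const 10).
Proof.
have h := taylor6M (taylor6M taylor6_inv1mk2 taylor6_inv1mk2)
  (taylor6M (taylor6Z 2 taylor6_k)
   (taylor6D (taylor6_coef (bounded_coef_cst 1)) (taylor6M taylor6_k taylor6_k))).
apply: taylor6_ext h _ _ => [b k|b]; last by split; split; ring.
by rewrite /dsv expr2 invfM; ring.
Qed.

Lemma bounded_b : @bounded_coef R id.
Proof. exact: bigO_b. Qed.

Lemma bounded_z : bounded_coef (fun b => Lam + 1 + b).
Proof. exact: bounded_coefD (bounded_coef_cst (Lam + 1)) bounded_b. Qed.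

Lemma taylor6_uv : taylor6 uv zero (fun b => 2 * (Lam + 1 + b)) zero
  (fun b => 2 * (Lam + 1 + b) - 8 * gam) zero
  (fun b => 2 * (Lam + 1 + b) - 24 * gam).
Proof.
have hs := taylor6_sv.
have h := taylor6D (taylor6M (taylor6_coef bounded_z) hs)
  (taylor6Z (- gam) (taylor6M hs (taylor6M hs hs))).
apply: taylor6_ext h _ _ => [b k|b]; first by rewrite /uv; ring.
by split; split; ring.
Qed.

Lemma taylor6_kduv : taylor6 (fun b k => k * duv b k) zero
  (fun b => 2 * (Lam + 1 + b)) zero
  (fun b => 3 * (2 * (Lam + 1 + b) - 8 * gam)) zero
  (fun b => 5 * (2 * (Lam + 1 + b) - 24 * gam)).
Proof.
have hs := taylor6_sv; have hd := taylor6_kdsv.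
have h := taylor6D (taylor6M (taylor6_coef bounded_z) hd)
  (taylor6Z (- 3 * gam) (taylor6M hd (taylor6M hs hs))).
apply: taylor6_ext h _ _ => [b k|b]; first by rewrite /duv; ring.
by split; split; ring.
Qed.

Lemma taylor6_ln1p v v1 v3 v5 : taylor6 v zero v1 zero v3 zero v5 ->
  taylor6 (fun b k => ln (1 + v b k)) zero v1 (fun b => - (v1 b ^+ 2 / 2))
    (fun b => v3 b + v1 b ^+ 3 / 3) (fun b => - (v1 b * v3 b) - v1 b ^+ 4 / 4)
    (fun b => v5 b + v1 b ^+ 2 * v3 b + v1 b ^+ 5 / 5).
Proof.
move=> hv; have h2 : (0 : R) <= 2 by []; have h12 : 0 < 1 / 2 :> R by lra.
have h := @taylor6_odd_comp R (fun x => ln (1 + x)) _ _ _ _ _ _ 2 _ v _ _ _ h2 h12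
  (@ln_taylor6 R) hv.
by apply: taylor6_ext h _ _ => // b; split; split; field.
Qed.

Lemma taylor6_inv1p v v1 v3 v5 : taylor6 v zero v1 zero v3 zero v5 ->
  taylor6 (fun b k => (1 + v b k)^-1) (const 1) (fun b => - v1 b)
    (fun b => v1 b ^+ 2) (fun b => - v3 b - v1 b ^+ 3)
    (fun b => 2 * v1 b * v3 b + v1 b ^+ 4)
    (fun b => - v5 b - 3 * v1 b ^+ 2 * v3 b - v1 b ^+ 5).
Proof.
move=> hv; have h2 : (0 : R) <= 2 by []; have h12 : 0 < 1 / 2 :> R by lra.
have h := @taylor6_odd_comp R (fun x => (1 + x)^-1) _ _ _ _ _ _ 2 _ v _ _ _ h2 h12
  (@inv_taylor6 R) hv.
apply: taylor6_ext h _ _ => // b; split; split; ring.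
Qed.

Definition G3 b : R := - 8 - 16 * Lam - 16 * Lam ^+ 2
  + b * (- 8 - 16 * Lam + b * - (16 / 3)).
Definition G5 b : R :=
  - 40 + 64 * gam - 160 * Lam + 128 * Lam * gam - 256 * Lam ^+ 2 - 192 * Lam ^+ 3
    - 64 * Lam ^+ 4
  + b * (- 80 + 64 * gam - 256 * Lam - 288 * Lam ^+ 2 - 128 * Lam ^+ 3
  + b * (- (256 / 3) - 192 * Lam - 128 * Lam ^+ 2
  + b * (- 48 - 64 * Lam + b * - (64 / 5)))).

Lemma bounded_G3 : bounded_coef G3.
Proof.
rewrite /G3; do ?[apply: bounded_coefD; first exact: bounded_coef_cst
  | apply: bounded_coefM; first exact: bounded_b]; exact: bounded_coef_cst.
Qed.

Lemma bounded_G5 : bounded_coef G5.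
Proof.
rewrite /G5; do ?[apply: bounded_coefD; first exact: bounded_coef_cst
  | apply: bounded_coefM; first exact: bounded_b]; exact: bounded_coef_cst.
Qed.

Lemma taylor6_1pk2 : taylor6 (fun _ k => (1 + k) ^+ 2)
  (const 1) (const 2) (const 1) zero zero zero.
Proof.
have h1 := taylor6D (taylor6_coef (bounded_coef_cst (1 : R))) (@taylor6_k R).
by apply: taylor6_ext (taylor6M h1 h1) _ _ => [b k|b]; [ring|split; split; ring].
Qed.

(** A bound on a remainder cannot be differentiated, so the derivative is expanded on its own from
    its explicit formula; its coefficients are then checked to be [n] times those of [ell]. *)
Lemma taylor6_ell : exists e1 e2 e3 e4 e5 : R -> R,
  [/\ taylor6 ell (const Lam) e1 e2 e3 e4 e5,
   taylor6 (fun b k => k * (dsv k / (1 + sv k) - duv b k / (1 + uv b k)))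
     zero e1 (fun b => 2 * e2 b) (fun b => 3 * e3 b) (fun b => 4 * e4 b)
     (fun b => 5 * e5 b) &
  forall b, [/\ 2 * (e1 b + 2 * Lam) = - 4 * b,
    2 * (e3 b + 2 * e2 b + e1 b) = A3 + b * G3 b &
    2 * (e5 b + 2 * e4 b + e3 b) = A5 + b * G5 b]].
Proof.
have h := taylor6D (taylor6_coef (bounded_coef_cst Lam))
  (taylor6D (taylor6_ln1p taylor6_sv) (taylor6Z (- 1) (taylor6_ln1p taylor6_uv))).
have hd := taylor6D (taylor6M taylor6_kdsv (taylor6_inv1p taylor6_sv))
  (taylor6Z (- 1) (taylor6M taylor6_kduv (taylor6_inv1p taylor6_uv))).
(* The coefficients are instantiated by [reflexivity] in the first goal. *)
do 5 eexists; split.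
- apply: taylor6_ext h _ _ => [b k|b]; first by rewrite /ell; ring.
  by split; split; try reflexivity; ring.
- apply: taylor6_ext hd _ _ => [b k|b]; first by ring.
  by split; split; field.
- by move=> b; split; rewrite /A3 /A5 /G3 /G5 /=; field.
Qed.

Lemma eqn_germ : odd_germ eqn 4 A3 A5.
Proof.
have [e1 [e2 [e3 [e4 [e5 [he _ E]]]]]] := taylor6_ell.
have h := taylor6_oddpart (taylor6M taylor6_1pk2 he).
exists G3, G5; split; [exact: bounded_G3|exact: bounded_G5|].
apply: bigO_ext h _ => b k; have [E1 E3 E5] := E b.
rewrite -E3 -E5 (_ : - 4 * b * k = 2 * (e1 b + 2 * Lam) * k); last by rewrite E1.
by rewrite /eqn /half_eqn; ring.
Qed.

(** The operator [f |-> k f' - 2 f] multiplies the coefficient of [k ^ n] by [n - 2], that is by -1,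
    1 and 3. The linear term thus changes sign relative to [eqn], so that [odd_germ_pos] applies to
    [deqn] exactly on the side where [eqn] has a zero. *)
Lemma deqn_germ : odd_germ deqn (- 4) A3 (3 * A5).
Proof.
have [e1 [e2 [e3 [e4 [e5 [he hm E]]]]]] := taylor6_ell.
have h1 := taylor6D (taylor6_coef (bounded_coef_cst (1 : R))) (@taylor6_k R).
have h := taylor6_oddpart (taylor6D (taylor6Z (- 2) (taylor6M h1 he))
  (taylor6M taylor6_1pk2 hm)).
exists G3, (fun b => 3 * G5 b); split; first exact: bounded_G3.
  exact: bounded_coefM (bounded_coef_cst 3) bounded_G5.
apply: bigO_ext h _ => b k; have [E1 E3 E5] := E b.
rewrite (_ : 3 * A5 + b * (3 * G5 b) = 3 * (A5 + b * G5 b)); last by ring.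
rewrite -E3 -E5 (_ : - - 4 * b * k = - (2 * (e1 b + 2 * Lam)) * k); last by rewrite E1; ring.
by rewrite /deqn /wronsk /dhalf_eqn /half_eqn; ring.
Qed.

Lemma is_derive_sv k : `|k| < 1 -> is_derive k 1 sv (dsv k).
Proof.
move=> hk; have n0 := one_mk2_neq0 hk.
have h := derM (derM (derC 2 k) (is_derive_id k 1))
  (derV (f := fun s : R => 1 - s ^+ 2) n0 (derB (derC 1 k) (derX 1 k))).
apply: der_ext h _ _ => //.
by rewrite /dsv; field.
Qed.

Lemma is_derive_uv b k : `|k| < 1 -> is_derive k 1 (uv b) (duv b k).
Proof.
move=> hk; have hs := is_derive_sv hk.
have h := derB (derM (derC (Lam + 1 + b) k) hs)
  (derM (derC gam k) (der_comp (derX 2 (sv k)) hs)).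
by apply: der_ext h _ _ => //; rewrite /duv; ring.
Qed.

Lemma is_derive_half_eqn b k : `|k| < 1 -> `|sv k| < 1 -> `|uv b k| < 1 ->
  is_derive k 1 (half_eqn b) (dhalf_eqn b k).
Proof.
move=> hk; rewrite !ltr_norml => /andP[s0 _] /andP[u0 _].
have s1 : 0 < 1 + sv k by lra.
have u1 : 0 < 1 + uv b k by lra.
have hs := der_comp (g := fun s => 1 + sv s) (is_derive1_ln s1) (derD (derC 1 k) (is_derive_sv hk)).
have hu := der_comp (g := fun s => 1 + uv b s) (is_derive1_ln u1) (derD (derC 1 k) (is_derive_uv b hk)).
have h2 := der_comp (g := fun s => 1 + s) (derX 1 (1 + k)) (derD (derC 1 k) (is_derive_id k 1)).
have h := derM h2 (derD (derC Lam k) (derB hs hu)).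
by apply: der_ext h _ _ => //; rewrite /dhalf_eqn /ell; ring.
Qed.

Lemma svN k : sv (- k) = - sv k.
Proof. by rewrite /sv sqrrN; ring. Qed.

Lemma uvN b k : uv b (- k) = - uv b k.
Proof. by rewrite /uv svN; ring. Qed.

Lemma eqnN b k : eqn b (- k) = - eqn b k.
Proof. by rewrite /eqn opprK opprB. Qed.

Lemma is_derive_eqn b k : `|k| < 1 -> `|sv k| < 1 -> `|uv b k| < 1 ->
  is_derive k 1 (eqn b) (dhalf_eqn b k + dhalf_eqn b (- k)).
Proof.
move=> hk hs hu; have h1 := is_derive_half_eqn hk hs hu.
have hN : is_derive (- k) 1 (half_eqn b) (dhalf_eqn b (- k)).
  by apply: is_derive_half_eqn; rewrite ?svN ?uvN normrN.
have hk' : is_derive k 1 (fun t : R => - t) (- 1) by exact: is_deriveNid.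
by apply: der_ext (derB h1 (der_comp hN hk')) _ _ => //; ring.
Qed.

(** Keeps the arguments of all logarithms positive, at [k] and at [- k]. *)
Lemma sv_uv_lt1 : exists2 d : R, 0 < d < 1 & forall b k, `|b| <= 1 -> `|k| <= d ->
  `|sv k| < 1 /\ `|uv b k| < 1.
Proof.
have [C [d [C0 /andP[d0 d1] h]]] := taylor6_bigO1 taylor6_sv.
have [C' [d' [C'0 /andP[d'0 d'1] h']]] := taylor6_bigO1 taylor6_uv.
have p : 0 < 2 * (C + C' + 2) by rewrite mulr_gt0 // ltr_wpDl // addr_ge0.
exists (Num.min (Num.min d d') (2 * (C + C' + 2))^-1).
  rewrite !lt_min d0 d'0 invr_gt0 p /= !gt_min; apply/orP; right.
  by rewrite invf_lt1 //; move: C0 C'0; clear; lra.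
move=> b k hb; rewrite !le_min => /andP[/andP[kd kd']].
rewrite -[_^-1]mul1r ler_pdivlMr // => kC.
have := h b k hb kd; have := h' b k hb kd'; rewrite expr1.
have := normr_ge0 k; have := mulr_ge0 C0 (normr_ge0 k).
have := mulr_ge0 C'0 (normr_ge0 k); move: kC; clear.
by move=> *; split; lra.
Qed.

Lemma eqn_div_mono b d (sg : R) : d < 1 ->
  (forall k, `|k| <= d -> `|sv k| < 1 /\ `|uv b k| < 1) ->
  (forall k, 0 < k <= d -> 0 < sg * deqn b k) ->
  forall k k', 0 < k -> k < k' -> k' <= d ->
    sg * eqn b k / k ^+ 2 < sg * eqn b k' / k' ^+ 2.
Proof.
move=> d1 hsm hpos k k' k0 kk' k'd.
have [||c] := @MVT R (fun t => sg * eqn b t / t ^+ 2)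
   (fun t => sg * deqn b t / t ^+ 3) k k' kk'.
- move=> t; rewrite in_itv /= => /andP[kt tk'].
  have t0 : 0 < t by exact: lt_trans kt.
  have td : `|t| <= d by rewrite gtr0_norm // ltW // (lt_le_trans tk').
  have t1 : `|t| < 1 by exact: le_lt_trans d1.
  have [hs hu] := hsm t td; have ht := is_derive_eqn t1 hs hu.
  have n0 : t ^+ 2 != 0 by rewrite expf_neq0 // gt_eqF.
  have h := derM (derM (derC sg t) ht) (derV (f := fun s : R => s ^+ 2) n0 (derX 1 t)).
  apply: der_ext h _ _ => //.
  by rewrite /deqn /wronsk /eqn; field; rewrite gt_eqF.
- apply: continuous_in_subspaceT => t /[!inE] /=; rewrite in_itv /= => /andP[kt tk'].
  have t0 : 0 < t by exact: lt_le_trans kt.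
  have td : `|t| <= d by rewrite gtr0_norm // (le_trans tk').
  have t1 : `|t| < 1 by exact: le_lt_trans d1.
  have [hs hu] := hsm t td; have ht := is_derive_eqn t1 hs hu.
  have n0 : t ^+ 2 != 0 by rewrite expf_neq0 // gt_eqF.
  exact: is_derive_continuous (derM (derM (derC sg t) ht) (derV (f := fun s : R => s ^+ 2) n0 (derX 1 t))).
rewrite in_itv /= => /andP[kc ck'] E.
rewrite -subr_gt0 E mulr_gt0 ?subr_gt0 //.
have c0 : 0 < c by exact: lt_trans kc.
rewrite divr_gt0 ?exprn_gt0 // hpos // c0 ltW // (lt_le_trans ck') //.
Qed.

End branch_equation.

(** * Existence, uniqueness and continuity of the zero *)

(** Monotonicity of the quotient gives more than uniqueness: [G y] is negative below its zero [K y]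
    and positive above it. The sign at a fixed level [k] persists for nearby parameters and traps
    the zero there, which gives continuity also at [y = 0], where the zero merges with [k = 0]. *)
Lemma pitchfork_root (R : realType) (G : R -> R -> R) (k1 : R) : 0 < k1 ->
  (forall y k : R, - 1 <= y <= 0 -> 0 < k <= k1 -> 0 < G y k) ->
  (forall y : R, 0 < y <= 1 -> exists2 k2 : R, 0 < k2 & forall k : R, 0 < k <= k2 -> G y k < 0) ->
  (forall y k k' : R, 0 < y <= 1 -> 0 < k -> k < k' -> k' <= k1 ->
    G y k / k ^+ 2 < G y k' / k' ^+ 2) ->
  (forall y k : R, - 1 < y < 1 -> 0 < k <= k1 -> {for y, continuous (G^~ k)}) ->
  (forall y k : R, 0 < y < 1 -> 0 < k <= k1 -> {for k, continuous (G y)}) ->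
  exists (d : R) (K : R -> R), [/\ 0 < d <= 1, K 0 = 0,
    forall y : R, 0 < y < d -> 0 < K y < k1 /\
      forall k : R, 0 < k <= k1 -> (G y k = 0 <-> k = K y) &
    {within [set y : R | 0 <= y < d], continuous K}].
Proof.
move=> k10 hneg hnear hmono hcy hck.
(* Positivity at the outer end [k1] holds at [y = 0] and is kept for small [y]; the zero can then be
   found below [k1]. *)
have [d [d0 d1 hd]] : exists d : R, [/\ 0 < d, d <= 1 &
    forall y : R, 0 <= y < d -> 0 < G y k1].
  have G0 : 0 < G 0 k1 by apply: hneg; rewrite ?lexx ?k10 // lerN10.
  have c0 : {for 0, continuous (G^~ k1)}.
    by apply: hcy; rewrite ?k10 ?lexx // ltrN10 ltr01.
  have /nbhs_ballP[d d0 hd] : \forall y \near 0, 0 < G y k1.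
    exact: (cvgr_gt (G 0 k1) c0 _ G0).
  exists (Num.min d 1); split.
  - by rewrite lt_min d0 ltr01.
  - by rewrite ge_min lexx orbT.
  - move=> y /andP[y0]; rewrite lt_min => /andP[yd _]; apply: hd.
    by rewrite /ball /= sub0r normrN ger0_norm.
have root (y : R) : 0 < y < d -> exists2 K, 0 < K < k1 & G y K = 0.
  move=> /andP[y0 yd]; have y1 : 0 < y < 1 by rewrite y0 (lt_le_trans yd).
  have [k2 k20 hk2] := hnear y ltac:(rewrite y0 ltW //; case/andP: y1 => //).
  pose k3 := Num.min k2 k1.
  have k30 : 0 < k3 by rewrite lt_min k20.
  have k31 : k3 <= k1 by rewrite ge_min lexx orbT.
  have Gk3 : G y k3 < 0 by apply: hk2; rewrite k30 ge_min lexx.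
  have Gk1 : 0 < G y k1 by apply: hd; rewrite ltW.
  have [||K] := @IVT R (G y) k3 k1 0 k31.
  - apply: continuous_in_subspaceT => t /[!inE] /=; rewrite in_itv /= => /andP[kt tk].
    by apply: hck => //; rewrite (lt_le_trans k30).
  - by rewrite min_l ?max_r ?ltW // (lt_trans Gk3).
  rewrite in_itv /= => /andP[h1 h2] GK; exists K => //.
  rewrite (lt_le_trans k30) //= lt_neqAle h2 andbT.
  by apply: contraTneq Gk1 => <-; rewrite GK ltxx.
have [K0 hK0] : {K : R -> R & forall y : R, 0 < y < d -> 0 < K y < k1 /\ G y (K y) = 0}.
  apply: (@choice R R (fun y K => 0 < y < d -> 0 < K < k1 /\ G y K = 0)) => y.
  have [hy|hy] := boolP (0 < y < d); last by exists 0.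
  by have [K h1 h2] := root y hy; exists K.
pose K (y : R) := if 0 < y then K0 y else 0.
have hK (y : R) : 0 < y < d -> 0 < K y < k1 /\ G y (K y) = 0.
  by move=> hy; rewrite /K; have [-> _] := andP hy; exact: hK0.
have gtK (y k : R) : 0 < y < d -> K y < k -> k <= k1 -> 0 < G y k.
  move=> hy Kk kk1; have [/andP[K00 K1] GK] := hK y hy.
  have hy1 : 0 < y <= 1 by case/andP: hy => -> /ltW/le_trans; apply.
  have := hmono y _ _ hy1 K00 Kk kk1; rewrite GK mul0r.
  by rewrite pmulr_lgt0 // invr_gt0 exprn_gt0 // (lt_trans K00).
have ltK (y k : R) : 0 < y < d -> 0 < k -> k < K y -> G y k < 0.
  move=> hy k0 kK; have [/andP[K00 K1] GK] := hK y hy.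
  have hy1 : 0 < y <= 1 by case/andP: hy => -> /ltW/le_trans; apply.
  have := hmono y _ _ hy1 k0 kK (ltW K1); rewrite GK mul0r.
  by rewrite pmulr_llt0 // invr_gt0 exprn_gt0.
exists d, K; split.
- by rewrite d0.
- by rewrite /K ltxx.
- move=> y hy; have [hK1 GK] := hK y hy; split=> // k /andP[k0 kk1].
  split=> [Gk|->//]; case: (ltgtP k (K y)) => // h.
    by have := ltK y k hy k0 h; rewrite Gk ltxx.
  by have := gtK y k hy h kk1; rewrite Gk ltxx.
suff cont (y : R) : 0 <= y < d ->
    K t @[t --> within [set y : R | 0 <= y < d] (nbhs y)] --> K y.
  by apply/subspace_continuousP => y; exact: cont.
move=> /andP[y0 yd].
have y1 : - 1 < y < 1 by rewrite (lt_le_trans yd) // (lt_le_trans _ y0) // ltrN10.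
have K00 : 0 <= K y.
  have [yp|/negbTE yn] := boolP (0 < y); last by rewrite /K yn.
  by have [/andP[/ltW]] := hK y ltac:(rewrite yp //).
have Kk1 : K y < k1.
  have [yp|/negbTE yn] := boolP (0 < y); last by rewrite /K yn.
  by have [/andP[]] := hK y ltac:(rewrite yp //).
have up (e : R) : 0 < e -> \forall t \near y, 0 <= t < d -> K t < K y + e.
  move=> e0; pose k := Num.min (K y + e / 2) k1.
  have kK : K y < k by rewrite lt_min Kk1 ltrDl divr_gt0.
  have kk1 : k <= k1 by rewrite ge_min lexx orbT.
  have k0 : 0 < k by exact: le_lt_trans kK.
  have ke : k < K y + e.
    have : k <= K y + e / 2 by rewrite ge_min lexx.
    by move: e0; clear; lra.
  have Gk : 0 < G y k.
    move: y0; rewrite le_eqVlt => /orP[/eqP<-|yp].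
      by apply: hneg; rewrite ?k0 // lerN10 lexx.
    by apply: gtK; rewrite // yp.
  have c : {for y, continuous (G^~ k)} by apply: hcy; rewrite ?k0.
  have : \forall t \near y, 0 < G t k by exact: (cvgr_gt (G y k) c _ Gk).
  apply: filterS => t Gt /andP[t0 td].
  move: t0; rewrite le_eqVlt => /orP[/eqP<-|tp].
    by rewrite {1}/K ltxx; exact: lt_trans ke.
  rewrite ltNge; apply/negP => h.
  have kKt : k < K t by exact: lt_le_trans ke h.
  have := ltK t k ltac:(rewrite tp //) k0 kKt.
  by rewrite ltNge (ltW Gt).
have low (e : R) : 0 < e -> \forall t \near y, 0 <= t < d -> K y - e < K t.
  move=> e0; pose k := K y - e / 2.
  have [k0|k0] := leP k 0.
    near=> t => /andP[t0 td].
    have : 0 <= K t.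
      move: t0; rewrite le_eqVlt => /orP[/eqP<-|tp]; first by rewrite /K ltxx.
      by have [/andP[/ltW]] := hK t ltac:(rewrite tp //).
    by move: k0 e0; rewrite /k; clear; lra.
  have kK : k < K y by rewrite /k; move: e0; clear; lra.
  have yp : 0 < y.
    move: y0; rewrite le_eqVlt => /orP[/eqP y0|//].
    by move: kK; rewrite -y0 {1}/K ltxx => /(lt_trans k0); rewrite ltxx.
  have Gk := ltK y k ltac:(rewrite yp //) k0 kK.
  have c : {for y, continuous (G^~ k)}.
    by apply: hcy => //; rewrite k0 ltW // (lt_trans kK).
  have : \forall t \near y, G t k < 0 by exact: (cvgr_lt (G y k) c _ Gk).
  apply: filterS => t Gt /andP[t0 td].
  move: t0; rewrite le_eqVlt => /orP[/eqP t0|tp].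
    have : 0 < G t k by apply: hneg; rewrite -?t0 ?lerN10 ?lexx // k0 ltW // (lt_trans kK).
    by rewrite ltNge (ltW Gt).
  rewrite ltNge; apply/negP => h.
  have Ktk : K t < k by apply: (le_lt_trans h); rewrite /k; move: e0; clear; lra.
  have := gtK t k ltac:(rewrite tp //) Ktk (ltW (lt_trans kK Kk1)).
  by rewrite ltNge (ltW Gt).
apply/cvgrPdist_lt => e e0; rewrite near_withinE.
near=> t => ht; rewrite ltr_norml.
have h1 : K t < K y + e by move: ht; near: t; exact: up.
have h2 : K y - e < K t by move: ht; near: t; exact: low.
by move: h1 h2; clear; lra.
Unshelve. all: by end_near. Qed.

(** * Continuity tools and nondegeneracy of the quintic coefficient *)

Lemma within_continuous_comp (R : realType) (A B : set R) (f g : R -> R) :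
  continuous g -> (forall x, A x -> B (g x)) -> {within B, continuous f} ->
  {within A, continuous (fun x => f (g x))}.
Proof.
move=> cg AB /subspace_continuousP hf.
suff cont (x : R) : A x -> f (g t) @[t --> within A (nbhs x)] --> f (g x).
  by apply/subspace_continuousP => x; exact: cont.
move=> Ax U nU.
have h : nbhs (g x) [set t | B t -> U (f t)] := hf (g x) (AB x Ax) U nU.
have h' : \forall t \near x, B (g t) -> U (f (g t)) by exact: (cg x _ h).
suff : \forall t \near x, A t -> U (f (g t)) by [].
by move: h'; apply: filterS => t ht At; exact: ht (AB t At).
Qed.

Lemma cvg_rV (R : realType) n (T : Type) (F : set_system T) (f : T -> 'rV[R]_n)
    (l : 'rV[R]_n) : Filter F ->
  (forall i, f t 0 i @[t --> F] --> l 0 i) -> f t @[t --> F] --> l.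
Proof.
move=> FF h; apply/cvgrPdist_le => e e0.
have : \forall t \near F, forall i, `|l 0 i - f t 0 i| <= e.
  apply: (@filter_forall _ 'I_n (fun i t => `|l 0 i - f t 0 i| <= e)) => i.
  by have /cvgrPdist_le := h i; apply.
apply: filterS => t ht; apply: rV_norm_le => [|i]; first exact: ltW.
by rewrite !mxE.
Qed.

(** From [1 - x <= expR (- x)] at [x = 1 / 16], raised to the twentieth power. *)
Lemma exp54_lt (R : realType) : expR (5 / 4) <= 3764 / 1000 :> R.
Proof.
have h : expR (1 / 16) <= 16 / 15 :> R.
  have := @expR_ge1Dx R (- (1 / 16)); rewrite expRN => h.
  have p := expR_gt0 (1 / 16 : R).
  have := ler_wpM2r (ltW p) h; rewrite mulVf ?gt_eqF //; lra.
have p := expR_ge0 (1 / 16 : R).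
have -> : expR (5 / 4) = expR (1 / 16) ^+ 20 :> R.
  by rewrite -expRM_natl; congr expR; field.
set x := expR (1 / 16) in h p *.
have x2 : x ^+ 2 <= 114 / 100 by nra.
have x4 : x ^+ 4 <= 13 / 10.
  by rewrite (_ : x ^+ 4 = x ^+ 2 * x ^+ 2); [have := sqr_ge0 x; nra|ring].
have x5 : x ^+ 5 <= 139 / 100.
  by rewrite exprS; have := exprn_ge0 4 p; nra.
have x10 : x ^+ 10 <= 194 / 100.
  by rewrite (_ : x ^+ 10 = x ^+ 5 * x ^+ 5); [have := exprn_ge0 5 p; nra|ring].
by rewrite (_ : x ^+ 20 = x ^+ 10 * x ^+ 10); [have := exprn_ge0 10 p; nra|ring].
Qed.

(** If [A3] vanishes, then [expR L = L + L ^ 2 + 2 / 3 L ^ 3]; inserted in [A5] this leaves [8 L]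
    times a quartic polynomial, whose positive zeros lie between 6/5 and 5/4. There the cubic
    expression already exceeds [expR (5 / 4)], so the two coefficients cannot vanish together. *)
Lemma quintic_nondegenerate (R : realType) (L : R) : 0 < L ->
  A3 L (expR L / 2) = 0 -> A5 L (expR L / 2) != 0.
Proof.
move=> L0; rewrite /A3 /A5 => h3; apply/eqP => h5.
have e : expR L = L + L ^+ 2 + 2 / 3 * L ^+ 3 by move: h3; clear; lra.
have P : - 1 - 2 * L + 2 / 3 * L ^+ 3 + 16 / 15 * L ^+ 4 = 0.
  apply: (mulfI (_ : 8 * L != 0)); first by rewrite mulf_neq0 ?gt_eqF.
  by rewrite mulr0 -h5 e; field.
have L12 : 6 / 5 < L.
  rewrite ltNge; apply/negP => hL.
  have L2 : L ^+ 2 <= 36 / 25 by rewrite expr2; nra.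
  have L3 : L ^+ 3 <= 36 / 25 * L by rewrite exprSr; nra.
  have L4 : L ^+ 4 <= 216 / 125 * L by rewrite exprS; nra.
  by move: P L3 L4 hL; clear; lra.
have L54 : L < 5 / 4.
  rewrite ltNge; apply/negP => hL.
  have L2 : 25 / 16 <= L ^+ 2 by rewrite expr2; nra.
  have L3 : 25 / 16 * L <= L ^+ 3 by rewrite exprSr; nra.
  have L4 : 125 / 64 * L <= L ^+ 4 by rewrite exprS; nra.
  by move: P L3 L4 hL; clear; lra.
have := @exp54_lt R; have : expR L <= expR (5 / 4) by rewrite ler_expR ltW.
rewrite e.
have L2 : 36 / 25 < L ^+ 2 by rewrite expr2; nra.
have L3 : 216 / 125 < L ^+ 3 by rewrite exprS; nra.
by move: L12 L2 L3; clear; lra.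
Qed.

(** * The pitchfork bifurcation of the pulse system *)

Section pitchfork.
Context {R : realType} (D delta0 : R).
Hypotheses (hD : 0 < D) (hd : 0 < delta0 < 1 / 2).

Local Notation p := (pstar D delta0).
Local Notation Lam := (Lambda delta0).
Local Notation gam := (1 / (4 * delta0)).
Local Notation uv := (uv Lam gam).
Local Notation ell := (ell Lam gam).
Local Notation eqn := (eqn Lam gam).
Local Notation deqn := (deqn Lam gam).

Lemma gamE : gam = expR Lam / 2.
Proof.
have d0 := delta0_gt0 hd.
have : expR Lam = (2 * delta0)^-1 by rewrite -(expR_Lambda hd) -expRN opprK.
by move=> ->; field; rewrite gt_eqF.
Qed.

Lemma branch_sign : exists sg : R, (sg = 1 \/ sg = - 1) /\
  (0 < sg * A3 Lam gam \/ (A3 Lam gam = 0 /\ 0 < sg * A5 Lam gam)).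
Proof.
have [h|h|h] := ltgtP (A3 Lam gam) 0.
- by exists (-1); split; [right|left; rewrite mulN1r oppr_gt0].
- by exists 1; split; [left|left; rewrite mul1r].
have h5 : A5 Lam gam != 0.
  by rewrite gamE quintic_nondegenerate ?Lambda_gt0 // -gamE.
have [h'|h'|h'] := ltgtP (A5 Lam gam) 0.
- by exists (-1); split; right => //; split => //; rewrite mulN1r oppr_gt0.
- by exists 1; split; [left|right; split => //; rewrite mul1r].
- by rewrite h' eqxx in h5.
Qed.

Definition unfolding (tau : R) : R := 2 * Num.sqrt D * lin_coef D tau / delta0 - (Lam + 1).
Definition rate : R := 2 * Num.sqrt D * Num.sqrt 2 / delta0.

Lemma rate_gt0 : 0 < rate.
Proof.
have s0 := sqrtD_gt0 hD; have s2 : 0 < Num.sqrt 2 :> R by rewrite sqrtr_gt0.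
rewrite /rate divr_gt0 ?(delta0_gt0 hd) //.
by rewrite mulr_gt0 // mulr_gt0.
Qed.

Lemma unfoldingE tau : unfolding tau = - rate * (tau - tau_d D delta0).
Proof.
have d0 := lt0r_neq0 (delta0_gt0 hd); have s0 := lt0r_neq0 (sqrtD_gt0 hD).
have E : lin_coef D tau = kappa D delta0 - Num.sqrt 2 * (tau - tau_d D delta0).
  by rewrite -lin_coef_tau_d /lin_coef; ring.
rewrite /unfolding /rate E (kappaE _ hD); field.
by rewrite d0 s0.
Qed.

Lemma phi_sv k : `|k| < 1 ->
  phi D (2 * Num.sqrt D * sv k) = 2 * Num.sqrt D * ((1 + k ^+ 2) / (1 - k ^+ 2)).
Proof.
move=> hk; have n0 := one_mk2_neq0 hk.
have k2 : 0 < 1 - k ^+ 2.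
  by rewrite subr_gt0 -real_normK ?num_real // expr_lt1.
rewrite /phi; have -> : (2 * Num.sqrt D * sv k) ^+ 2 + 4 * D =
    (2 * Num.sqrt D * ((1 + k ^+ 2) / (1 - k ^+ 2))) ^+ 2.
  by rewrite -{2}(sqrtD_sq hD) /sv; field.
have s0 := sqrtD_gt0 hD; rewrite sqrtr_sqr ger0_norm //.
have h : 0 <= (1 + k ^+ 2) / (1 - k ^+ 2) by rewrite divr_ge0 ?(ltW k2) // addr_ge0 // sqr_ge0.
by rewrite mulr_ge0 // mulr_ge0 // ltW.
Qed.

Lemma exp_eq_iff (x y t : R) : 0 < x -> 0 < y ->
  x * expR (- t) = 2 * delta0 * y <-> t = Lam + (ln x - ln y).
Proof.
move=> x0 y0; rewrite -(expR_Lambda hd) -{1}(lnK x0) -{1}(lnK y0) -!expRD.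
split=> [/expR_inj|->]; last by congr expR; ring.
by move=> h; move: h; clear -hd; lra.
Qed.

Lemma rhs2_branch tau k h : `|k| < 1 -> `|sv k| < 1 -> `|uv (unfolding tau) k| < 1 ->
  rhs2 D delta0 tau h (2 * Num.sqrt D * sv k) (2 * Num.sqrt D * sv k) = 0 <->
  (1 + k) * h = Num.sqrt D * (1 - k) * ell (unfolding tau) (- k).
Proof.
move=> hk hs hu; have n0 := one_mk2_neq0 hk.
have s0 := sqrtD_gt0 hD; have sq := sqrtD_sq hD; have d0 := delta0_gt0 hd.
have [k1 k2] : 0 < 1 + k /\ 0 < 1 - k by move: hk; rewrite ltr_norml => /andP[]; clear -hd; lra.
have s1 : 0 < 1 - sv k by move: hs; rewrite ltr_norml => /andP[]; clear -hd; lra.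
have u1 : 0 < 1 - uv (unfolding tau) k by move: hu; rewrite ltr_norml => /andP[]; clear -hd; lra.
have E : - ((2 * Num.sqrt D * sv k + phi D (2 * Num.sqrt D * sv k)) / (2 * D)) * h =
    - ((1 + k) / (1 - k) * (h / Num.sqrt D)).
  rewrite phi_sv // /sv; set q := Num.sqrt D in s0 sq *; rewrite -sq.
  by field; rewrite n0 !gt_eqF.
have U : uv (unfolding tau) k = (2 * Num.sqrt D * lin_coef D tau * sv k - sv k ^+ 3 / 4) / delta0.
  by rewrite /uv /unfolding; field; rewrite gt_eqF.
have T : rhs2 D delta0 tau h (2 * Num.sqrt D * sv k) (2 * Num.sqrt D * sv k) =
   ((1 - sv k) * expR (- ((1 + k) / (1 - k) * (h / Num.sqrt D)))
    - 2 * delta0 * (1 - uv (unfolding tau) k)) / 2.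
  rewrite U /rhs2 E -/(lin_coef D tau) /g3 /G0 /G1; set ex := expR _.
  by field; rewrite !gt_eqF.
rewrite T; split.
- move/eqP; rewrite mulf_eq0 invr_eq0 pnatr_eq0 orbF subr_eq0 => /eqP.
  move/(exp_eq_iff _ s1 u1) => F.
  rewrite /ell svN uvN -F; field; by rewrite !gt_eqF.
- move=> F; have /(exp_eq_iff _ s1 u1) -> : (1 + k) / (1 - k) * (h / Num.sqrt D) =
      Lam + (ln (1 - sv k) - ln (1 - uv (unfolding tau) k)).
    move: F; rewrite /ell svN uvN; set X := Lam + _ => F.
    have -> : (1 + k) / (1 - k) * (h / Num.sqrt D) =
      (1 + k) * h / ((1 - k) * Num.sqrt D) by field; rewrite !gt_eqF.
    by rewrite F; field; rewrite !gt_eqF.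
  by rewrite subrr mul0r.
Qed.

(** [h] is solved from the stationarity condition on [rhs1]; [eqn b k = 0] says that the condition
    on [rhs2] gives the same value. *)
Definition branch (b k : R) : 'rV[R]_3 :=
  state (Num.sqrt D * ((1 + k) / (1 - k)) * ell b k)
    (2 * Num.sqrt D * sv k) (2 * Num.sqrt D * sv k).

Lemma branch0 b : branch b 0 = p.
Proof.
have s0 : sv 0 = 0 :> R by rewrite /sv mulr0 mul0r.
rewrite /branch /pstar hstarE s0 mulr0; congr state.
by rewrite /ell /uv s0 expr0n /= !mulr0 subrr !addr0 subrr addr0 subr0 divr1 mulr1.
Qed.

Lemma stationary_diag tau (x : 'rV[R]_3) :
  pulse_field D delta0 tau x = 0 <->
  [/\ x 0 1 = x 0 2, rhs2 D delta0 tau (x 0 0) (x 0 1) (x 0 1) = 0 &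
      rhs2 D delta0 tau (x 0 0) (- x 0 1) (- x 0 1) = 0].
Proof.
have m0 := lt0r_neq0 (m0_gt0 hD); split.
- move=> E.
  have E0 := congr1 (fun u : 'rV[R]_3 => u 0 0) E.
  have E1 := congr1 (fun u : 'rV[R]_3 => u 0 1) E.
  have E2 := congr1 (fun u : 'rV[R]_3 => u 0 2) E.
  move: E0 E1 E2; rewrite /pulse_field !mxE /= => /eqP; rewrite subr_eq0 => /eqP <-.
  rewrite rhs1_rhs2 => /eqP; rewrite mulf_eq0 invr_eq0 (negbTE m0) orbF => /eqP E1.
  by move=> /eqP; rewrite mulf_eq0 invr_eq0 (negbTE m0) orbF oppr_eq0 => /eqP E2.
- move=> [e E1 E2]; apply/rowP => i; rewrite /pulse_field !mxE rhs1_rhs2 -e E1 E2.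
  by case: i => -[|[|[|//]]] hi /=; rewrite ?subrr ?oppr0 ?mul0r.
Qed.

Lemma stationary_branch tau k (x : 'rV[R]_3) :
  `|k| < 1 -> `|sv k| < 1 -> `|uv (unfolding tau) k| < 1 ->
  x 0 1 = 2 * Num.sqrt D * sv k ->
  pulse_field D delta0 tau x = 0 <-> eqn (unfolding tau) k = 0 /\ x = branch (unfolding tau) k.
Proof.
move=> hk hs hu x1; rewrite stationary_diag x1 -mulrN -svN.
have s0 := sqrtD_gt0 hD.
have [k1 k2] : 0 < 1 + k /\ 0 < 1 - k by move: hk; rewrite ltr_norml => /andP[]; clear -hd; lra.
have r2 := rhs2_branch (x 0 0) hk hs hu.
have r1 : rhs2 D delta0 tau (x 0 0) (2 * Num.sqrt D * sv (- k))
    (2 * Num.sqrt D * sv (- k)) = 0 <->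
    (1 - k) * x 0 0 = Num.sqrt D * (1 + k) * ell (unfolding tau) k.
  have := @rhs2_branch tau (- k) (x 0 0); rewrite normrN svN uvN !normrN opprK.
  by move=> /(_ hk hs hu).
split.
- move=> [e /r2 E2 /r1 E1].
  have h : x 0 0 = Num.sqrt D * ((1 + k) / (1 - k)) * ell (unfolding tau) k.
    have -> : x 0 0 = (1 - k) * x 0 0 / (1 - k) by field; rewrite gt_eqF.
    by rewrite E1; field; rewrite gt_eqF.
  split.
    apply: (mulfI (lt0r_neq0 s0)); rewrite mulr0 /eqn /half_eqn.
    transitivity ((1 + k) * (Num.sqrt D * (1 + k) * ell (unfolding tau) k)
      - (1 - k) * (Num.sqrt D * (1 - k) * ell (unfolding tau) (- k))); first by ring.
    by rewrite -E1 -E2; ring.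
  apply/rowP => i; rewrite mxE; case: i => -[|[|[|//]]] hi /=.
  + by rewrite -h; congr (x _ _); apply/val_inj.
  + by rewrite -x1; congr (x _ _); apply/val_inj.
  + by rewrite e; congr (x _ _); apply/val_inj.
- move=> [E X].
  have x0 : x 0 0 = Num.sqrt D * ((1 + k) / (1 - k)) * ell (unfolding tau) k by rewrite X mxE.
  have x2 : x 0 2 = 2 * Num.sqrt D * sv k by rewrite X mxE.
  split => //; [apply/r2|apply/r1]; rewrite x0; last by field; rewrite gt_eqF.
  have E' : (1 + k) ^+ 2 * ell (unfolding tau) k = (1 - k) ^+ 2 * ell (unfolding tau) (- k).
    by apply/eqP; rewrite -subr_eq0; apply/eqP.
  transitivity (Num.sqrt D / (1 - k) * ((1 + k) ^+ 2 * ell (unfolding tau) k)).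
    by field; rewrite gt_eqF.
  by rewrite E'; field; rewrite gt_eqF.
Qed.

(** The half-angle formula [tanh (theta / 2) = sinh theta / (1 + cosh theta)], with
    [r = 2 sqrt D sinh theta] and [phi D r = 2 sqrt D cosh theta]. *)
Definition kof (r : R) : R := r / (2 * Num.sqrt D + phi D r).

Lemma kof_props r : [/\ `|kof r| < 1, `|kof r| <= `|r| / (4 * Num.sqrt D) &
  r = 2 * Num.sqrt D * sv (kof r)].
Proof.
have s0 := sqrtD_gt0 hD; have sq := sqrtD_sq hD; have ph := phi_ge D r.
have ps := phi_sq hD r.
have q0 : 0 < 2 * Num.sqrt D + phi D r by move: s0 ph; clear -hd; lra.
have rphi : `|r| <= phi D r.
  rewrite -(ler_pXn2r (isT : (0 < 2)%N)) ?nnegrE //; last by move: s0 ph; clear -hd; lra.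
  by rewrite ps real_normK ?num_real // lerDl mulr_ge0 // ltW.
split.
- rewrite /kof normrM normfV (gtr0_norm q0) ltr_pdivrMr // mul1r.
  by move: rphi s0; clear -hd; lra.
- rewrite /kof normrM normfV (gtr0_norm q0) ler_wpM2l // lef_pV2 ?posrE ?mulr_gt0 //.
  by move: ph; clear -hd; lra.
- have e : (2 * Num.sqrt D + phi D r) ^+ 2 - r ^+ 2 =
      4 * Num.sqrt D * (2 * Num.sqrt D + phi D r).
    have sq4 : 4 * D = 4 * Num.sqrt D ^+ 2 by rewrite sq.
    by rewrite sqrrD ps sq4; ring.
  have e0 : (2 * Num.sqrt D + phi D r) ^+ 2 - r ^+ 2 != 0.
    by rewrite e gt_eqF // !mulr_gt0.
  rewrite /kof /sv; set Q := 2 * Num.sqrt D + phi D r in q0 e e0 *.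
  have -> : 2 * (r / Q) / (1 - (r / Q) ^+ 2) = 2 * r * Q / (Q ^+ 2 - r ^+ 2).
    by field; rewrite e0 gt_eqF.
  by rewrite e; field; rewrite !gt_eqF.
Qed.

Section cvg.
Context (T : Type) (F : set_system T) (FF : Filter F).
Implicit Types (bf kf : T -> R) (b k : R).

Lemma cvg_sv kf k : `|k| < 1 -> kf t @[t --> F] --> k -> sv (kf t) @[t --> F] --> sv k.
Proof.
move=> hk hkf; have n0 := one_mk2_neq0 hk.
apply: cvgM; first by apply: cvgM => //; exact: cvg_cst.
apply: cvgV => //; apply: cvgB; first exact: cvg_cst.
by rewrite expr2; under eq_fun do rewrite expr2; exact: cvgM.
Qed.

Lemma cvg_ell bf kf b k : `|k| < 1 -> `|sv k| < 1 -> `|uv b k| < 1 ->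
  bf t @[t --> F] --> b -> kf t @[t --> F] --> k ->
  ell (bf t) (kf t) @[t --> F] --> ell b k.
Proof.
move=> hk hs hu hb hkf; have csv := cvg_sv hk hkf.
have csv3 : sv (kf t) ^+ 3 @[t --> F] --> sv k ^+ 3.
  under eq_fun do rewrite !exprS expr0 mulr1.
  by rewrite !exprS expr0 mulr1; apply: cvgM => //; exact: cvgM.
have cuv : uv (bf t) (kf t) @[t --> F] --> uv b k.
  apply: cvgB; last by apply: cvgM => //; exact: cvg_cst.
  by apply: cvgM => //; apply: cvgD => //; exact: cvg_cst.
have cln (g : T -> R) (l : R) : `|l| < 1 -> g t @[t --> F] --> l ->
    ln (1 + g t) @[t --> F] --> ln (1 + l).
  rewrite ltr_norml => /andP[l1 _] hg.
  have c : {for 1 + l, continuous (@ln R)} by apply: continuous_ln; rewrite -ltrBlDl sub0r.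
  have h1 : 1 + g t @[t --> F] --> 1 + l by apply: cvgD => //; exact: cvg_cst.
  exact: cvg_comp h1 c.
by apply: cvgD; [exact: cvg_cst|apply: cvgB; exact: cln].
Qed.

Lemma cvg_branch bf kf b k : `|k| < 1 -> `|sv k| < 1 -> `|uv b k| < 1 ->
  bf t @[t --> F] --> b -> kf t @[t --> F] --> k ->
  branch (bf t) (kf t) @[t --> F] --> branch b k.
Proof.
move=> hk hs hu hb hkf; have csv := cvg_sv hk hkf; have cell := cvg_ell hk hs hu hb hkf.
have k2 : 1 - k != 0.
  by move: hk; rewrite ltr_norml => /andP[_]; rewrite -subr_gt0 => /lt0r_neq0.
have c0 : Num.sqrt D * ((1 + kf t) / (1 - kf t)) * ell (bf t) (kf t) @[t --> F] -->
    Num.sqrt D * ((1 + k) / (1 - k)) * ell b k.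
  apply: cvgM => //; apply: cvgM; first exact: cvg_cst.
  apply: cvgM; first by apply: cvgD => //; exact: cvg_cst.
  by apply: cvgV => //; apply: cvgB => //; exact: cvg_cst.
have c1 : 2 * Num.sqrt D * sv (kf t) @[t --> F] --> 2 * Num.sqrt D * sv k.
  by apply: cvgM => //; exact: cvg_cst.
apply: cvg_rV => i; rewrite /branch mxE; under eq_fun do rewrite mxE.
by case: i => -[|[|[|//]]] hi /=.
Qed.

End cvg.

Lemma continuous_eqn (b k : R) : `|k| < 1 -> `|sv k| < 1 -> `|uv b k| < 1 ->
  {for b, continuous (eqn^~ k)}.
Proof.
move=> hk hs hu.
have c (x : R) : `|x| < 1 -> `|sv x| < 1 -> `|uv b x| < 1 ->
    (1 + x) ^+ 2 * ell t x @[t --> b] --> (1 + x) ^+ 2 * ell b x.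
  move=> hx hsx hux; apply: cvgM; first exact: cvg_cst.
  by apply: (cvg_ell _ hx hsx hux); [exact: cvg_id|exact: cvg_cst].
by apply: cvgB; apply: c; rewrite ?svN ?uvN ?normrN.
Qed.

(** With [y = sg * b] as parameter and the equation multiplied by [sg], both signs of the leading
    coefficient reduce to the single orientation of [pitchfork_root]. *)
Lemma branch_roots : exists (sg k1 d : R) (K : R -> R),
  [/\ sg = 1 \/ sg = - 1,
      [/\ 0 < k1 < 1, 0 < d <= 1 & forall b k : R, `|b| <= 1 -> `|k| <= k1 ->
        `|sv k| < 1 /\ `|uv b k| < 1],
      forall b k : R, `|b| <= 1 -> 0 < k <= k1 -> sg * b <= 0 -> eqn b k != 0,
      K 0 = 0 /\ {within [set y : R | 0 <= y < d], continuous K} &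
      forall b : R, 0 < sg * b < d -> 0 < K (sg * b) < k1 /\
        forall k : R, 0 < k <= k1 -> (eqn b k = 0 <-> k = K (sg * b))].
Proof.
have [sg [hsg hA]] := branch_sign.
have sg2 x : sg * (sg * x) = x by case: hsg => ->; ring.
have nsg x : `|sg * x| = `|x| by case: hsg => ->; rewrite ?mulN1r ?normrN ?mul1r.
have [d1 /andP[d10 d11] hsm] := sv_uv_lt1 Lam gam.
have [|k2 /andP[k20 k21] hk2] := odd_germ_pos (eqn_germ Lam gam) _ hsg hA.
  by rewrite pnatr_eq0.
have hA' : 0 < sg * A3 Lam gam \/ A3 Lam gam = 0 /\ 0 < sg * (3 * A5 Lam gam).
  case: hA => [|[h1 h2]]; [by left|right; split => //].
  by rewrite mulrCA mulr_gt0.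
have [|k3 /andP[k30 k31] hk3] := odd_germ_pos (deqn_germ Lam gam) _ hsg hA'.
  by rewrite oppr_eq0 pnatr_eq0.
pose k1 := Num.min d1 (Num.min k2 k3).
have k10 : 0 < k1 by rewrite !lt_min d10 k20.
have k1d : k1 <= d1 by rewrite ge_min lexx.
have k12 : k1 <= k2 by rewrite !ge_min lexx orbT.
have k13 : k1 <= k3 by rewrite !ge_min lexx !orbT.
have k11 : k1 < 1 by exact: le_lt_trans d11.
have hsm1 (b k : R) : `|b| <= 1 -> `|k| <= k1 -> `|sv k| < 1 /\ `|uv b k| < 1.
  by move=> hb hk; apply: hsm => //; exact: le_trans k1d.
have kn (k : R) : 0 < k <= k1 -> `|k| <= k1 by move=> /andP[k0 ?]; rewrite gtr0_norm.
have pos (b k : R) : `|b| <= 1 -> 0 < k <= k1 -> sg * b <= 0 -> 0 < sg * eqn b k.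
  move=> hb /andP[k0 kk] sb; apply: hk2 => //; first by rewrite k0 (le_trans kk).
  by rewrite mulrAC pmulr_lle0.
have [|||||d [K [hd0 K0 hK cK]]] := @pitchfork_root R (fun y k => sg * eqn (sg * y) k) k1 k10.
- move=> y k /andP[y1 y0] hk; apply: pos; rewrite ?sg2 // nsg ler_norml y1.
  exact: le_trans y0 ler01.
- move=> y /andP[y0 y1].
  apply: odd_germ_near0 (eqn_germ Lam gam) hsg _ _; first by rewrite nsg gtr0_norm.
  by rewrite mulrAC sg2 mulr_gt0.
- move=> y k k' /andP[y0 y1] k0 kk' k'1.
  apply: (@eqn_div_mono R Lam gam (sg * y) k1 sg) => //.
    by move=> t ht; apply: hsm1; rewrite // nsg gtr0_norm.
  move=> t /andP[t0 t1]; apply: hk3; rewrite ?t0 ?nsg ?gtr0_norm ?(le_trans t1) //.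
  by rewrite mulrAC sg2 mulrN oppr_le0 ltW // mulr_gt0.
- move=> y k /andP[y0 y1] hk.
  have hy : `|sg * y| <= 1 by rewrite nsg ler_norml !ltW.
  have [hs hu] := hsm1 _ _ hy (kn k hk).
  have hk1 : `|k| < 1 by exact: le_lt_trans (kn k hk) k11.
  have c := continuous_eqn hk1 hs hu.
  apply: cvgM; first exact: cvg_cst.
  have c' : sg * t @[t --> y] --> sg * y by apply: cvgM; [exact: cvg_cst|exact: cvg_id].
  exact: cvg_comp c' c.
- move=> y k /andP[y0 y1] hk.
  have hy : `|sg * y| <= 1 by rewrite nsg gtr0_norm // ltW.
  have [hs hu] := hsm1 _ _ hy (kn k hk).
  have hk1 : `|k| < 1 by exact: le_lt_trans (kn k hk) k11.
  apply: cvgM; first exact: cvg_cst.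
  exact: is_derive_continuous (is_derive_eqn hk1 hs hu).
exists sg, k1, d, K; split => //.
- by rewrite k10.
- by move=> b k hb hk sb; apply: contraTneq (pos b k hb hk sb) => ->; rewrite mulr0 ltxx.
- move=> b hb; have [h1 h2] := hK _ hb; split => // k hk; rewrite -h2 // sg2.
  split => [->|]; first by rewrite mulr0.
  by move=> h; rewrite -[eqn b k]sg2 h mulr0.
Qed.

(** The radius [eps] is fixed before the parameter range: through [kof_props] it confines [k] to
    [k1] for every stationary point in the ball, and [branch] then determines [h]. The range of [mu]
    is shrunk afterwards, by continuity of the branches at [td], to keep both of them in that
    ball. *)
Lemma pulse_pitchfork :
  pitchfork_bifurcation (pulse_field D delta0) p (tau_d D delta0).
Proof.
split; first exact: crossing_d.
have [sg [k1 [d [K [hsg [/andP[k10 k11] /andP[d0 d1] hsm] hneg [K0 cK] hK]]]]] := branch_roots.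
have sg2 x : sg * (sg * x) = x by case: hsg => ->; ring.
have nsg x : `|sg * x| = `|x| by case: hsg => ->; rewrite ?mulN1r ?normrN ?mul1r.
have s0 := sqrtD_gt0 hD; have r0 := rate_gt0.
set td := tau_d D delta0.
have yE mu : sg * unfolding mu = rate * (- sg * (mu - td)) by rewrite unfoldingE // -/td; ring.
pose eps := 4 * Num.sqrt D * k1; pose d' := d / rate.
have e0 : 0 < eps by rewrite !mulr_gt0.
have d'0 : 0 < d' by rewrite divr_gt0.
pose A := [set mu | 0 <= - sg * (mu - td) < d'].
have AB mu : A mu -> 0 <= sg * unfolding mu < d.
  by move=> /andP[h1 h2]; rewrite yE mulr_ge0 ?(ltW r0) // [rate * _]mulrC -ltr_pdivlMr.
have Kk1 mu : A mu -> 0 <= K (sg * unfolding mu) < k1.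
  move=> /AB /andP[]; rewrite le_eqVlt => /orP[/eqP<- _|h1 h2]; first by rewrite K0 lexx.
  by have [] := hK (unfolding mu); [rewrite h1|move=> /andP[/ltW -> ->]].
have cbb : continuous unfolding.
  move=> mu; rewrite (_ : unfolding = fun t => - rate * (t - td)); last first.
    by apply/funext => t; exact: unfoldingE.
  apply: cvgM; first exact: cvg_cst.
  by apply: cvgB; [exact: cvg_id|exact: cvg_cst].
have bb_small mu : `|mu - td| < d' -> `|unfolding mu| <= 1.
  move=> h; rewrite unfoldingE // -/td normrM normrN (gtr0_norm r0) mulrC.
  by apply: ltW; apply: lt_le_trans d1; rewrite -ltr_pdivlMr.
have normA mu : A mu -> `|mu - td| < d'.
  by move=> /andP[h1 h2]; rewrite -[`|_|]nsg -normrN -mulNr ger0_norm.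
pose xb (e mu : R) := branch (unfolding mu) (e * K (sg * unfolding mu)).
have cK' : {within A, continuous (fun mu => K (sg * unfolding mu))}.
  apply: (@within_continuous_comp R A [set y | 0 <= y < d] K (fun mu => sg * unfolding mu)) => //.
  by move=> mu; apply: cvgM; [exact: cvg_cst|exact: cbb].
have cxb (e mu : R) : `|e| = 1 -> A mu ->
    xb e t @[t --> within A (nbhs mu)] --> xb e mu.
  move=> he Amu; have /andP[h1 h2] := Kk1 mu Amu.
  have hk : `|e * K (sg * unfolding mu)| < k1 by rewrite normrM he mul1r ger0_norm.
  have [hs hu] := hsm (unfolding mu) _ (bb_small mu (normA mu Amu)) (ltW hk).
  apply: (cvg_branch _ (lt_trans hk k11) hs hu).
    by apply: cvg_within_filter; exact: cbb.
  apply: cvgM; first exact: cvg_cst.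
  by move/subspace_continuousP : cK' => /(_ mu Amu).
have xb0 e : xb e td = p by rewrite /xb unfoldingE // -/td subrr !mulr0 K0 mulr0 branch0.
have Atd : A td by rewrite /A /= subrr mulr0 lexx.
have nearp (e : R) : `|e| = 1 -> exists2 dl : R, 0 < dl &
    forall mu, `|mu - td| < dl -> A mu -> ball p eps (xb e mu).
  move=> he; have : \forall t \near within A (nbhs td), ball (xb e td) eps (xb e t).
    exact: (cxb e td he Atd _ (nbhsx_ballx _ _ e0)).
  rewrite xb0 near_withinE => /nbhs_ballP[dl dl0 h]; exists dl => // mu hm.
  by apply: h; rewrite /ball /= distrC.
have [dp dp0 hp] := nearp 1 (normr1 _).
have [dm dm0 hm] := nearp (-1) (normrN1 _).
pose dl := Num.min d' (Num.min dp dm).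
have dld : dl <= d' by rewrite ge_min lexx.
have subA : [set mu | 0 <= - sg * (mu - td) < dl] `<=` A.
  by move=> mu /andP[h1 h2]; rewrite /A /= h1 (lt_le_trans h2).
(* [unfolding] decreases in [tau], so the branches at [sg * b > 0] lie on the side [- sg] of
   [tau_d]. *)
exists (- sg), dl, eps, (xb 1), (xb (-1)); split => //.
- by case: hsg => ->; [right|left; rewrite opprK].
- by rewrite !lt_min d'0 dp0 dm0.
- by split; apply: (continuous_subspaceW subA); apply/subspace_continuousP => mu;
    apply: cxb; rewrite ?normrN normr1.
have pstat mu : stationary (pulse_field D delta0 mu) p by apply/stationaryP; exact: pulse_field_pstar.
have pball : ball p eps p by exact: ballxx.
have dich mu x : `|unfolding mu| <= 1 -> ball p eps x -> stationary (pulse_field D delta0 mu) x ->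
    exists2 k : R, `|k| <= k1 & eqn (unfolding mu) k = 0 /\ x = branch (unfolding mu) k.
  move=> hb hx /stationaryP hs; have [h1 h2 h3] := kof_props (x 0 1).
  have hk : `|kof (x 0 1)| <= k1.
    apply: le_trans h2 _; rewrite ler_pdivrMr ?mulr_gt0 // mulrC -/eps.
    move: hx; rewrite -ball_normE /= => /ltW; apply: le_trans.
    by have := rV_coord_le (p - x) 1; rewrite !mxE /= sub0r normrN.
  have [hs' hu] := hsm (unfolding mu) _ hb hk.
  exists (kof (x 0 1)) => //.
  by apply/(stationary_branch h1 hs' hu h3).
move=> mu hmu.
have hmu' : `|mu - td| < d' by exact: lt_le_trans dld.
have hb := bb_small mu hmu'.
split=> hs.
- apply/seteqP; split=> x /=; last by move=> ->; split.
  move=> [hx /(dich _ _ hb hx)[k hk [E ->]]].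
  have hy : sg * unfolding mu <= 0 by rewrite yE pmulr_rle0.
  have [k0|k0|k0] := ltgtP k 0.
  + have := hneg (unfolding mu) (- k) hb; rewrite oppr_gt0 k0 -(ltr0_norm k0) hk => /(_ isT hy).
    by rewrite (ltr0_norm k0) eqnN E oppr0 eqxx.
  + have := hneg (unfolding mu) k hb; rewrite k0 -(gtr0_norm k0) hk => /(_ isT hy).
    by rewrite (gtr0_norm k0) E eqxx.
  + by rewrite k0 branch0.
have Amu : A mu by rewrite /A /= (ltW hs) (le_lt_trans _ hmu') // -(nsg (mu - td)) -normrN -mulNr ler_norm.
have hy : 0 < sg * unfolding mu < d.
  by have /andP[_ ->] := AB mu Amu; rewrite andbT yE mulr_gt0.
have [/andP[Kp Kk] hroot] := hK _ hy.
have EK : eqn (unfolding mu) (K (sg * unfolding mu)) = 0 by apply/hroot; rewrite ?Kp ?ltW.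
have svp : 0 < sv (K (sg * unfolding mu)).
  rewrite /sv divr_gt0 ?mulr_gt0 // subr_gt0 expr_lt1 ?ltW //.
  exact: lt_trans k11.
have x1 e : xb e mu 0 1 = 2 * Num.sqrt D * sv (e * K (sg * unfolding mu)) by rewrite state1.
have c0 : 0 < 2 * Num.sqrt D * sv (K (sg * unfolding mu)).
  by rewrite mulr_gt0 // mulr_gt0.
have ne (x y : 'rV[R]_3) : y 0 1 < x 0 1 -> x != y.
  by move=> h; apply: contraTneq h => ->; rewrite ltxx.
have xbstat e : e = 1 \/ e = -1 -> stationary (pulse_field D delta0 mu) (xb e mu).
  move=> he; apply/stationaryP.
  have hk : `|e * K (sg * unfolding mu)| <= k1.
    by case: he => ->; rewrite ?mulN1r ?normrN ?mul1r gtr0_norm // ltW.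
  have [hs' hu] := hsm (unfolding mu) _ hb hk.
  apply/(stationary_branch (le_lt_trans hk k11) hs' hu (x1 e)); split => //.
  by case: he => ->; rewrite ?mulN1r ?eqnN ?[1 * K _]mul1r EK ?oppr0.
split.
- by apply: ne; rewrite x1 state1 mul1r.
- by rewrite eq_sym; apply: ne; rewrite x1 state1 mulN1r svN mulrN oppr_lt0.
- apply: ne; rewrite !x1 mul1r mulN1r svN mulrN; apply: (lt_trans _ c0).
  by rewrite oppr_lt0.
apply/seteqP; split=> x /=.
- move=> [hx /(dich _ _ hb hx)[k hk [E ->]]].
  have [k0|k0|k0] := ltgtP k 0.
  + right; rewrite /xb mulN1r; have/hroot[h _] : 0 < - k <= k1.
      by rewrite oppr_gt0 k0 -(ltr0_norm k0).
    by rewrite -h ?opprK // eqnN E oppr0.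
  + left; right; rewrite /xb mul1r; have/hroot[h _] : 0 < k <= k1.
      by rewrite k0 -(gtr0_norm k0).
    by rewrite -h.
  + by left; left; rewrite k0 branch0.
- have md (q : R) : dl <= q -> `|mu - td| < q by exact: lt_le_trans.
  move=> [[->|->]|->]; split => //; try by apply: xbstat; auto.
  + by apply: hp => //; apply: md; rewrite !ge_min lexx !orbT.
  + by apply: hm => //; apply: md; rewrite !ge_min lexx !orbT.
Qed.

End pitchfork.

Theorem proposition2 (R : realType) (D delta0 : R)
    (hD : 0 < D) (hdelta0 : 0 < delta0 < 1 / 2) :
  (forall tau : R,
     stationary (pulse_field D delta0 tau) (state (hstar D delta0) 0 0)) /\
  pitchfork_bifurcation (pulse_field D delta0) (state (hstar D delta0) 0 0)
    (tau_d D delta0) /\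
  hopf_bifurcation (pulse_field D delta0) (state (hstar D delta0) 0 0)
    (tau_H D delta0).
Proof.
split; first by move=> tau; apply/stationaryP; exact: pulse_field_pstar.
split; [exact: pulse_pitchfork|exact: pulse_hopf].
Qed.
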